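(* Let $p\ge q\ge1$ be integers. Let $A_0(z),A_1(z),\dots,A_k(z)$ be entire functions and suppose there exists an integer $l$ $(0\le l\le k)$ such that $$\max\{\rho_{A_j}(p,q): j=0,1,\dots,k,\ j\ne l\}\le\rho_{A_l}(p,q),$$ $$\max\{\tau_{A_j}(p,q): \rho_{A_j}(p,q)=\rho_{A_l}(p,q),\ j\neq l\}<\tau_{A_l}(p,q),$$ where $0<\rho_{A_l}(p,q)<\infty$ and $0<\tau_{A_l}(p,q)<\infty$. Then every meromorphic solution $f\not\equiv0$ of $$A_k(z)f(z+c_k)+A_{k-1}(z)f(z+c_{k-1})+\cdots+A_1(z)f(z+c_1)+A_0(z)f(z)=0$$ satisfies $\rho_f(p,q)\ge\rho_{A_l}(p,q)$.
   Context: Meromorphic means meromorphic in $\mathbb{C}$; $T(r,f)$ is the Nevanlinna characteristic and $M(r,f)$ the maximum modulus. Iterated logarithms: $\log_0 r=r$, $\log_1 r=\log r$, $\log_{n+1}r=\log(\log_n r)$ for large $r$. The $(p,q)$-order of a transcendental meromorphic function $f$ is $\rho_f(p,q)=\limsup_{r\to\infty}\frac{\log_p T(r,f)}{\log_q r}$; if $f$ is transcendental entire, $\rho_f(p,q)=\limsup_{r\to\infty}\frac{\log_{p+1}M(r,f)}{\log_q r}$. For a rational function $\rho_f(p,q)=0$. The $(p,q)$-type of a meromorphic function $f$ with nonzero finite $(p,q)$-order is $\tau_f(p,q)=\limsup_{r\to\infty}\frac{\log_{p-1}T(r,f)}{(\log_{q-1}r)^{\rho_f(p,q)}}$; if $f$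 is transcendental entire, $\tau_f(p,q)=\limsup_{r\to\infty}\frac{\log_p M(r,f)}{(\log_{q-1}r)^{\rho_f(p,q)}}$. A condition on the maximum over an empty set is regarded as vacuous. Standing assumptions on the equation: $k\ge2$, the coefficients $A_0,\dots,A_k$ are not identically zero, and $c_1,\dots,c_k$ are distinct nonzero complex numbers. *)

(* Defs.v *)
From HB Require Import structures.
From mathcomp Require Import all_boot all_order all_algebra.
From mathcomp Require Import complex.
From mathcomp Require Import all_classical all_reals all_analysis.

Set Implicit Arguments.
Unset Strict Implicit.
Unset Printing Implicit Defensive.

Import Order.TTheory GRing.Theory Num.Theory.
Import numFieldNormedType.Exports.

Local Open Scope classical_set_scope.
Local Open Scope ring_scope.

Section Meromorphic.
Variable R : realType.
Local Notation C := R[i].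
Implicit Types (f g : C -> C) (a z : C).

(* [derivable] is instantiated with scalar field [C], so this is complex
   differentiability. *)
Definition complex_differentiable f a : Prop :=
  derivable (f : C^o -> C^o) (a : C^o) (1 : C^o).

Definition holomorphic_at f a : Prop :=
  \forall z \near (a : C^o), complex_differentiable f z.

Definition entire f : Prop := forall z, complex_differentiable f z.

Definition has_pole_of_order f a (n : nat) : Prop :=
  (0 < n)%N /\
  exists g, [/\ holomorphic_at g a, g a != 0 &
    \forall z \near (a : C^o), z != a -> f z = g z / (z - a) ^+ n].

Definition has_pole f a : Prop := exists n, has_pole_of_order f a n.

(* A meromorphic function is a total function whose values at its poles are
   arbitrary; no definition below depends on them. At every point that is not
   a pole the function is genuinely holomorphic. *)
Definition meromorphic f : Prop :=
  forall a, holomorphic_at f a \/ has_pole f a.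

Definition pole_order f a : nat := xget 0%N [set n | has_pole_of_order f a n].

Definition rational_function f : Prop :=
  exists P Q : {poly C}, Q != 0 /\
    forall z, Q.[z] != 0 -> f z = P.[z] / Q.[z].

End Meromorphic.

Section Nevanlinna.
Variable R : realType.
Local Notation C := R[i].
Local Notation modulus := (@ComplexField.Normc.normc R).
Local Notation mu := (@lebesgue_measure R).
Implicit Types (f : C -> C) (r t theta : R).

Definition circle_point r theta : C := ((r * cos theta) +i* (r * sin theta))%C.

Definition log_plus t : R := Num.max 0 (ln t).

Definition proximity f r : R :=
  (pi *+ 2)^-1 * \int[mu]_(theta in `[0, pi *+ 2])
                    log_plus (modulus (f (circle_point r theta))).

(* The sum has finite support whenever [f] is meromorphic. *)
Definition pole_count f t : R :=
  \sum_(a \in [set a : C | modulus a <= t]) ((pole_order f a)%:R : R).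

Definition pole_counting f r : R :=
  \int[mu]_(t in `]0, r]) ((pole_count f t - pole_count f 0) / t)
  + pole_count f 0 * ln r.

Definition nevanlinna_T f r : R := proximity f r + pole_counting f r.

Definition max_modulus f r : R :=
  sup [set modulus (f z) | z in [set z | modulus z = r]].

(* [ln] is total, with value 0 on nonpositive reals; this only affects small
   arguments, hence none of the upper limits at infinity below. *)
Definition iterated_log (n : nat) t : R := iter n (@ln R) t.

Definition limsup_infty (u : R -> R) : \bar R :=
  limf_esup (fun r => (u r)%:E) +oo%R.

(* The entire case uses the maximum modulus. For the order this agrees with
   the formula in terms of the characteristic; for the type the two formulas
   differ when [p = 1]. *)
Definition pq_order (p q : nat) f : \bar R :=
  if `[< rational_function f >] then 0%E
  else if `[< entire f >] then
    limsup_infty (fun r =>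
      iterated_log p.+1 (max_modulus f r) / iterated_log q r)
  else
    limsup_infty (fun r =>
      iterated_log p (nevanlinna_T f r) / iterated_log q r).

(* Meaningful when [1 <= p], [1 <= q] and [pq_order p q f] is positive and
   finite; in particular [f] is then transcendental. *)
Definition pq_type (p q : nat) f : \bar R :=
  let rho := fine (pq_order p q f) in
  if `[< entire f >] then
    limsup_infty (fun r =>
      iterated_log p (max_modulus f r) / (iterated_log q.-1 r) `^ rho)
  else
    limsup_infty (fun r =>
      iterated_log p.-1 (nevanlinna_T f r) / (iterated_log q.-1 r) `^ rho).

End Nevanlinna.

(* Main.v *)
Require Import Defs.
From HB Require Import structures.
From mathcomp Require Import all_boot all_order all_algebra.
From mathcomp Require Import complex.
From mathcomp Require Import all_classical all_reals all_analysis.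
From mathcomp Require Import measurable_realfun ring lra.

Set Implicit Arguments.
Unset Strict Implicit.
Unset Printing Implicit Defensive.

Import Order.TTheory GRing.Theory Num.Theory.
Import numFieldNormedType.Exports.

Local Open Scope classical_set_scope.
Local Open Scope ring_scope.

(** Suppose that the order of [f] is smaller than [rho], the order of [A l]. The
    equation expresses [A l] through the other coefficients and the quotients
    [f (z + c j) / f (z + c l)]. The other coefficients grow less than [A l],
    because their order is at most [rho] and their type is smaller when the
    order is [rho]; and the quotients should not matter, as their growth is
    governed by the characteristic of [f], which has order below [rho]. The
    work lies in the quotients, since [f] may have zeros and poles anywhere.

    No exceptional set of radii is needed, as an averaging argument avoids the
    zeros. Multiplication by a polynomial clears the poles in a disc of radius
    [S] ([clear_poles]) and turns the translates of [f] into holomorphic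
    functions [G j] with [\sum_j A j * G j = 0] and [|G j| <= exp B], where [B]
    is controlled by the proximity function and by the number of poles of [f]
    ([cleared_bound]). Let [phi = B - ln |G l|], which is nonnegative. On a
    circle slightly larger than the given one the equation yields
    [ln |A l| <= K1 + phi], with [K1] bounding the other coefficients. Inside
    the circle the Poisson inequality replaces [phi] by a multiple of its mean
    ([poisson_upper]), and the opposite Poisson inequality at one fixed point
    where [f] neither vanishes nor has a pole bounds this mean by a multiple
    of [B] ([poisson_lower]). The outcome is [coefficient_estimate].

    It remains to compare growths. The circle is enlarged by a factor [1 + e] so
    small that the gap between the types survives ([power_margin],
    [iterated_log_scale]). The number of poles enters with a factor [ln r], and
    [q <= p] ensures that it is absorbed by a [(p - 1)]-fold exponential of a
    power of [log_{q-1} r] ([ln_le_iterated], [growth_comparison]). A radius at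
    which [A l] nearly attains its type then gives a contradiction.

    Both Poisson inequalities come from the maximum principle. A finite sum [Q]
    of Herglotz kernels [(t + z) / (t - z)], with [t] running through equally
    spaced points of a slightly larger circle, has a real part that dominates
    the given boundary function, so [F * exp (- Q)] is bounded
    ([modulus_le_herglotz_sum]); as the number of points grows, Riemann sums turn
    [Q] into circle means. The maximum principle itself rests on the mean value
    property, which in logarithmic coordinates is Goursat's theorem on a
    rectangle ([goursat_rectangle]), combined with the Moebius maps of the
    disc. *)

(** * Goursat on a rectangle *)

Section RealGoursat.
Variable R : realType.
Local Notation mu := (@lebesgue_measure R).
Implicit Types (g : R -> R) (a b c d e x y w k X Y p q s t : R).

Definition segment_continuous a b g :=
  forall x, a <= x <= b -> {for x, continuous g}.

Lemma segment_continuous_integrable a b g : segment_continuous a b g ->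
  mu.-integrable `[a, b] (EFin \o g).
Proof.
move=> cg; apply: continuous_compact_integrable; first exact: segment_compact.
by apply: continuous_in_subspaceT => x; rewrite inE /= in_itv /=; exact: cg.
Qed.

Local Notation int a b g := (\int[mu]_(x in `[a, b]) g x).

Lemma segment_integral_split a b c g : segment_continuous a b g ->
  a <= c -> c <= b -> int a b g = int a c g + int c b g.
Proof.
move=> cg ac cb; apply/eqP; rewrite addrC -subr_eq; apply/eqP.
rewrite (@Rintegral_itvB _ g (BLeft a) (BRight b) c) ?bnd_simp//; last first.
  exact: segment_continuous_integrable.
rewrite Rintegral_itv_obnd_cbnd//.
apply: integrableS (segment_continuous_integrable cg) => //.
by apply: subset_itvr; rewrite bnd_simp.
Qed.

Lemma segment_integral_cst a b c : a <= b -> int a b (fun=> c) = c * (b - a).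
Proof.
move=> ab; rewrite Rintegral_cst//= lebesgue_measure_itv/= lte_fin.
by move: ab; rewrite le_eqVlt => /predU1P[->|->//]; rewrite ltxx subrr.
Qed.

Lemma segment_integral_le a b g h : segment_continuous a b g ->
  segment_continuous a b h -> (forall x, a <= x <= b -> g x <= h x) ->
  int a b g <= int a b h.
Proof.
move=> cg ch gh; apply: le_Rintegral => //; try exact: segment_continuous_integrable.
Qed.

Lemma segment_integral_sub a b g h : segment_continuous a b g ->
  segment_continuous a b h ->
  int a b (fun x => g x - h x) = int a b g - int a b h.
Proof.
by move=> cg ch; apply: RintegralB => //; exact: segment_continuous_integrable.
Qed.

Lemma segment_integral_near_cst a b c e g : a <= b -> segment_continuous a b g ->
  (forall x, a <= x <= b -> `|g x - c| <= e) ->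
  `|int a b g - c * (b - a)| <= e * (b - a).
Proof.
move=> ab cg ge.
have cc d : segment_continuous a b (fun=> d) by move=> x _; exact: cst_continuous.
rewrite ler_distl; apply/andP; split.
- have : int a b (fun=> c - e) <= int a b g.
    by apply: segment_integral_le => // x /ge; rewrite ler_distl => /andP[].
  by rewrite segment_integral_cst// mulrBl.
- have : int a b g <= int a b (fun=> c + e).
    by apply: segment_integral_le => // x /ge; rewrite ler_distl => /andP[].
  by rewrite segment_integral_cst// mulrDl.
Qed.

Definition planar_differential (u : R -> R -> R) (x y a b : R) : Prop :=
  forall e, 0 < e -> exists2 d : R, 0 < d &
    forall h k : R, `|h| < d -> `|k| < d ->
      `|u (x + h) (y + k) - u x y - (a * h + b * k)| <= e * (`|h| + `|k|).

Lemma planar_differential_continuous1 (u : R -> R -> R) (x y a b : R) :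
  planar_differential u x y a b -> {for x, continuous (fun t => u t y)}.
Proof.
move=> /(_ 1 ltr01)[d d0 ud]; apply/cvgrPdist_lt => e e0.
near=> t.
have td : `|t - x| < d.
  by rewrite distrC; near: t; apply: cvgr_dist_lt.
have := ud (t - x) 0 td; rewrite normr0 !addr0 mulr0 addr0 mul1r [x + _]addrC subrK.
move=> /(_ d0) H; rewrite distrC.
rewrite -[u t y - u x y](subrK (a * (t - x))).
apply: (le_lt_trans (ler_normD _ _)); rewrite normrM.
have : `|t - x| < e / (2 + `|a|).
  rewrite distrC; near: t; apply: cvgr_dist_lt => //.
  by apply: divr_gt0 => //; rewrite ltr_wpDr.
rewrite ltr_pdivlMr ?ltr_wpDr// => H2.
apply: (le_lt_trans (lerD H (lexx _))); apply: le_lt_trans H2.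
by rewrite mulrDr mulr2n mulrDr mulr1 [`|a| * _]mulrC lerD2r ler_wpDr.
Unshelve. all: by end_near. Qed.

Lemma planar_differential_swap (u : R -> R -> R) (x y a b : R) :
  planar_differential u x y a b ->
  planar_differential (fun y x => u x y) y x b a.
Proof.
move=> ud e e0; have [d d0 H] := ud e e0; exists d => // h k hd kd.
by have := H k h kd hd; rewrite [a * k + _]addrC [`|k| + _]addrC.
Qed.

Lemma planar_differential_continuous2 (u : R -> R -> R) (x y a b : R) :
  planar_differential u x y a b -> {for y, continuous (u x)}.
Proof. by move=> /planar_differential_swap/planar_differential_continuous1. Qed.

(** The imaginary part of the integral of [u + i v] along the boundary of a
    rectangle; circle means of real parts require no more of Cauchy's theorem. *)
Definition boundary_flux (u v : R -> R -> R) (x y w h : R) : R :=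
  int y (y + h) (fun t => u (x + w) t - u x t) -
  int x (x + w) (fun t => v t (y + h) - v t y).

Section Goursat.
Variables (u v : R -> R -> R) (x0 y0 w0 h0 : R).
Hypotheses (w0_ge0 : 0 <= w0) (h0_ge0 : 0 <= h0).
Hypothesis uv : forall x y, x0 <= x <= x0 + w0 -> y0 <= y <= y0 + h0 ->
  exists a b c, planar_differential u x y a b /\ planar_differential v x y c a.

Let u_cont2 x a b : x0 <= x <= x0 + w0 -> y0 <= a -> b <= y0 + h0 ->
  segment_continuous a b (u x).
Proof.
move=> xi ya yb y /andP[ay yb']; have [||? [?] [?] [+ _]] := @uv x y => //.
  by rewrite (le_trans ya ay) (le_trans yb' yb).
exact: planar_differential_continuous2.
Qed.

Let v_cont1 y a b : y0 <= y <= y0 + h0 -> x0 <= a -> b <= x0 + w0 ->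
  segment_continuous a b (fun t => v t y).
Proof.
move=> yi xa xb x /andP[ay yb']; have [||? [?] [?] [_ +]] := @uv x y => //.
  by rewrite (le_trans xa ay) (le_trans yb' xb).
exact: planar_differential_continuous1.
Qed.

Let flux := boundary_flux u v.

(** The sides interior to the large rectangle are run through twice, in
    opposite directions. *)
Let flux_split x y w (h : R) : 0 <= w -> 0 <= h -> x0 <= x -> y0 <= y ->
  x + (w + w) <= x0 + w0 -> y + (h + h) <= y0 + h0 ->
  flux x y (w + w) (h + h) =
    flux x y w h + flux (x + w) y w h + flux x (y + h) w h
    + flux (x + w) (y + h) w h.
Proof.
move=> w_ge0 h_ge0 x0x y0y xw yh; rewrite /flux /boundary_flux.
rewrite !addrA in xw yh *.
have xs t : x <= t <= x + w + w -> x0 <= t <= x0 + w0.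
  by move=> /andP[? ?]; apply/andP; split; lra.
have ys t : y <= t <= y + h + h -> y0 <= t <= y0 + h0.
  by move=> /andP[? ?]; apply/andP; split; lra.
have U t : x <= t <= x + w + w -> [/\ segment_continuous y (y + h + h) (u t),
    segment_continuous y (y + h) (u t) &
    segment_continuous (y + h) (y + h + h) (u t)].
  by move=> /xs tx; split; apply: u_cont2 => //; lra.
have V t : y <= t <= y + h + h ->
    [/\ segment_continuous x (x + w + w) (fun x => v x t),
    segment_continuous x (x + w) (fun x => v x t) &
    segment_continuous (x + w) (x + w + w) (fun x => v x t)].
  by move=> /ys ty; split; apply: v_cont1 => //; lra.
have [U1 [U2 U3]] : x <= x <= x + w + w /\ x <= x + w <= x + w + w /\
  x <= x + w + w <= x + w + w by split; [|split]; lra.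
have [V1 [V2 V3]] : y <= y <= y + h + h /\ y <= y + h <= y + h + h /\
  y <= y + h + h <= y + h + h by split; [|split]; lra.
have /U[? ? ?] := U1; have /U[? ? ?] := U2; have /U[? ? ?] := U3.
have /V[? ? ?] := V1; have /V[? ? ?] := V2; have /V[? ? ?] := V3.
rewrite !segment_integral_sub//.
have yh1 : y <= y + h by lra.
have yh2 : y + h <= y + h + h by lra.
have xw1 : x <= x + w by lra.
have xw2 : x + w <= x + w + w by lra.
rewrite (@segment_integral_split y (y + h + h) (y + h) (u (x + w + w)))//.
rewrite (@segment_integral_split y (y + h + h) (y + h) (u x))//.
rewrite (@segment_integral_split x (x + w + w) (x + w) (fun t => v t (y + h + h)))//.
rewrite (@segment_integral_split x (x + w + w) (x + w) (fun t => v t y))//.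
by ring.
Qed.

Let corner (n : nat) (ij : bool * bool) (z : R * R) : R * R :=
  (z.1 + ij.1%:R * (w0 / 2 ^+ n.+1), z.2 + ij.2%:R * (h0 / 2 ^+ n.+1)).

Let flux_at n (z : R * R) := flux z.1 z.2 (w0 / 2 ^+ n) (h0 / 2 ^+ n).

Let half_size (t : R) n : t / 2 ^+ n = t / 2 ^+ n.+1 + t / 2 ^+ n.+1.
Proof. by rewrite exprS invfM; field; rewrite expf_neq0. Qed.

Let large_quarter n z : [&& x0 <= z.1, y0 <= z.2,
    z.1 + w0 / 2 ^+ n <= x0 + w0 & z.2 + h0 / 2 ^+ n <= y0 + h0] ->
  exists ij, `|flux_at n z| <= 4 * `|flux_at n.+1 (corner n ij z)|.
Proof.
move=> /and4P[x0z y0z zx zy].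
have w_ge0 : 0 <= w0 / 2 ^+ n.+1 by rewrite divr_ge0 ?exprn_ge0.
have h_ge0 : 0 <= h0 / 2 ^+ n.+1 by rewrite divr_ge0 ?exprn_ge0.
apply: contrapT => /forallNP H.
have {}H ij : 4 * `|flux_at n.+1 (corner n ij z)| < `|flux_at n z|.
  by rewrite ltNge; apply/negP; exact: H.
have := H (false, false); have := H (true, false).
have := H (false, true); have := H (true, true).
rewrite {2 4 6 8}/flux_at [w0 / 2 ^+ n]half_size [h0 / 2 ^+ n]half_size.
rewrite flux_split -?half_size// /flux_at /corner /= !mul1r !mul0r !addr0.
set f1 := flux _ _ _ _; set f2 := flux _ _ _ _.
set f3 := flux _ _ _ _; set f4 := flux _ _ _ _.
have := ler_normD (f2 + f3 + f4) f1.
have := ler_normD (f2 + f3) f4.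
have := ler_normD f2 f3.
by lra.
Qed.

Let quarter n z : bool * bool := xget (false, false)
  [set ij | `|flux_at n z| <= 4 * `|flux_at n.+1 (corner n ij z)|].

Fixpoint nested (n : nat) : R * R :=
  if n is m.+1 then corner m (quarter m (nested m)) (nested m) else (x0, y0).

Let nested_in n : [&& x0 <= (nested n).1, y0 <= (nested n).2,
    (nested n).1 + w0 / 2 ^+ n <= x0 + w0 & (nested n).2 + h0 / 2 ^+ n <= y0 + h0].
Proof.
elim: n => [|n /and4P[x0z y0z zx zy]]; first by rewrite expr0 !divr1 !lexx.
have w_ge0 : 0 <= w0 / 2 ^+ n.+1 by rewrite divr_ge0 ?exprn_ge0.
have h_ge0 : 0 <= h0 / 2 ^+ n.+1 by rewrite divr_ge0 ?exprn_ge0.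
rewrite [w0 / 2 ^+ n]half_size in zx; rewrite [h0 / 2 ^+ n]half_size in zy.
rewrite /= /corner /=; case: (quarter _ _) => -[] [] /=;
  rewrite ?mul1r ?mul0r; apply/and4P; split; lra.
Qed.

Let nested_flux n : `|flux x0 y0 w0 h0| <= 4 ^+ n * `|flux_at n (nested n)|.
Proof.
elim: n => [|n IHn]; first by rewrite /flux_at /= expr0 !divr1 mul1r.
apply: (le_trans IHn); rewrite exprSr -mulrA ler_wpM2l ?exprn_ge0//=.
rewrite /quarter; case: xgetP => [ij _ //|H].
by have [ij /H] := large_quarter (nested_in n).
Qed.

Let nested_mono m n : (m <= n)%N ->
  ((nested m).1 <= (nested n).1 /\ (nested n).1 <= (nested m).1 + w0 / 2 ^+ m)
  /\ ((nested m).2 <= (nested n).2 /\ (nested n).2 <= (nested m).2 + h0 / 2 ^+ m).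
Proof.
move=> mn.
suff : ((nested m).1 <= (nested n).1 /\
    (nested n).1 + w0 / 2 ^+ n <= (nested m).1 + w0 / 2 ^+ m)
  /\ ((nested m).2 <= (nested n).2 /\
    (nested n).2 + h0 / 2 ^+ n <= (nested m).2 + h0 / 2 ^+ m).
  have w_ge0 : 0 <= w0 / 2 ^+ n by rewrite divr_ge0 ?exprn_ge0.
  have h_ge0 : 0 <= h0 / 2 ^+ n by rewrite divr_ge0 ?exprn_ge0.
  by move=> [[? ?] [? ?]]; split; split => //; lra.
elim: n mn => [|n IHn]; first by rewrite leqn0 => /eqP ->; rewrite !lexx.
rewrite leq_eqVlt => /predU1P[->|/IHn]; first by rewrite !lexx.
have w_ge0 : 0 <= w0 / 2 ^+ n.+1 by rewrite divr_ge0 ?exprn_ge0.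
have h_ge0 : 0 <= h0 / 2 ^+ n.+1 by rewrite divr_ge0 ?exprn_ge0.
rewrite [w0 / 2 ^+ n]half_size [h0 / 2 ^+ n]half_size.
move=> [[? ?] [? ?]] /=; rewrite /corner /=; case: (quarter _ _) => -[] [] /=;
  rewrite ?mul1r ?mul0r; split; split; lra.
Qed.

(** The lower left corners increase, so the suprema of their coordinates lie in
    every rectangle of the sequence. *)
Let nested_point : exists z : R * R, forall n,
  ((nested n).1 <= z.1 /\ z.1 <= (nested n).1 + w0 / 2 ^+ n)
  /\ ((nested n).2 <= z.2 /\ z.2 <= (nested n).2 + h0 / 2 ^+ n).
Proof.
exists (sup (range (fun n => (nested n).1)), sup (range (fun n => (nested n).2))).
have cmp m n : (nested m).1 <= (nested n).1 + w0 / 2 ^+ n /\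
               (nested m).2 <= (nested n).2 + h0 / 2 ^+ n.
  have [mn|/ltnW nm] := leqP m n; last first.
    by have [[_ ?] [_ ?]] := nested_mono nm.
  have [[? _] [? _]] := nested_mono mn.
  have w_ge0 : 0 <= w0 / 2 ^+ n by rewrite divr_ge0 ?exprn_ge0.
  have h_ge0 : 0 <= h0 / 2 ^+ n by rewrite divr_ge0 ?exprn_ge0.
  by split; lra.
move=> n /=; split; split.
- apply: ub_le_sup; last by exists n.
  by exists ((nested 0).1 + w0 / 2 ^+ 0) => _ [m _ <-]; have [] := cmp m 0%N.
- apply: ge_sup; first by exists (nested 0).1, 0%N.
  by move=> _ [m _ <-]; have [] := cmp m n.
- apply: ub_le_sup; last by exists n.
  by exists ((nested 0).2 + h0 / 2 ^+ 0) => _ [m _ <-]; have [] := cmp m 0%N.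
- apply: ge_sup; first by exists (nested 0).2, 0%N.
  by move=> _ [m _ <-]; have [] := cmp m n.
Qed.

(** The affine parts of [u] and [v] at [(X, Y)] have the same slope [a] in the
    two directions that matter, so their contributions [a * w * h] to the two
    integrals cancel and only the error terms remain. *)
Let small_flux x y a b c e d w (h : R) X Y : 0 < e -> 0 <= w -> 0 <= h ->
  w < d -> h < d ->
  (forall h k : R, `|h| < d -> `|k| < d ->
      `|u (X + h) (Y + k) - u X Y - (a * h + b * k)| <= e * (`|h| + `|k|)) ->
  (forall h k : R, `|h| < d -> `|k| < d ->
      `|v (X + h) (Y + k) - v X Y - (c * h + a * k)| <= e * (`|h| + `|k|)) ->
  x <= X <= x + w -> y <= Y <= y + h ->
  [&& x0 <= x, y0 <= y, x + w <= x0 + w0 & y + h <= y0 + h0] ->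
  `|flux x y w h| <= 2 * e * (w + h) ^+ 2.
Proof.
move=> e0 w_ge0 h_ge0 wd hd ud vd /andP[xX Xx] /andP[yY Yy] /and4P[? ? ? ?].
have bound f p q : (forall h k : R, `|h| < d -> `|k| < d ->
      `|f (X + h) (Y + k) - f X Y - (p * h + q * k)| <= e * (`|h| + `|k|)) ->
    forall s t, x <= s <= x + w -> y <= t <= y + h ->
    `|f s t - f X Y - (p * (s - X) + q * (t - Y))| <= e * (w + h).
  move=> fd s t sx ty.
  have sX : `|s - X| <= w by rewrite ler_norml; apply/andP; split; lra.
  have tY : `|t - Y| <= h by rewrite ler_norml; apply/andP; split; lra.
  have := fd (s - X) (t - Y) (le_lt_trans sX wd) (le_lt_trans tY hd).
  rewrite ![_ + (_ - _)]addrC !subrK => /le_trans; apply.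
  by apply: ler_wpM2l; [exact: ltW|exact: lerD].
have ub := bound _ _ _ ud; have vb := bound _ _ _ vd.
rewrite /flux /boundary_flux.
have cu t : x <= t <= x + w -> segment_continuous y (y + h) (u t).
  by move=> tx; apply: u_cont2 => //; lra.
have cv t : y <= t <= y + h -> segment_continuous x (x + w) (fun s => v s t).
  by move=> ty; apply: v_cont1 => //; lra.
have csub (g g' : R -> R) p q : segment_continuous p q g ->
    segment_continuous p q g' -> segment_continuous p q (fun x => g x - g' x).
  by move=> cg cg' t ti; apply: cvgB; [apply: cg|apply: cg'].
have yh1 : y <= y <= y + h by rewrite lexx lerDl.
have yh2 : y <= y + h <= y + h by rewrite lexx lerDl h_ge0.
have xw1 : x <= x <= x + w by rewrite lexx lerDl.
have xw2 : x <= x + w <= x + w by rewrite lexx lerDl w_ge0.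
have two_points (P Q r al be ga : R) : `|P - r - al| <= e * (w + h) ->
    `|Q - r - be| <= e * (w + h) -> ga = al - be ->
    `|P - Q - ga| <= 2 * e * (w + h).
  move=> HP HQ ->; rewrite (_ : P - Q - _ = (P - r - al) - (Q - r - be)); last by ring.
  by rewrite (le_trans (ler_normB _ _))// -mulrA mulr2n mulrDl mul1r lerD.
have := @segment_integral_near_cst y (y + h) (a * w) (2 * e * (w + h))
  (fun t => u (x + w) t - u x t) _ _ _.
have := @segment_integral_near_cst x (x + w) (a * h) (2 * e * (w + h))
  (fun t => v t (y + h) - v t y) _ _ _.
set I1 := Rintegral _ _ _; set I2 := Rintegral _ _ _.
rewrite ![_ + _ - _]addrAC !subrr !add0r => H1 H2.
have {}H1 : `|I1 - a * h * w| <= 2 * e * (w + h) * w.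
  apply: H1; [by rewrite lerDl|by apply: csub; apply: cv|move=> t ty].
  by apply: (two_points _ _ _ _ _ _ (vb t (y + h) ty yh2) (vb t y ty yh1)); ring.
have {}H2 : `|I2 - a * w * h| <= 2 * e * (w + h) * h.
  apply: H2; [by rewrite lerDl|by apply: csub; apply: cu|move=> t ty].
  by apply: (two_points _ _ _ _ _ _ (ub (x + w) t xw2 ty) (ub x t xw1 ty)); ring.
rewrite expr2 mulrA [X in _ <= X]mulrDr.
move: H1 H2; rewrite !ler_norml => /andP[? ?] /andP[? ?].
by apply/andP; split; lra.
Qed.

(** Goursat's bisection: the flux is additive, so some quarter of a rectangle
    carries at least a quarter of it; in nested quarters shrinking to a point
    the affine part of [u] and [v] contributes nothing, and what remains is
    negligible against the area. *)
Lemma goursat_rectangle : boundary_flux u v x0 y0 w0 h0 = 0.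
Proof.
have [z zn] := nested_point.
have zx : x0 <= z.1 <= x0 + w0.
  by have [[+ +] _] := zn 0%N; rewrite /= expr0 divr1 => -> ->.
have zy : y0 <= z.2 <= y0 + h0.
  by have [_ [+ +]] := zn 0%N; rewrite /= expr0 divr1 => -> ->.
have [a [b [c [ud vd]]]] := uv zx zy.
apply/eqP; rewrite -normr_le0; apply/ler_addgt0Pl => e e0; rewrite addr0.
pose e' := e / (2 * (w0 + h0) ^+ 2 + 1).
have den : 0 < 2 * (w0 + h0) ^+ 2 + 1 by rewrite ltr_wpDl// mulr_ge0// sqr_ge0.
have e'0 : 0 < e' by rewrite divr_gt0.
have [d1 d10 H1] := ud _ e'0; have [d2 d20 H2] := vd _ e'0.
pose d := Num.min d1 d2.
have d0 : 0 < d by rewrite lt_min d10.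
have [n nd] : exists n, (w0 + h0) / 2 ^+ n < d.
  have : (w0 + h0) * (2^-1) ^+ n @[n --> \oo] --> (w0 + h0) * 0.
    apply: cvgMr; apply: cvg_expr.
    by rewrite ger0_norm// invf_lt1// ltr1n.
  rewrite mulr0 => /cvgr0Pnorm_lt /(_ d d0)[n _ /(_ n (leqnn n))].
  rewrite ger0_norm; last by rewrite mulr_ge0 ?exprn_ge0 ?addr_ge0.
  by rewrite exprVn; exists n.
have w_ge0 : 0 <= w0 / 2 ^+ n by rewrite divr_ge0 ?exprn_ge0.
have h_ge0 : 0 <= h0 / 2 ^+ n by rewrite divr_ge0 ?exprn_ge0.
rewrite mulrDl in nd.
have [[? ?] [? ?]] := zn n.
apply: (le_trans (nested_flux n)).
have : `|flux_at n (nested n)| <= 2 * e' * (w0 / 2 ^+ n + h0 / 2 ^+ n) ^+ 2.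
  apply: (@small_flux _ _ a b c e' d _ _ z.1 z.2) => //; try lra.
  - by move=> h k; rewrite !lt_min => /andP[? _] /andP[? _]; apply: H1.
  - by move=> h k; rewrite !lt_min => /andP[_ ?] /andP[_ ?]; apply: H2.
rewrite -mulrDl exprMn exprVn -[X in _ / X]exprM mulnC exprM => H.
have -> : e = e' * (2 * (w0 + h0) ^+ 2 + 1) by rewrite /e' divfK// gt_eqF.
have : 4 ^+ n * `|flux_at n (nested n)| <= 2 * e' * (w0 + h0) ^+ 2.
  rewrite mulrC -ler_pdivlMr ?exprn_gt0//; apply: (le_trans H).
  by rewrite mulrA (_ : 4 = 2 ^+ 2) // -natrX.
move/le_trans; apply.
have -> : e' * (2 * (w0 + h0) ^+ 2 + 1) = 2 * e' * (w0 + h0) ^+ 2 + e' by ring.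
by rewrite lerDl ltW.
Qed.

End Goursat.

End RealGoursat.

(** * The modulus and complex differentiability *)

Section ComplexBasics.
Variable R : realType.
Local Notation C := R[i].
Local Notation modulus := (@ComplexField.Normc.normc R).
Local Notation cdiff := (@complex_differentiable R).
Local Notation re := (@complex.Re R).
Local Notation im := (@complex.Im R).
Implicit Types (F G : C -> C) (z w : C).

Lemma normr_modulus z : `|z| = (modulus z)%:C%C.
Proof. by []. Qed.

Lemma modulus_ge0 z : 0 <= modulus z.
Proof. by case: z => a b; exact: sqrtr_ge0. Qed.

Lemma modulus0 : modulus 0 = 0.
Proof. exact: ComplexField.Normc.normc0. Qed.

Lemma modulus1 : modulus 1 = 1.
Proof. exact: ComplexField.Normc.normc1. Qed.

Lemma modulusM z w : modulus (z * w) = modulus z * modulus w.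
Proof. exact: ComplexField.Normc.normcM. Qed.

Lemma modulusV z : modulus z^-1 = (modulus z)^-1.
Proof. exact: ComplexField.Normc.normcV. Qed.

Lemma modulusN z : modulus (- z) = modulus z.
Proof. exact: normcN. Qed.

Lemma modulus_conj z : modulus z^*%C = modulus z.
Proof. by case: z => a b /=; rewrite sqrrN. Qed.

Lemma modulusD z w : modulus (z + w) <= modulus z + modulus w.
Proof. exact: le_normcD. Qed.

Lemma modulusB z w : modulus (z - w) <= modulus z + modulus w.
Proof. by rewrite (le_trans (modulusD _ _))// modulusN. Qed.

Lemma modulus_sub_ge z w : modulus z - modulus w <= modulus (z - w).
Proof. by rewrite lerBlDr -{1}[z](subrK w) modulusD. Qed.

Lemma modulus_distC z w : modulus (z - w) = modulus (w - z).
Proof. by rewrite -modulusN opprB. Qed.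

Lemma modulus_eq0 z : (modulus z == 0) = (z == 0).
Proof.
apply/eqP/eqP => [|->]; last exact: modulus0.
exact: ComplexField.Normc.eq0_normc.
Qed.

Lemma modulus_gt0 z : (0 < modulus z) = (z != 0).
Proof. by rewrite lt_def modulus_ge0 modulus_eq0 andbT. Qed.

Lemma modulusX z n : modulus (z ^+ n) = modulus z ^+ n.
Proof. by elim: n => [|n IHn]; rewrite ?expr0 ?modulus1// !exprS modulusM IHn. Qed.

Lemma modulus_real (x : R) : modulus x%:C%C = `|x|.
Proof. by rewrite /= expr0n/= addr0 sqrtr_sqr. Qed.

Lemma modulus_sqr z : modulus z ^+ 2 = re z ^+ 2 + im z ^+ 2.
Proof. by case: z => a b; rewrite sqr_sqrtr// addr_ge0// sqr_ge0. Qed.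

Lemma Re_modulus z : `|re z| <= modulus z.
Proof.
rewrite -(@ler_pXn2r _ 2)// ?nnegrE ?modulus_ge0//.
by rewrite real_normK ?num_real// modulus_sqr lerDl sqr_ge0.
Qed.

Lemma Im_modulus z : `|im z| <= modulus z.
Proof.
rewrite -(@ler_pXn2r _ 2)// ?nnegrE ?modulus_ge0//.
by rewrite real_normK ?num_real// modulus_sqr lerDr sqr_ge0.
Qed.

Lemma modulus_ReIm z : modulus z <= `|re z| + `|im z|.
Proof.
rewrite -(@ler_pXn2r _ 2)// ?nnegrE ?modulus_ge0 ?addr_ge0//.
rewrite modulus_sqr sqrrD !real_normK ?num_real//.
by rewrite -addrA lerD2l lerDr mulrn_wge0// mulr_ge0.
Qed.

Lemma modulus_sum (I : Type) (r : seq I) (P : pred I) (E : I -> C) :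
  modulus (\sum_(i <- r | P i) E i) <= \sum_(i <- r | P i) modulus (E i).
Proof.
elim/big_ind2 : _ => // [|x1 x2 y1 y2 le1 le2]; first by rewrite modulus0.
by rewrite (le_trans (modulusD _ _))// lerD.
Qed.

Lemma modulus_prod (I : Type) (r : seq I) (P : pred I) (E : I -> C) :
  modulus (\prod_(i <- r | P i) E i) = \prod_(i <- r | P i) modulus (E i).
Proof. by elim/big_ind2 : _ => // [|? ? ? ? <- <-]; rewrite ?modulus1 ?modulusM. Qed.

(** The order of [R[i]] makes a positive radius real, so the neighbourhoods of
    a complex number are described by real radii and the real-valued modulus. *)
Lemma near_modulusP z (P : C -> Prop) :
  (\forall w \near (z : C^o), P w) <->
  exists2 d : R, 0 < d & forall w, modulus (w - z) < d -> P w.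
Proof.
split=> [/nbhs_ballP[[d b] /= d0 dP]|[d d0 dP]].
- have [b0 d'0] : b = 0 /\ 0 < d by move: d0; rewrite ltcE/= => /andP[/eqP -> ?].
  exists d => // w wz; apply: dP.
  by rewrite -ball_normE /= normr_modulus b0 ltcE/= eqxx/= modulus_distC.
- apply/nbhs_ballP; exists d%:C%C => /=; first by rewrite ltcE/= eqxx.
  move=> w; rewrite -ball_normE /= normr_modulus ltcE/= => /andP[_ wz].
  by apply: dP; rewrite modulus_distC.
Qed.

Lemma complex_differentiableP F z : cdiff F z <->
  exists D, forall e : R, 0 < e -> exists2 d : R, 0 < d & forall h,
    modulus h < d -> modulus (F (z + h) - F z - D * h) <= e * modulus h.
Proof.
split.
- move=> /cvg_ex[/= D FD]; exists D => e e0.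
  move: FD => /cvgrPdist_le /(_ e%:C%C); rewrite ltcE/= eqxx e0 => /(_ isT).
  move=> /near_modulusP[d d0 dP]; exists d => // h hd.
  have [->|h0] := eqVneq h 0.
    by rewrite addr0 subrr mulr0 subrr modulus0 mulr0.
  have := dP h; rewrite subr0 => /(_ hd h0); rewrite normr_modulus lecE/= eqxx/=.
  rewrite -[h *: _]/(h * 1) mulr1 [h + z]addrC => Dh.
  have -> : F (z + h) - F z - D * h = - (h * (D - h^-1 * (F (z + h) - F z))).
    by field.
  by rewrite modulusN modulusM mulrC ler_wpM2r ?modulus_ge0.
- move=> [D HD]; apply/cvg_ex; exists D; apply/cvgrPdist_le => -[e b].
  rewrite ltcE/= => /andP[/eqP -> e0]; have [d d0 dP] := HD e e0.
  apply/near_modulusP; exists d => // h; rewrite subr0 => hd h0.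
  rewrite normr_modulus lecE/= eqxx/= -[h *: _]/(h * 1) mulr1 [h + z]addrC.
  rewrite -[_ *: _]/(h^-1 * _).
  have -> : D - h^-1 * (F (z + h) - F z) = - (F (z + h) - F z - D * h) / h.
    by field.
  rewrite modulusM modulusN modulusV ler_pdivrMr ?modulus_gt0//.
  exact: dP.
Qed.

Lemma complex_differentiable_continuous F z : cdiff F z ->
  {for z, continuous (F : C^o -> C^o)}.
Proof. by move=> /derivable1_diffP/differentiable_continuous. Qed.

Lemma complex_continuousP (F : C^o -> C^o) z : {for z, continuous F} <->
  forall e : R, 0 < e -> exists2 d : R, 0 < d & forall w,
    modulus (w - z) < d -> modulus (F w - F z) < e.
Proof.
split=> [/cvgrPdist_lt cF e e0|H].
  have := cF e%:C%C; rewrite ltcE/= eqxx e0 => /(_ isT)/near_modulusP[d d0 dP].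
  exists d => // w /dP; rewrite normr_modulus ltcE/= eqxx/= => ?.
  by rewrite modulus_distC.
apply/(@cvgrPdist_lt _ _ _ _ (nbhs_filter (z : C^o))) => -[e b].
rewrite ltcE/= => /andP[/eqP -> e0].
have [d d0 dP] := H e e0; apply/near_modulusP; exists d => // w /dP.
by rewrite normr_modulus ltcE/= eqxx/= modulus_distC.
Qed.

Lemma complex_continuous_modulusP (F : C^o -> R) z : {for z, continuous F} <->
  forall e : R, 0 < e -> exists2 d : R, 0 < d & forall w,
    modulus (w - z) < d -> `|F w - F z| < e.
Proof.
split=> [/cvgrPdist_lt cF e e0|H].
  have /near_modulusP[d d0 dP] := cF e e0.
  by exists d => // w /dP; rewrite distrC.
apply/(@cvgrPdist_lt _ _ _ _ (nbhs_filter (z : C^o))) => e e0.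
have [d d0 dP] := H e e0; apply/near_modulusP; exists d => // w /dP.
by rewrite distrC.
Qed.

Lemma complex_differentiable_cst w z : cdiff (fun=> w) z.
Proof. exact: derivable_cst. Qed.

Lemma complex_differentiable_id z : cdiff id z.
Proof. exact: derivable_id. Qed.

Lemma complex_differentiableD F G z : cdiff F z -> cdiff G z ->
  cdiff (fun w => F w + G w) z.
Proof. exact: derivableD. Qed.

Lemma complex_differentiableB F G z : cdiff F z -> cdiff G z ->
  cdiff (fun w => F w - G w) z.
Proof. exact: derivableB. Qed.

Lemma complex_differentiableM F G z : cdiff F z -> cdiff G z ->
  cdiff (fun w => F w * G w) z.
Proof. exact: derivableM. Qed.

Lemma complex_differentiableV F z : F z != 0 -> cdiff F z ->
  cdiff (fun w => (F w)^-1) z.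
Proof. exact: derivableV. Qed.

Lemma complex_differentiable_comp F G z : cdiff F z -> cdiff G (F z) ->
  cdiff (fun w => G (F w)) z.
Proof.
move=> /derivable1_diffP dF /derivable1_diffP dG.
by apply/derivable1_diffP; exact: (@differentiable_comp _ C^o C^o C^o F G z dF dG).
Qed.

Lemma complex_differentiable_shift F z w : cdiff F (z + w) ->
  cdiff (fun x => F (x + w)) z.
Proof.
move=> dF; apply: (@complex_differentiable_comp (fun x => x + w) F z _ dF).
apply: complex_differentiableD; first exact: complex_differentiable_id.
exact: complex_differentiable_cst.
Qed.

Lemma complex_differentiable_sum (I : Type) (r : seq I) (P : pred I)
    (E : I -> C -> C) z :
  (forall i, P i -> cdiff (E i) z) -> cdiff (fun w => \sum_(i <- r | P i) E i w) z.
Proof.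
move=> dE; elim: r => [|i r IHr].
  by under eq_fun do rewrite big_nil; exact: complex_differentiable_cst.
under eq_fun do rewrite big_cons.
case: (boolP (P i)) => [/dE dEi|_]; last exact: IHr.
exact: complex_differentiableD dEi IHr.
Qed.

Lemma complex_differentiable_prod (I : Type) (r : seq I) (P : pred I)
    (E : I -> C -> C) z :
  (forall i, P i -> cdiff (E i) z) -> cdiff (fun w => \prod_(i <- r | P i) E i w) z.
Proof.
move=> dE; elim: r => [|i r IHr].
  by under eq_fun do rewrite big_nil; exact: complex_differentiable_cst.
under eq_fun do rewrite big_cons.
case: (boolP (P i)) => [/dE dEi|_]; last exact: IHr.
exact: complex_differentiableM dEi IHr.
Qed.

Lemma complex_differentiable_near F G z :
  (\forall w \near (z : C^o), F w = G w) -> cdiff F z -> cdiff G z.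
Proof.
move=> /near_modulusP[d d0 FG] /complex_differentiableP[D HD].
apply/complex_differentiableP; exists D => e e0; have [d' d'0 H] := HD e e0.
exists (Num.min d d') => [|h]; first by rewrite lt_min d0.
rewrite lt_min => /andP[hd hd'].
by rewrite -!FG ?subrr ?modulus0// ?[z + h]addrC ?addrK// addrC; exact: H.
Qed.

End ComplexBasics.

(** * Circle means and the maximum principle *)

Section MaximumPrinciple.
Variable R : realType.
Local Notation C := R[i].
Local Notation modulus := (@ComplexField.Normc.normc R).
Local Notation cdiff := (@complex_differentiable R).
Local Notation re := (@complex.Re R).
Local Notation im := (@complex.Im R).
Local Notation mu := (@lebesgue_measure R).
Implicit Types (F G : C -> C) (z w : C) (x y h k r s t theta : R).

Definition cexp z : C := circle_point (expR (re z)) (im z).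

Lemma modulus_circle_point r theta : 0 <= r -> modulus (circle_point r theta) = r.
Proof.
move=> r0; rewrite /= !exprMn -mulrDr cos2Dsin2 mulr1 sqrtr_sqr.
by rewrite ger0_norm.
Qed.

Lemma modulus_cexp z : modulus (cexp z) = expR (re z).
Proof. by rewrite modulus_circle_point ?expR_ge0. Qed.

Lemma cexp_neq0 z : cexp z != 0.
Proof. by rewrite -modulus_gt0 modulus_cexp expR_gt0. Qed.

Lemma cexpD z w : cexp (z + w) = cexp z * cexp w.
Proof.
case: z w => a b [c d]; rewrite /cexp /circle_point /= expRD cosD sinD.
by apply/eqP; rewrite eq_complex /=; apply/andP; split; apply/eqP; ring.
Qed.

Lemma is_derive_increment (f : R -> R) x (D : R) : is_derive x 1 f D ->
  forall e, 0 < e -> exists2 d : R, 0 < d & forall h, `|h| < d ->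
    `|f (x + h) - f x - D * h| <= e * `|h|.
Proof.
move=> fD e e0.
have /cvgrPdist_le/(_ e e0)/nbhs_ballP[d /= d0 dP] :
    h^-1 *: (f (h *: 1 + x) - f x) @[h --> 0^'] --> D.
  have -> : D = 'D_1 f x by rewrite derive_val.
  exact: ex_derive.
exists d => // h hd; have [->|h0] := eqVneq h 0.
  by rewrite addr0 subrr mulr0 subrr normr0 mulr0.
have := dP h; rewrite -ball_normE /= sub0r normrN => /(_ hd h0).
rewrite -[h *: _]/(h * 1) mulr1 [h + x]addrC -[_ *: _]/(h^-1 * _) => Dh.
have -> : f (x + h) - f x - D * h = - (h * (D - h^-1 * (f (x + h) - f x))).
  by field.
by rewrite normrN normrM mulrC ler_wpM2r.
Qed.

(** The real derivatives at [0] of [expR], [cos] and [sin] are the three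
    ingredients; the exponential law carries the result to every point. *)
Lemma cexp_derivative0 (e : R) : 0 < e -> exists2 d : R, 0 < d &
  forall z, modulus z < d -> modulus (cexp z - 1 - z) <= e * modulus z.
Proof.
move=> e0; have e60 : 0 < e / 6 by rewrite divr_gt0.
have [d1 d10 H1] := is_derive_increment (is_derive_expR (0 : R)) e60.
have [d2 d20 H2] := is_derive_increment (is_derive_cos (0 : R)) e60.
have [d3 d30 H3] := is_derive_increment (is_derive_sin (0 : R)) e60.
pose d := Num.min (Num.min d1 d2) (Num.min d3 (Num.min 1 (e / 6 / (1 + e / 6)))).
exists d => [|[x y] xyd].
  by rewrite !lt_min d10 d20 d30 ltr01/= divr_gt0// addr_gt0.
have xd : `|x| < d := le_lt_trans (Re_modulus (Complex x y)) xyd.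
have yd : `|y| < d := le_lt_trans (Im_modulus (Complex x y)) xyd.
have := xd; have := yd; rewrite !lt_min.
move=> /andP[/andP[_ yd2] /and3P[yd3 y1 yd4]] /andP[/andP[xd1 _] /and3P[_ x1 _]].
have := H1 x xd1; have := H2 y yd2; have := H3 y yd3.
rewrite !add0r expR0 cos0 sin0 !oppr0 mul0r !mul1r ?subr0 !addr0.
set E := expR x - 1 - x; set c := cos y - 1; move=> S3 S2 S1.
have siny : `|sin y| <= e / 6.
  have -> : sin y = (sin y - y) + y by rewrite subrK.
  rewrite (le_trans (ler_normD _ _))//.
  rewrite (le_trans (lerD S3 (lexx _)))// -[X in _ + X]mul1r -mulrDl addrC.
  by rewrite mulrC -ler_pdivlMr ?addr_gt0// ltW.
apply: (le_trans (modulus_ReIm _)).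
set M := modulus (Complex x y); rewrite /= !subr0.
have -> : expR x * cos y - 1 - x = E * cos y + (1 + x) * c by rewrite /E /c; ring.
have -> : expR x * sin y - y = (E + x) * sin y + (sin y - y) by rewrite /E; ring.
have B1 : `|E * cos y| <= e / 6 * `|x|.
  by rewrite normrM -[leRHS]mulr1 ler_pM// ler_norml cos_geN1 cos_le1.
have B2 : `|(1 + x) * c| <= 2 * (e / 6 * `|y|).
  rewrite normrM ler_pM// (le_trans (ler_normD _ _))// normr1.
  by rewrite -[leRHS]/(1 + 1) lerD2l ltW.
have B3 : `|(E + x) * sin y| <= 2 * (e / 6 * `|x|).
  rewrite mulrDl (le_trans (ler_normD _ _))// !normrM mulr2n mulrDl mul1r lerD//.
    rewrite -[leRHS]mulr1 ler_pM// ler_norml; apply/andP; split.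
      exact: sin_geN1.
    exact: sin_le1.
  by rewrite mulrC ler_wpM2r.
have := ler_normD (E * cos y) ((1 + x) * c).
have := ler_normD ((E + x) * sin y) (sin y - y).
have : e * (`|x| + `|y|) <= 2 * (e * M).
  rewrite mulrCA; apply: ler_wpM2l (ltW e0) _ _ _; rewrite mulr2n mulrDl mul1r lerD//.
    exact: (Re_modulus (Complex x y)).
  exact: (Im_modulus (Complex x y)).
by lra.
Qed.

Lemma complex_differentiable_cexp z : cdiff cexp z.
Proof.
apply/complex_differentiableP; exists (cexp z) => e e0.
have [d d0 H] := cexp_derivative0 (divr_gt0 e0 (expR_gt0 (re z))).
exists d => // h hd; rewrite cexpD.
have -> : cexp z * cexp h - cexp z - cexp z * h = cexp z * (cexp h - 1 - h) by ring.
rewrite modulusM modulus_cexp mulrC -ler_pdivlMr ?expR_gt0// mulrAC.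
exact: H.
Qed.

(** The Cauchy-Riemann equations, read off from the multiplication by the
    complex derivative. *)
Lemma complex_differentiable_planar F x y : cdiff F (Complex x y) ->
  exists a b,
    planar_differential (fun x y => re (F (Complex x y))) x y a (- b) /\
    planar_differential (fun x y => im (F (Complex x y))) x y b a.
Proof.
move=> /complex_differentiableP[D HD]; exists (re D), (im D).
suff H e : 0 < e -> exists2 d, 0 < d & forall h k, `|h| < d -> `|k| < d ->
    modulus (F (Complex (x + h) (y + k)) - F (Complex x y) - D * Complex h k)
      <= e * (`|h| + `|k|).
  split=> e /H[d d0 dP]; exists d => // h k hd kd.
  - apply: le_trans (dP h k hd kd); apply: le_trans (Re_modulus _).
    case: (F _) (F _) D {HD H dP} => [a b] [a' b'] [c c'] /=.
    by rewrite le_eqVlt; apply/orP; left; apply/eqP; congr (`| _ |); ring.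
  - apply: le_trans (dP h k hd kd); apply: le_trans (Im_modulus _).
    case: (F _) (F _) D {HD H dP} => [a b] [a' b'] [c c'] /=.
    by rewrite le_eqVlt; apply/orP; left; apply/eqP; congr (`| _ |); ring.
move=> e0; have [d d0 dP] := HD e e0; exists (d / 2) => [|h k hd kd].
  by rewrite divr_gt0.
apply: (le_trans (dP (Complex h k) _)).
  by rewrite (le_lt_trans (modulus_ReIm _))//= [d]splitr ltrD.
by rewrite (ler_wpM2l (ltW e0))// (modulus_ReIm (Complex h k)).
Qed.

Definition circle_mean (g : C -> R) (r : R) : R :=
  (pi *+ 2)^-1 * \int[mu]_(theta in `[0, pi *+ 2]) g (circle_point r theta).

Lemma twopi_gt0 : 0 < pi *+ 2 :> R.
Proof. by rewrite mulrn_wgt0// pi_gt0. Qed.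

Lemma circle_mean_ge0 (g : C -> R) r :
  (forall theta, 0 <= g (circle_point r theta)) -> 0 <= circle_mean g r.
Proof.
by move=> g0; rewrite mulr_ge0 ?invr_ge0 ?(ltW twopi_gt0)// Rintegral_ge0.
Qed.

(** In the coordinate [w] with [z = cexp w] the annulus between the two circles
    is a rectangle of height [2 pi]; by periodicity its horizontal sides cancel,
    and the vanishing flux says that the two vertical sides, which are the two
    circles, have the same integral. *)
Lemma circle_mean_re_radius F s t : 0 < t -> t <= s ->
  (forall z, modulus z <= s -> cdiff F z) ->
  circle_mean (fun z => re (F z)) s = circle_mean (fun z => re (F z)) t.
Proof.
move=> t0 ts dF; have s0 : 0 < s by exact: lt_le_trans ts.
pose H z := F (cexp z).
have dH x y : ln t <= x <= ln s -> cdiff H (Complex x y).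
  move=> /andP[_ xs].
  apply: (@complex_differentiable_comp _ cexp F); first exact: complex_differentiable_cexp.
  by apply: dF; rewrite modulus_cexp/= -[s]lnK ?posrE// ler_expR.
have w_ge0 : 0 <= ln s - ln t by rewrite subr_ge0 ler_ln ?posrE.
have h_ge0 := ltW twopi_gt0.
have := @goursat_rectangle R (fun x y => re (H (Complex x y)))
  (fun x y => im (H (Complex x y))) (ln t) 0 _ _ w_ge0 h_ge0.
rewrite /boundary_flux !add0r => /(_ _)/eqP; rewrite subr_eq0.
have per x : H (Complex x (pi *+ 2)) = H (Complex x 0).
  by rewrite /H /cexp /circle_point /= cos2pi sin2pi cos0 sin0.
under [X in _ == X]eq_Rintegral do rewrite per subrr.
rewrite segment_integral_cst ?lerDl// mul0r [ln t + _]addrC subrK.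
have cu x : ln t <= x <= ln s ->
    segment_continuous 0 (pi *+ 2) (fun y => re (H (Complex x y))).
  move=> xs y _; have [|a [b [+ _]]] := @complex_differentiable_planar H x y; first exact: dH.
  exact: planar_differential_continuous2.
rewrite segment_integral_sub; last 2 first.
- by apply: cu; rewrite lexx ler_ln ?posrE// ts.
- by apply: cu; rewrite lexx ler_ln ?posrE// ts.
rewrite subr_eq0 => /(_ _)/eqP HI.
rewrite /circle_mean; congr (_ * _); move: HI; rewrite /H /cexp /= !lnK ?posrE//.
apply=> x y xi _; have [a [b [ua va]]] := complex_differentiable_planar (dH x y xi).
by exists a, (- b), b.
Qed.

Lemma circle_mean_near_cst (g : C -> R) r (c e : R) :
  segment_continuous 0 (pi *+ 2) (fun theta => g (circle_point r theta)) ->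
  (forall theta, `|g (circle_point r theta) - c| <= e) ->
  `|circle_mean g r - c| <= e.
Proof.
move=> cg ge.
have := segment_integral_near_cst (ltW twopi_gt0) cg (fun x _ => ge x).
rewrite /circle_mean subr0; set I := Rintegral _ _ _ => HI.
have -> : (pi *+ 2)^-1 * I - c = (I - c * (pi *+ 2)) / (pi *+ 2).
  by rewrite mulrBl mulfK ?gt_eqF ?twopi_gt0// mulrC.
rewrite normrM normfV [`|pi *+ 2|]ger0_norm ?(ltW twopi_gt0)//.
by rewrite ler_pdivrMr ?twopi_gt0.
Qed.

Lemma continuous_circle_point r theta (g : C -> R) :
  {for circle_point r theta, continuous (g : C^o -> R)} ->
  {for theta, continuous (fun t => g (circle_point r t))}.
Proof.
move=> /complex_continuous_modulusP cg; apply/cvgrPdist_lt => e e0.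
have [d d0 dP] := cg e e0.
have rd : 0 < d / 2 / (1 + `|r|) by rewrite !divr_gt0// ltr_wpDr.
have small (f : R -> R) : {for theta, continuous f} ->
    \forall t \near theta, `|r * (f t - f theta)| < d / 2.
  move=> /cvgrPdist_lt/(_ _ rd); apply: filterS => x.
  rewrite distrC ltr_pdivlMr ?ltr_wpDr// normrM => /(le_lt_trans _); apply.
  by rewrite mulrC ler_wpM2l// lerDr.
have small_cos := small _ (@continuous_cos R theta).
have small_sin := small _ (@continuous_sin R theta).
near=> t; rewrite distrC; apply: dP.
rewrite (le_lt_trans (modulus_ReIm _))//= -!mulrBr [d]splitr ltrD//.
- by near: t; exact: small_cos.
- by near: t; exact: small_sin.
Unshelve. all: by end_near. Qed.

Lemma complex_differentiable_continuous_re F z : cdiff F z ->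
  {for z, continuous ((fun w => re (F w)) : C^o -> R)}.
Proof.
move=> /complex_differentiable_continuous/complex_continuousP cF.
apply/complex_continuous_modulusP => e /cF[d d0 dP]; exists d => // w /dP.
apply: le_lt_trans; apply: le_trans (Re_modulus _).
by case: (F w) (F z) => [a b] [a' b'].
Qed.

Lemma circle_mean_re F s : 0 < s -> (forall z, modulus z <= s -> cdiff F z) ->
  circle_mean (fun z => re (F z)) s = re (F 0).
Proof.
move=> s0 dF.
have cF z : modulus z <= s -> {for z, continuous ((fun z => re (F z)) : C^o -> R)}.
  by move=> /dF/complex_differentiable_continuous_re.
apply/eqP; rewrite -subr_eq0 -normr_le0; apply/ler_addgt0Pl => e e0; rewrite addr0.
have /cF/complex_continuous_modulusP/(_ e e0)[d d0 dP] : modulus 0 <= s.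
  by rewrite modulus0 ltW.
pose t := Num.min s (d / 2).
have t0 : 0 < t by rewrite lt_min s0 divr_gt0.
have ts : t <= s by rewrite ge_min lexx.
rewrite (circle_mean_re_radius t0 ts dF); apply: circle_mean_near_cst.
- move=> th _; apply: (@continuous_circle_point t th (fun z => re (F z))).
  by apply: cF; rewrite modulus_circle_point// ltW.
- move=> th; apply/ltW/dP; rewrite subr0 modulus_circle_point ?ltW//.
  by rewrite gt_min; apply/orP; right; rewrite ltr_pdivrMr// ltr_pMr// ltr1n.
Qed.

Lemma circle_mean_le (g : C -> R) r (M : R) :
  segment_continuous 0 (pi *+ 2) (fun theta => g (circle_point r theta)) ->
  (forall theta, g (circle_point r theta) <= M) -> circle_mean g r <= M.
Proof.
move=> cg gM; rewrite /circle_mean mulrC ler_pdivrMr ?twopi_gt0//.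
have := @segment_integral_le R 0 (pi *+ 2) _ (fun=> M) cg _ _.
rewrite segment_integral_cst ?(ltW twopi_gt0)// subr0; apply => //.
by move=> ? _; exact: cst_continuous.
Qed.

(** Multiplying by the conjugate of [F 0] turns the mean value property of the
    real part into a bound of the modulus. *)
Lemma maximum_principle_center F s (M : R) : 0 < s ->
  (forall z, modulus z <= s -> cdiff F z) ->
  (forall z, modulus z = s -> modulus (F z) <= M) -> modulus (F 0) <= M.
Proof.
move=> s0 dF FM.
have M0 : 0 <= M.
  by rewrite (le_trans (modulus_ge0 (F (circle_point s 0))))// FM// modulus_circle_point ?ltW.
have [->|F0] := eqVneq (F 0) 0; first by rewrite modulus0.
pose G z := (F 0)^*%C * F z.
have dG z : modulus z <= s -> cdiff G z.
  move=> /dF; apply: complex_differentiableM; exact: complex_differentiable_cst.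
have := circle_mean_re s0 dG.
have -> : re (G 0) = modulus (F 0) * modulus (F 0).
  by rewrite -expr2 modulus_sqr /G; case: (F 0) => a b /=; ring.
move=> meanG.
have : circle_mean (fun z => re (G z)) s <= modulus (F 0) * M.
  apply: circle_mean_le => [th _|th].
    have mz := modulus_circle_point th (ltW s0).
    apply: (@continuous_circle_point s th (fun z => re (G z))).
    by apply/complex_differentiable_continuous_re/dG; rewrite mz.
  rewrite (le_trans (ler_norm _))// (le_trans (Re_modulus _))// modulusM modulus_conj.
  by rewrite ler_wpM2l ?modulus_ge0// FM// modulus_circle_point ?ltW.
by rewrite meanG ler_pM2l// modulus_gt0.
Qed.

(** The Moebius map [phi] of the disc preserves the circle and sends [0] to
    [a], which reduces the claim to the center. *)
Lemma maximum_principle F s (M : R) a : 0 < s ->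
  (forall z, modulus z <= s -> cdiff F z) ->
  (forall z, modulus z = s -> modulus (F z) <= M) ->
  modulus a < s -> modulus (F a) <= M.
Proof.
move=> s0 dF FM as_.
pose s2 : C := (s ^+ 2)%:C%C.
pose den z : C := s2 + a^*%C * z.
pose phi z : C := s2 * (z + a) / den z.
have ms2 : modulus s2 = s ^+ 2 by rewrite modulus_real ger0_norm ?sqr_ge0.
have den0 z : modulus z <= s -> den z != 0.
  move=> zs; rewrite -modulus_gt0 /den -[_ * z]opprK.
  apply: lt_le_trans (modulus_sub_ge _ _); rewrite ms2 modulusN modulusM modulus_conj subr_gt0.
  by rewrite (le_lt_trans (ler_wpM2l (modulus_ge0 _) zs))// expr2 ltr_pM2r.
have key z : modulus (den z) ^+ 2 - modulus (z + a) ^+ 2 * s ^+ 2 =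
    (s ^+ 2 - modulus a ^+ 2) * (s ^+ 2 - modulus z ^+ 2).
  rewrite !modulus_sqr /den /s2; case: a z {as_ den phi den0} => [a b] [x y] /=.
  by rewrite !mulNr !opprK; ring.
have phiE z : modulus z <= s ->
    modulus (phi z) = s * (s * modulus (z + a)) / modulus (den z).
  by move=> zs; rewrite /phi !modulusM modulusV ms2 expr2 mulrA.
have phi_le z : modulus z <= s -> modulus (phi z) <= s.
  move=> zs; rewrite phiE// ler_pdivrMr ?modulus_gt0 ?den0// ler_pM2l//.
  rewrite -(@ler_pXn2r _ 2)// ?nnegrE ?modulus_ge0 ?mulr_ge0 ?modulus_ge0 ?(ltW s0)//.
  rewrite exprMn mulrC -subr_ge0 key mulr_ge0// subr_ge0;
  by rewrite ler_pXn2r// ?nnegrE ?modulus_ge0 ?(ltW s0) ?(ltW as_).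
have phi_eq z : modulus z = s -> modulus (phi z) = s.
  move=> zs; rewrite phiE ?zs// -mulrA; have dz : den z != 0 by rewrite den0 ?zs.
  suff -> : s * modulus (z + a) = modulus (den z).
    by rewrite divff ?mulr1// modulus_eq0.
  apply/eqP; rewrite -(@eqrXn2 _ 2)// ?mulr_ge0 ?modulus_ge0 ?(ltW s0)//.
  by rewrite exprMn mulrC eq_sym -subr_eq0 key zs subrr mulr0.
have s20 : s2 != 0 by rewrite -modulus_gt0 ms2 exprn_gt0.
have <- : phi 0 = a by rewrite /phi /den mulr0 addr0 add0r mulrC mulKf.
apply: (@maximum_principle_center (fun z => F (phi z)) s M s0) => z zs.
  apply: (@complex_differentiable_comp _ phi F); last by apply: dF; exact: phi_le.
  have dC w' := @complex_differentiable_cst R w' z.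
  apply: complex_differentiableM.
    apply: complex_differentiableM; first exact: dC.
    apply: complex_differentiableD; last exact: dC.
    exact: complex_differentiable_id.
  apply: complex_differentiableV; first exact: den0.
  apply: complex_differentiableD; first exact: dC.
  apply: complex_differentiableM; first exact: dC.
  exact: complex_differentiable_id.
by apply: FM; exact: phi_eq.
Qed.

End MaximumPrinciple.

(** * Compactness of circles and discs *)

Section CircleCompactness.
Variable R : realType.
Local Notation C := R[i].
Local Notation modulus := (@ComplexField.Normc.normc R).
Local Notation re := (@complex.Re R).
Local Notation im := (@complex.Im R).
Implicit Types (z w : C) (x y r s t theta : R).

Lemma polar_form s z : 0 < s -> modulus z = s ->
  exists2 theta, 0 <= theta <= pi *+ 2 & z = circle_point s theta.
Proof.
move=> s0 zs; set c := re z / s; set d := im z / s.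
have cd1 : c ^+ 2 + d ^+ 2 = 1.
  rewrite /c /d !expr_div_n -mulrDl -modulus_sqr zs divff//.
  by rewrite expf_neq0// gt_eqF.
have c1 : -1 <= c <= 1.
  by rewrite -ler_norml -(@expr_le1 _ 2)// real_normK ?num_real// -cd1 lerDl sqr_ge0.
have zE : z = Complex (s * c) (s * d).
  by rewrite /c /d !(mulrCA s) divff ?gt_eqF// !mulr1; case: z {zs c d cd1 c1}.
have acos_pi2 : 0 <= acos c <= pi *+ 2.
  rewrite acos_ge0//= (le_trans (acos_lepi c1))// mulr2n lerDl.
  exact: ltW (pi_gt0 _).
have [d0|d0] := leP 0 d.
  exists (acos c) => //; rewrite zE /circle_point acosK ?in_itv// sin_acos//.
  by rewrite -cd1 addrAC subrr add0r sqrtr_sqr ger0_norm.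
exists (pi *+ 2 - acos c).
  move: acos_pi2 => /andP[? ?]; rewrite subr_ge0 lerBlDr lerDl.
  by apply/andP.
rewrite zE /circle_point cosB sinB cos2pi sin2pi !mul1r !mul0r addr0 sub0r.
rewrite acosK ?in_itv// sin_acos// -cd1 addrAC subrr add0r sqrtr_sqr.
by rewrite ltr0_norm// opprK.
Qed.

Lemma modulus_dist_triangle z w v : modulus (z - v) <= modulus (z - w) + modulus (w - v).
Proof. by rewrite -{1}[z](subrK w) -addrA modulusD. Qed.

Let disc_param (rt : R * R) : C^o := circle_point rt.1 rt.2.

Lemma continuous_disc_param rt : {for rt, continuous disc_param}.
Proof.
case: rt => r t; have cR (f : R * R -> R) : {for (r, t), continuous f} ->
    forall e, 0 < e -> \forall x \near (r, t), `|f x - f (r, t)| < e.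
  by move=> /cvgrPdist_lt cf e /cf; apply: filterS => x; rewrite distrC.
apply/(@cvgrPdist_lt _ _ _ _ (nbhs_filter ((r, t) : R * R))) => -[e b].
rewrite ltcE/= => /andP[/eqP -> e0].
have e20 : 0 < e / 2 by rewrite divr_gt0.
have c1 : {for (r, t), continuous (fun x : R * R => x.1 * cos x.2)}.
  apply: cvgM; first exact: cvg_fst.
  by apply: continuous_comp; [exact: cvg_snd|exact: continuous_cos].
have c2 : {for (r, t), continuous (fun x : R * R => x.1 * sin x.2)}.
  apply: cvgM; first exact: cvg_fst.
  by apply: continuous_comp; [exact: cvg_snd|exact: continuous_sin].
have ltC z : modulus z < e -> `|z| < Complex e 0.
  by rewrite normr_modulus ltcE /= eqxx.
near=> x; rewrite distrC; apply: ltC.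
apply: (le_lt_trans (modulus_ReIm _)); rewrite [e]splitr ltrD//.
- by near: x; exact: cR c1 _ e20.
- by near: x; exact: cR c2 _ e20.
Unshelve. all: by end_near. Qed.

Lemma compact_circle s : 0 < s -> compact [set z : C^o | modulus z = s].
Proof.
move=> s0; suff -> : [set z : C^o | modulus z = s] =
    disc_param @` ([set s] `*` `[0, pi *+ 2]).
  apply: continuous_compact; last first.
    by apply: compact_setX; [exact: compact_set1|exact: segment_compact].
  by apply: continuous_subspaceT => x; exact: continuous_disc_param.
apply/seteqP; split => [z /= /(polar_form s0)[t t2 ->]|_ [[r t] [/= -> _] <-]].
  by exists (s, t) => //; split => //=; rewrite in_itv.
by apply: modulus_circle_point; exact: ltW.
Qed.

Lemma compact_disc s : compact [set z : C^o | modulus z <= s].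
Proof.
suff -> : [set z : C^o | modulus z <= s] =
    disc_param @` (`[0, s] `*` `[0, pi *+ 2]).
  apply: continuous_compact; last by apply: compact_setX; exact: segment_compact.
  by apply: continuous_subspaceT => x; exact: continuous_disc_param.
apply/seteqP; split => [z /= zs|_ [[r t] [/= + _] <-]]; last first.
  rewrite in_itv/= => /andP[r0 rs].
  by have := modulus_circle_point t r0; rewrite /= => ->.
have [z0|z0] := eqVneq z 0.
  exists (0, 0); last by rewrite z0 /disc_param /circle_point !mul0r.
  split; rewrite /= in_itv/= lexx /=; last by exact: ltW (twopi_gt0 _).
  by rewrite (le_trans _ zs)// modulus_ge0.
rewrite -modulus_gt0 in z0; have [t t2 zE] := polar_form z0 erefl.
by exists (modulus z, t) => //; split => //=; rewrite in_itv//= zs modulus_ge0.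
Qed.

(** A uniform threshold on a compact set from local ones: the filter of small
    positive reals turns the two-variable condition into a near-covering. *)
Lemma compact_near_forall (K : set C^o) (P : R -> C -> Prop) : compact K ->
  (forall z, K z -> exists2 d : R, 0 < d &
    forall (e : R) w, 0 < e < d -> modulus (w - z) < d -> P e w) ->
  exists2 d : R, 0 < d & forall w, K w -> P d w.
Proof.
move=> /compact_near_coveringP cK HP.
have [z Kz|d /= d0 dP] := cK _ (0^'+ : set_system R) P _.
  have [d d0 dP] := HP z Kz.
  exists ([set w | modulus (w - z) < d], [set e | 0 < e < d]) => /=.
    split; first by apply/near_modulusP; exists d.
    near=> e; apply/andP; split; near: e; first exact: nbhs_right_gt.
    exact: nbhs_right_lt.
  by move=> [w e] /= [wd ed]; exact: dP.
exists (d / 2) => [|w Kw]; first by rewrite divr_gt0.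
apply: (dP (d / 2)) => //=; last by rewrite divr_gt0.
by rewrite sub0r normrN ger0_norm ?divr_ge0 ?ltW// ltr_pdivrMr// ltr_pMr// ltr1n.
Unshelve. all: by end_near. Qed.

End CircleCompactness.

(** * Riemann sums of circle means *)

Section RiemannSums.
Variable R : realType.
Local Notation C := R[i].
Local Notation modulus := (@ComplexField.Normc.normc R).
Local Notation mu := (@lebesgue_measure R).
Implicit Types (z w : C) (x y r s t theta : R) (g phi : C -> R).

Lemma compact_uniform_continuous (K : set C^o) g (e : R) : compact K -> 0 < e ->
  (forall z, K z -> {for z, continuous (g : C^o -> R)}) ->
  exists2 d : R, 0 < d & forall z, K z -> forall w, modulus (w - z) < d ->
    `|g w - g z| < e.
Proof.
move=> cK e0 cg; apply: compact_near_forall => // z Kz.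
have e20 : 0 < e / 2 by rewrite divr_gt0.
have /complex_continuous_modulusP/(_ _ e20)[d d0 dP] := cg z Kz.
exists (d / 2) => [|f w /andP[f0 fd] wz v vw]; first by rewrite divr_gt0.
have -> : g v - g w = (g v - g z) - (g w - g z) by ring.
rewrite (le_lt_trans (ler_normB _ _))// [e]splitr ltrD//.
- apply: dP; rewrite (le_lt_trans (modulus_dist_triangle _ w _))//.
  by rewrite [d]splitr ltrD// (lt_trans vw).
- by apply: dP; rewrite (lt_trans wz)// ltr_pdivrMr// ltr_pMr// ltr1n.
Qed.

Lemma compact_bounded_modulus (K : set C^o) g : compact K ->
  (forall z, K z -> {for z, continuous (g : C^o -> R)}) ->
  exists2 M : R, 0 < M & forall z, K z -> `|g z| <= M.
Proof.
move=> cK cg.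
have [z Kz|d d0 dP] := @compact_near_forall R K (fun e z => `|g z| <= e^-1) cK.
  have /complex_continuous_modulusP/(_ _ ltr01)[d d0 dP] := cg z Kz.
  have gz0 : 0 < `|g z| + 1 by rewrite ltr_wpDl.
  exists (Num.min d (`|g z| + 1)^-1) => [|e w /andP[e0 +]].
    by rewrite lt_min d0 invr_gt0.
  rewrite !lt_min => /andP[_ ez] /andP[/dP wz _].
  have : `|g w| <= `|g z| + 1.
    by rewrite -[g w](subrK (g z)) (le_trans (ler_normD _ _))// addrC lerD2l ltW.
  by move/le_trans; apply; rewrite -[leLHS]invrK lef_pV2 ?posrE ?invr_gt0// ltW.
by exists d^-1; rewrite ?invr_gt0.
Qed.

Lemma circle_pointE r theta : circle_point r theta = r%:C%C * cexp (Complex 0 theta).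
Proof.
rewrite /cexp /circle_point /= expR0 !mul1r.
by apply/eqP; rewrite eq_complex /=; apply/andP; split; apply/eqP; ring.
Qed.

Lemma circle_point_uniform r (e : R) : 0 < e -> exists2 d : R, 0 < d &
  forall theta h, `|h| < d ->
    modulus (circle_point r (theta + h) - circle_point r theta) < e.
Proof.
move=> e0; have r0 : 0 < e / (1 + `|r|) by rewrite divr_gt0// ltr_wpDr.
have /complex_differentiable_continuous/complex_continuousP := @complex_differentiable_cexp R 0.
move=> /(_ _ r0)[d d0 dP]; exists d => // th h hd.
have -> : circle_point r (th + h) - circle_point r th =
    circle_point r th * (cexp (Complex 0 h) - cexp 0).
  have -> : cexp 0 = 1 :> C.
    by rewrite /cexp /circle_point /= expR0 cos0 sin0 mulr1 mulr0.
  rewrite mulrBr mulr1 !circle_pointE -mulrA -cexpD; congr (_ * cexp _ - _).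
  by apply/eqP; rewrite eq_complex /= addr0 !eqxx.
rewrite modulusM circle_pointE modulusM modulus_real modulus_cexp expR0 mulr1.
have := dP (Complex 0 h); rewrite subr0 ltr_pdivlMr ?ltr_wpDr// => H.
rewrite mulrC (le_lt_trans _ (H _))//; last by rewrite /= expr0n/= add0r sqrtr_sqr.
by rewrite ler_wpM2l ?modulus_ge0// lerDr.
Qed.

Definition circle_angle (n j : nat) : R := (pi *+ 2) * (j%:R / n%:R).

(** Equidistant nodes suffice because the integrand is uniformly continuous on
    the circle; [partial] adds up the errors of the single arcs. *)
Lemma riemann_sum_circle_mean g r (e : R) : 0 < r -> 0 < e ->
  (forall z, modulus z = r -> {for z, continuous (g : C^o -> R)}) ->
  exists N, forall n, (N <= n)%N -> (0 < n)%N ->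
    `|n%:R^-1 * (\sum_(j < n) g (circle_point r (circle_angle n j))) -
      circle_mean g r| <= e.
Proof.
move=> r0 e0 cg; set u := fun th => g (circle_point r th).
have [d d0 dP] := compact_uniform_continuous (compact_circle r0) e0 cg.
have [f f0 fP] := circle_point_uniform r d0.
have uP th h : `|h| < f -> `|u (th + h) - u th| <= e.
  move=> hf; apply/ltW/dP; last exact: fP.
  exact: (modulus_circle_point _ (ltW r0)).
have cu a b : segment_continuous a b u.
  move=> th _; apply: (@continuous_circle_point _ r th g); apply: cg.
  by rewrite modulus_circle_point// ltW.
exists (Num.truncn (pi *+ 2 / f)).+1 => n Nn n0.
have n0' : 0 < n%:R :> R by rewrite ltr0n.
pose h : R := pi *+ 2 / n%:R.
have h0 : 0 < h by rewrite divr_gt0 ?twopi_gt0.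
have hf : h < f.
  rewrite /h ltr_pdivrMr// mulrC -ltr_pdivrMr//.
  rewrite (lt_le_trans (truncnS_gt _))// ler_nat.
  exact: Nn.
have angleE j : circle_angle n j = h * j%:R by rewrite /circle_angle /h; ring.
have partial m : `|\int[mu]_(x in `[0, h * m%:R]) u x -
    h * \sum_(j < m) u (circle_angle n j)| <= e * (h * m%:R).
  elim: m => [|m IHm].
    by rewrite big_ord0 !mulr0 set_itv1 Rintegral_set1 subr0 normr0.
  have hm0 : 0 <= h * m%:R by rewrite mulr_ge0 ?ler0n ?(ltW h0).
  have hmS : h * m%:R <= h * m.+1%:R by rewrite ler_wpM2l ?(ltW h0)// ler_nat.
  rewrite (segment_integral_split (cu 0 (h * m.+1%:R)) hm0 hmS) big_ord_recr/=.
  rewrite mulrDr opprD addrACA (le_trans (ler_normD _ _))//.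
  have -> : e * (h * m.+1%:R) = e * (h * m%:R) + e * h by rewrite -natr1; ring.
  apply: lerD => //.
  have hE : h * m.+1%:R - h * m%:R = h by rewrite -natr1; ring.
  have := @segment_integral_near_cst R _ _ (u (circle_angle n m)) e u hmS (cu _ _).
  rewrite hE [u _ * h]mulrC; apply=> x /andP[x1 x2].
  rewrite angleE; have -> : x = h * m%:R + (x - h * m%:R) by rewrite addrC subrK.
  apply: uP.
  by rewrite ger0_norm ?subr_ge0// (le_lt_trans _ hf)// -[leRHS]hE lerD2r.
have hn : h * n%:R = pi *+ 2 by rewrite /h divfK// gt_eqF.
have := partial n; rewrite hn.
rewrite /circle_mean distrC; set I := Rintegral _ _ _; set S := \sum_(j < n) _ => HI.
have p0 := twopi_gt0 R.
have -> : n%:R^-1 * S - (pi *+ 2)^-1 * I = (h * S - I) / (pi *+ 2).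
  rewrite /h; move: (pi *+ 2) p0 => P P0.
  by field; rewrite !gt_eqF.
by rewrite normrM normfV [`|pi *+ 2|]ger0_norm ?(ltW p0)// ler_pdivrMr.
Qed.

End RiemannSums.

(** * The Herglotz kernel and roots of unity *)

Section HerglotzKernel.
Variable R : realType.
Local Notation C := R[i].
Local Notation modulus := (@ComplexField.Normc.normc R).
Local Notation re := (@complex.Re R).
Implicit Types (z w t : C) (x y r s T theta : R).

Lemma cexp0 : cexp 0 = 1 :> C.
Proof. by rewrite /cexp /circle_point /= expR0 cos0 sin0 mulr1 mulr0. Qed.

Lemma imaginaryMn x n : Complex 0 x *+ n = Complex 0 (x *+ n).
Proof.
by elim: n => [//|n IHn]; rewrite !mulrS IHn; apply/eqP; rewrite eq_complex /= addr0 !eqxx.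
Qed.

Lemma cexpMn z n : cexp (z *+ n) = cexp z ^+ n.
Proof. by elim: n => [|n IHn]; rewrite ?cexp0// mulrS exprS cexpD IHn. Qed.

Lemma cexp_imaginary_eq1 theta : 0 < theta < pi *+ 2 -> cexp (Complex 0 theta) != 1.
Proof.
move=> /andP[t0 t2]; apply/eqP; rewrite /cexp /circle_point /= expR0 !mul1r => -[c1 _].
have : 0 < sin (theta / 2).
  by apply: sin_gt0_pi; rewrite divr_gt0//= ltr_pdivrMr// mulr_natr.
have : cos (theta / 2 *+ 2) = 1 by rewrite -mulr_natr divfK.
rewrite cos_mulr2n cos2sin2 => H s0.
have : sin (theta / 2) ^+ 2 = 0 by move: H; rewrite mulr2n; lra.
by move/eqP; rewrite expf_eq0/= gt_eqF.
Qed.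

(** A geometric sum over the [n]-th roots of unity, whose ratio is a root of
    unity different from [1] unless [m = 0]. *)
Lemma sum_unity_root_powers (n m : nat) : (0 < n)%N -> (m < n)%N ->
  \sum_(j < n) (cexp (Complex 0 (circle_angle R n j)))^-1 ^+ m = (m == 0)%:R * n%:R.
Proof.
move=> n0 mn; have [->|m0] := eqVneq m 0%N.
  by rewrite mul1r (eq_bigr (fun=> 1)) => [|j _]; rewrite ?expr0// sumr_const card_ord.
rewrite mul0r.
have n0' : n%:R != 0 :> R by rewrite pnatr_eq0 -lt0n.
pose z := cexp (Complex 0 (circle_angle R n m)).
have -> : \sum_(j < n) (cexp (Complex 0 (circle_angle R n j)))^-1 ^+ m =
    \sum_(j < n) z^-1 ^+ j.
  apply: eq_bigr => j _; rewrite !exprVn -!cexpMn; congr ((cexp _)^-1).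
  rewrite !imaginaryMn; congr (Complex 0 _).
  rewrite -[LHS]mulr_natr -?[RHS]mulr_natr /circle_angle; move: (pi *+ 2) => P.
  by field.
have z1 : z != 1.
  apply: cexp_imaginary_eq1; rewrite /circle_angle !mulr_gt0 ?twopi_gt0 ?invr_gt0 ?ltr0n//.
    by rewrite gtr_pMr ?twopi_gt0// ltr_pdivrMr ?ltr0n// mul1r ltr_nat.
  by rewrite lt0n.
have zn : z^-1 ^+ n = 1.
  rewrite exprVn -cexpMn (_ : _ *+ n = Complex 0 (pi *+ 2) *+ m).
    rewrite cexpMn (_ : cexp _ = 1) ?expr1n ?invr1//.
    by rewrite /cexp /circle_point /= expR0 cos2pi sin2pi mulr1 mulr0.
  rewrite !imaginaryMn; congr (Complex 0 _).
  rewrite -[LHS]mulr_natr -?[RHS]mulr_natr /circle_angle; move: (pi *+ 2) => P.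
  by field.
apply/eqP; have /eqP := subrX1 z^-1 n; rewrite zn subrr eq_sym mulf_eq0 => /orP[|//].
by rewrite subr_eq0 invr_eq1 (negPf z1).
Qed.

(** The Herglotz kernel: its real part is the Poisson kernel, and it is
    holomorphic in [z] away from [t]. *)
Definition herglotz t z : C := (t + z) / (t - z).

Lemma re_herglotz t z : t != z ->
  re (herglotz t z) = (modulus t ^+ 2 - modulus z ^+ 2) / modulus (t - z) ^+ 2.
Proof.
move=> tz; have : modulus (t - z) ^+ 2 != 0.
  by rewrite expf_neq0// modulus_eq0 subr_eq0.
rewrite /herglotz !modulus_sqr; case: t z {tz} => [a b] [c d] /= H.
by set N := (a - c) ^+ 2 + (b - d) ^+ 2 in H *; field.
Qed.

Lemma re_herglotz_le t z : modulus z < modulus t ->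
  re (herglotz t z) <= (modulus t + modulus z) / (modulus t - modulus z).
Proof.
move=> zt; have tz : t != z by apply: contraTneq zt => ->; rewrite ltxx.
rewrite re_herglotz//; set d := modulus (t - z).
have dt : modulus t - modulus z <= d := modulus_sub_ge t z.
have p : 0 < modulus t - modulus z by rewrite subr_gt0.
have d0 : 0 < d by exact: lt_le_trans dt.
rewrite subr_sqr ler_pdivrMr ?exprn_gt0// mulrAC ler_pdivlMr// mulrAC.
rewrite mulrC ler_wpM2l ?addr_ge0 ?modulus_ge0//.
by rewrite expr2 ler_pM// ltW.
Qed.

Lemma re_herglotz_ge t z : modulus z < modulus t ->
  (modulus t - modulus z) / (modulus t + modulus z) <= re (herglotz t z).
Proof.
move=> zt; have tz : t != z by apply: contraTneq zt => ->; rewrite ltxx.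
rewrite re_herglotz//; set d := modulus (t - z).
have dt : d <= modulus t + modulus z := modulusB t z.
have d0 : 0 < d by rewrite modulus_gt0 subr_eq0.
have p : 0 < modulus t + modulus z by exact: lt_le_trans dt.
have q : 0 <= modulus t - modulus z by rewrite subr_ge0 ltW.
rewrite subr_sqr ler_pdivlMr ?exprn_gt0// mulrAC ler_pdivrMr//.
by rewrite -mulrA ler_wpM2l// expr2 ler_pM// ltW.
Qed.

(** Expanding every kernel in a finite geometric series modulo the [n]-th power,
    the sum over the roots of unity kills all the terms but the constant one.
    As [q] is tiny for large [n], the average of the kernels is close to [1],
    with an explicit error. *)
Lemma mean_herglotz T z (n : nat) : modulus z < T -> (0 < n)%N ->
  let q := (z / T%:C%C) ^+ n in
  \sum_(j < n) herglotz (circle_point T (circle_angle R n j)) z =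
    n%:R * ((1 + q) / (1 - q)).
Proof.
move=> zT n0 q.
have T0 : 0 < T by exact: le_lt_trans (modulus_ge0 z) zT.
have TC0 : T%:C%C != 0 :> C by rewrite -modulus_gt0 modulus_real normr_gt0 gt_eqF.
have mzT : modulus (z / T%:C%C) < 1.
  by rewrite modulusM modulusV modulus_real ger0_norm ?(ltW T0)// ltr_pdivrMr ?mul1r.
have neq1 w : modulus w < 1 -> 1 - w != 0.
  by move=> w1; rewrite subr_eq0; apply: contraTneq w1 => <-; rewrite modulus1 ltxx.
have q1 : 1 - q != 0.
  by apply: neq1; rewrite modulusX exprn_ilt1 ?modulus_ge0// -lt0n.
pose e j := cexp (Complex 0 (circle_angle R n j)).
have e0 j : e j != 0 := cexp_neq0 _.
have en j : e j ^+ n = 1.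
  rewrite -cexpMn (_ : _ *+ n = Complex 0 (pi *+ 2) *+ j).
    rewrite cexpMn (_ : cexp _ = 1) ?expr1n//.
    by rewrite /cexp /circle_point /= expR0 cos2pi sin2pi mulr1 mulr0.
  have n0' : n%:R != 0 :> R by rewrite pnatr_eq0 -lt0n.
  rewrite !imaginaryMn; congr (Complex 0 _).
  rewrite -[LHS]mulr_natr -?[RHS]mulr_natr /circle_angle; move: (pi *+ 2) => P.
  by field.
have term j : herglotz (circle_point T (circle_angle R n j)) z =
    2 / (1 - q) * (\sum_(m < n) (z / T%:C%C) ^+ m * (e j)^-1 ^+ m) - 1.
  pose w := z / T%:C%C * (e j)^-1.
  have w1 : 1 - w != 0.
    apply: neq1; rewrite /w modulusM modulusV modulus_cexp expR0 invr1 mulr1//.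
  have -> : \sum_(m < n) (z / T%:C%C) ^+ m * (e j)^-1 ^+ m = (1 - q) / (1 - w).
    apply/eqP; rewrite eq_sym -(inj_eq (mulfI w1)) mulrCA divff// mulr1; apply/eqP.
    under eq_bigr do rewrite -exprMn.
    have := subrX1 w n; rewrite -(opprB 1 w) -[w ^+ n - 1]opprB mulNr => /oppr_inj <-.
    by rewrite /w exprMn exprVn en invr1 mulr1.
  rewrite /herglotz circle_pointE -/(e j) mulrA divfK//.
  have zE : z = w * (T%:C%C * e j) by rewrite /w; field; rewrite e0.
  rewrite {1 2}zE -[X in _ / (X - _)]mul1r -[X in (X + _) / _]mul1r -mulrDl -mulrBl.
  have Te0 : T%:C%C * e j != 0 by rewrite mulf_neq0.
  rewrite -mulf_div divff// mulr1 (_ : 1 + w = 2 - (1 - w)); last by ring.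
  by rewrite mulrBl divff.
under eq_bigr do rewrite term.
rewrite big_split/= -mulr_sumr exchange_big/= sumr_const card_ord.
have -> : \sum_(m < n) \sum_(j < n) (z / T%:C%C) ^+ m * (e j)^-1 ^+ m = n%:R.
  under eq_bigr do rewrite -mulr_sumr sum_unity_root_powers//.
  case: n n0 q q1 {e e0 en term} => // n _ q q1; rewrite big_ord_recl/= ?expr0 !mul1r.
  by rewrite big1 ?addr0// => i _; rewrite /= mul0r mulr0.
by rewrite -[(-1) *+ n]mulr_natr; field.
Qed.

End HerglotzKernel.

(** * Poisson inequalities *)

Section PoissonInequality.
Variable R : realType.
Local Notation C := R[i].
Local Notation modulus := (@ComplexField.Normc.normc R).
Local Notation cdiff := (@complex_differentiable R).
Local Notation re := (@complex.Re R).
Implicit Types (F : C -> C) (phi : C -> R) (z w t a : C) (x y r s T theta : R).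

Lemma re_sum_real n (x : 'I_n -> R) (w : 'I_n -> C) :
  re (\sum_(j < n) (x j)%:C%C * w j) = \sum_(j < n) x j * re (w j).
Proof.
apply: (big_rec2 (fun (u : C) (p : R) => re u = p)) => [//|j u p _ <-].
by case: u (w j) => [? ?] [? ?] /=; rewrite mul0r subr0.
Qed.

Lemma complex_differentiable_herglotz t z : modulus z < modulus t ->
  cdiff (herglotz t) z.
Proof.
move=> zt; have cst w := @complex_differentiable_cst R w z.
have id := @complex_differentiable_id R z.
apply: complex_differentiableM; first exact: complex_differentiableD (cst t) id.
apply: complex_differentiableV; last exact: complex_differentiableB (cst t) id.
by rewrite subr_eq0; apply: contraTneq zt => ->; rewrite ltxx.
Qed.

Lemma cayley_near1 (q : C) : modulus q <= 4^-1 ->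
  `|re ((1 + q) / (1 - q)) - 1| <= 4 * modulus q.
Proof.
move=> q4; have q1 : 3 / 4 <= modulus (1 - q).
  by apply: le_trans (modulus_sub_ge _ _); rewrite modulus1; lra.
have q0 : 1 - q != 0 by rewrite -modulus_gt0; lra.
have -> : (1 + q) / (1 - q) = 1 + 2 * q / (1 - q) by field.
set w := 2 * q / (1 - q); have -> : re (1 + w) - 1 = re w.
  by case: w => ? ? /=; rewrite addrC addKr.
apply: (le_trans (Re_modulus _)); rewrite /w !modulusM modulusV.
have -> : modulus (2 : C) = 2.
  by rewrite -(rmorph_nat (@real_complex R)) modulus_real ger0_norm.
rewrite ler_pdivrMr; last by rewrite modulus_gt0.
have := ler_wpM2l (modulus_ge0 q) q1; rewrite (mulrC 4) -mulrA.
by have := modulus_ge0 q; lra.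
Qed.

(** The kernels with poles on the circle of radius [T], slightly larger than
    [s], are a positive approximate identity on the circle of radius [s]: at nodes
    near [z] the values of [phi] almost equal [phi z], at the other nodes the
    kernel is small, and [mean_herglotz] evaluates the total mass. *)
Lemma herglotz_approximates_boundary phi s (e : R) : 0 < s -> 0 < e ->
  (forall z, modulus z = s -> {for z, continuous (phi : C^o -> R)}) ->
  exists2 T, s < T & exists N, forall n, (N <= n)%N -> (0 < n)%N ->
  forall z, modulus z = s -> phi z - e <= n%:R^-1 * \sum_(j < n)
    phi (circle_point s (circle_angle R n j)) *
      re (herglotz (circle_point T (circle_angle R n j)) z).
Proof.
move=> s0 e0 cphi; pose f := e / 4; have f0 : 0 < f by rewrite divr_gt0.
have e4 : e = 4 * f by rewrite /f; field.
clearbody f.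
have [d d0 dP] := compact_uniform_continuous (compact_circle s0) f0 cphi.
have [U U0 phiU] := compact_bounded_modulus (compact_circle s0) cphi.
(* A node at distance [d] from [z] stays at distance [d / 2] when it is moved to
   the outer circle; the last bound makes the kernel small there, and [1] only
   simplifies the estimate of [T ^+ 2 - s ^+ 2]. *)
pose tau := Num.min (d / 2) (Num.min 1 (f * d ^+ 2 / (8 * U * (2 * s + 1)))).
have s21 : 0 < 2 * s + 1 by rewrite addr_gt0// mulr_gt0.
have tau0 : 0 < tau.
  by rewrite !lt_min !divr_gt0 ?mulr_gt0 ?exprn_gt0 ?ltr01.
have [tau_d tau_1 tau_f] : [/\ tau <= d / 2, tau <= 1 &
    tau <= f * d ^+ 2 / (8 * U * (2 * s + 1))].
  by split; rewrite !ge_min lexx ?orbT.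
exists (s + tau) => [|]; first by rewrite ltrDl.
set T := s + tau; have T0 : 0 < T by rewrite addr_gt0.
have sT : s < T by rewrite ltrDl.
have [N NP] : exists N, forall n, (N <= n)%N ->
    (s / T) ^+ n < Num.min 4^-1 (f / (4 * U)).
  have /cvgr0Pnorm_lt H : (s / T) ^+ n @[n --> \oo] --> (0 : R).
    apply: cvg_expr; rewrite ger0_norm ?divr_ge0 ?(ltW s0) ?(ltW T0)//.
    by rewrite ltr_pdivrMr ?mul1r.
  have [|N _ NP] := H (Num.min 4^-1 (f / (4 * U))).
    by rewrite lt_min; apply/andP; split; rewrite ?invr_gt0// divr_gt0// mulr_gt0.
  exists N => n /NP; rewrite ger0_norm// exprn_ge0// divr_ge0 ?(ltW s0) ?(ltW T0)//.
exists N => n Nn n0 z zs.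
pose t j := circle_point T (circle_angle R n j).
pose p j := circle_point s (circle_angle R n j).
pose k j := re (herglotz (t j) z).
have mt j : modulus (t j) = T := modulus_circle_point _ (ltW T0).
have mp j : modulus (p j) = s := modulus_circle_point _ (ltW s0).
have k0 j : 0 <= k j.
  apply: le_trans (@re_herglotz_ge _ _ _ _); last by rewrite mt zs.
  rewrite mt zs; apply: divr_ge0; first by rewrite subr_ge0 (ltW sT).
  exact: ltW (addr_gt0 T0 s0).
have pt j : modulus (t j - p j) = tau.
  rewrite /t /p !circle_pointE -mulrBl modulusM modulus_cexp expR0 mulr1.
  by rewrite -rmorphB modulus_real /T addrC addKr ger0_norm// ltW.
have term j : phi z * k j - (f * k j + f) <= phi (p j) * k j.
  have [near|far] := ltP (modulus (p j - z)) d.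
    have := ler_wpM2r (k0 j) (ltW (dP z zs (p j) near)).
    have : (phi z - phi (p j)) * k j <= `|phi (p j) - phi z| * k j.
      by rewrite ler_wpM2r// distrC ler_norm.
    by rewrite mulrBl; lra.
  have tz : d / 2 <= modulus (t j - z).
    have := modulus_dist_triangle (p j) (t j) z.
    by rewrite [modulus (p j - t j)]modulus_distC pt; lra.
  have tz0 : 0 < modulus (t j - z) by apply: lt_le_trans tz; rewrite divr_gt0.
  have kle : 2 * U * k j <= f.
    rewrite /k re_herglotz; last by rewrite -subr_eq0 -modulus_gt0.
    rewrite mt zs mulrA ler_pdivrMr ?exprn_gt0//.
    have H1 : f * (d / 2) ^+ 2 <= f * modulus (t j - z) ^+ 2.
      rewrite ler_wpM2l ?(ltW f0)// ler_pXn2r// nnegrE ?modulus_ge0//.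
      by rewrite divr_ge0 ?(ltW d0).
    apply: le_trans H1.
    have -> : 2 * U * (T ^+ 2 - s ^+ 2) = 2 * U * (tau * (2 * s + tau)) by rewrite /T; ring.
    have H2 : 2 * U * (tau * (2 * s + tau)) <= 2 * U * (tau * (2 * s + 1)).
      by rewrite ler_wpM2l ?mulr_ge0 ?(ltW U0)// ler_wpM2l ?(ltW tau0)// lerD2l.
    apply: (le_trans H2); move: tau_f; rewrite ler_pdivlMr; last by rewrite !mulr_gt0.
    by rewrite expr_div_n; lra.
  have : (phi z - phi (p j)) * k j <= 2 * U * k j.
    rewrite ler_wpM2r// (le_trans (ler_norm _))// (le_trans (ler_normB _ _))//.
    by rewrite mulr2n mulrDl mul1r lerD// phiU.
  have := mulr_ge0 (ltW f0) (k0 j).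
  by rewrite mulrBl; lra.
pose q := (z / T%:C%C) ^+ n.
have mq : modulus q = (s / T) ^+ n.
  by rewrite modulusX modulusM modulusV modulus_real zs ger0_norm ?(ltW T0).
pose W := re ((1 + q) / (1 - q)).
have n0' : 0 < n%:R :> R by rewrite ltr0n.
have sumk : \sum_(j < n) k j = n%:R * W.
  have := @mean_herglotz _ T z n; rewrite zs => /(_ sT n0) H.
  have := re_sum_real (fun _ : 'I_n => 1) (fun j => herglotz (t j) z).
  under eq_bigr do rewrite mul1r.
  under [in RHS]eq_bigr do rewrite mul1r.
  rewrite H -/q /k => <-; rewrite -[n%:R in LHS](rmorph_nat (@real_complex R)).
  by rewrite /W; case: (_ / _) => ? ? /=; rewrite mul0r subr0.
have := NP n Nn; rewrite lt_min -mq => /andP[q4 qf].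
have W1 := cayley_near1 (ltW q4); rewrite -/W in W1.
rewrite ler_pdivlMl//.
have : \sum_(j < n) (phi z * k j - (f * k j + f)) <= \sum_(j < n) phi (p j) * k j.
  by apply: ler_sum => j _; exact: term.
apply: le_trans; rewrite sumrB big_split/= -!mulr_sumr sumk sumr_const card_ord.
rewrite -[f *+ n]mulr_natl.
have -> : phi z * (n%:R * W) - (f * (n%:R * W) + n%:R * f) =
  n%:R * (phi z * W - (f * W + f)) by ring.
rewrite ler_pM2l//.
have phizU : `|phi z * (W - 1)| <= f.
  rewrite normrM (le_trans (ler_pM _ _ (phiU z zs) W1))//.
  by rewrite mulrCA mulrA -ler_pdivlMl ?mulr_gt0// mulrC ltW.
have W2 : `|W - 1| <= 1 by rewrite (le_trans W1)//; lra.
move: phizU W2; rewrite !ler_norml => /andP[A1 A2] /andP[A3 A4].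
have : f * W <= f * 2 by rewrite ler_wpM2l ?(ltW f0)//; lra.
rewrite e4; lra.
Qed.

(** The finite sum [Q] of kernels is holomorphic on the closed disc and its real
    part dominates [phi], up to [e], on the circle. So [F * exp (- Q)] is bounded
    by [exp e] on the circle, and by the maximum principle inside: [Q] serves as
    the holomorphic majorant that an exact Poisson integral would provide. *)
Lemma modulus_le_herglotz_sum F phi s a (e : R) : 0 < s ->
  (forall z, modulus z <= s -> cdiff F z) ->
  (forall z, modulus z = s -> {for z, continuous (phi : C^o -> R)}) ->
  (forall z, modulus z = s -> modulus (F z) <= expR (phi z)) ->
  modulus a < s -> 0 < e ->
  exists2 T, s < T & exists N, forall n, (N <= n)%N -> (0 < n)%N ->
  modulus (F a) <= expR (n%:R^-1 * (\sum_(j < n)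
    phi (circle_point s (circle_angle R n j)) *
      re (herglotz (circle_point T (circle_angle R n j)) a)) + e).
Proof.
move=> s0 dF cphi Fphi as_ e0.
have [T sT [N NP]] := herglotz_approximates_boundary s0 e0 cphi.
have T0 : 0 < T := lt_trans s0 sT.
exists T => //; exists N => n Nn n0.
pose c j := n%:R^-1 * phi (circle_point s (circle_angle R n j)).
pose Q z := \sum_(j < n) (c j)%:C%C * herglotz (circle_point T (circle_angle R n j)) z.
have reQ z : re (Q z) = n%:R^-1 * \sum_(j < n)
    phi (circle_point s (circle_angle R n j)) *
      re (herglotz (circle_point T (circle_angle R n j)) z).
  rewrite /Q re_sum_real mulr_sumr; apply: eq_bigr => j _.
  by rewrite /c mulrA.
have dQ z : modulus z <= s -> cdiff Q z.
  move=> zs; apply: complex_differentiable_sum => j _.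
  apply: complex_differentiableM; first exact: complex_differentiable_cst.
  apply: complex_differentiable_herglotz.
  by rewrite (modulus_circle_point _ (ltW T0)) (le_lt_trans zs).
pose G z := F z * cexp (0 - Q z).
have mG z : modulus (G z) = modulus (F z) * expR (- re (Q z)).
  rewrite /G modulusM modulus_cexp; congr (_ * expR _).
  by case: (Q z) => ? ? /=; rewrite sub0r.
have : modulus (G a) <= expR e.
  apply: (@maximum_principle _ G s _ a s0 _ _ as_) => z zs.
    apply: complex_differentiableM; first exact: dF.
    apply: (@complex_differentiable_comp _ (fun w => 0 - Q w) (@cexp R)).
      apply: complex_differentiableB; first exact: complex_differentiable_cst.
      exact: dQ.
    exact: complex_differentiable_cexp.
  have := NP n Nn n0 z zs; rewrite -reQ mG => H.
  rewrite (le_trans (ler_wpM2r (expR_ge0 _) (Fphi z zs)))// -expRD ler_expR.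
  by lra.
rewrite mG -reQ expRN ler_pdivrMr ?expR_gt0// -expRD addrC.
by [].
Qed.

Lemma expR_infimum (x y : R) : 0 <= x -> (forall e, 0 < e -> x <= expR (y + e)) ->
  x <= expR y.
Proof.
move=> x0 H; have [->|xn0] := eqVneq x 0; first exact: expR_ge0.
have {}x0 : 0 < x by rewrite lt_def xn0.
rewrite -[x]lnK ?posrE// ler_expR; apply/ler_addgt0Pr => e e0.
by rewrite -ler_expR lnK ?posrE// H.
Qed.

(** The Poisson kernel of the disc is at most [(s + |a|) / (s - |a|)] times the
    uniform density, so a nonnegative boundary majorant enters through its
    circle mean alone. *)
Lemma poisson_upper F phi s a : 0 < s ->
  (forall z, modulus z <= s -> cdiff F z) ->
  (forall z, modulus z = s -> {for z, continuous (phi : C^o -> R)}) ->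
  (forall z, modulus z = s -> modulus (F z) <= expR (phi z)) ->
  (forall z, modulus z = s -> 0 <= phi z) ->
  modulus a < s ->
  modulus (F a) <= expR ((s + modulus a) / (s - modulus a) * circle_mean phi s).
Proof.
move=> s0 dF cphi Fphi phi0 as_; apply: expR_infimum => [|e e0].
  exact: modulus_ge0.
have a0 := modulus_ge0 a.
set K := (s + _) / _; have K0 : 0 < K.
  by rewrite divr_gt0 ?subr_gt0// ltr_wpDr.
have e20 : 0 < e / 2 by rewrite divr_gt0.
have eK0 : 0 < e / 2 / K by rewrite divr_gt0.
have [T sT [N1 H1]] := modulus_le_herglotz_sum s0 dF cphi Fphi as_ e20.
have [N2 H2] := riemann_sum_circle_mean s0 eK0 cphi.
set n := (maxn N1 N2).+1.
have N1n : (N1 <= n)%N by rewrite leqW// leq_maxl.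
have N2n : (N2 <= n)%N by rewrite leqW// leq_maxr.
apply: (le_trans (H1 n N1n isT)); rewrite ler_expR.
have := H2 n N2n isT; rewrite ler_distl => /andP[_ H3].
set S := \sum_(j < n) phi _ in H3.
rewrite {2}[e]splitr addrA lerD2r; apply: (@le_trans _ _ (K * (n%:R^-1 * S))).
  rewrite mulrCA ler_wpM2l ?invr_ge0// mulr_sumr; apply: ler_sum => j _.
  rewrite mulrC ler_wpM2r ?phi0 ?modulus_circle_point ?(ltW s0)//.
  have mt := modulus_circle_point (circle_angle R n j) (ltW (lt_trans s0 sT)).
  apply: (le_trans (@re_herglotz_le _ _ _ _)); rewrite mt ?(lt_trans as_)//.
  rewrite /K ler_pdivrMr ?subr_gt0 ?(lt_trans as_)// mulrAC ler_pdivlMr ?subr_gt0//.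
  have := mulr_ge0 (ltW (lt_trans s0 sT)) a0.
  have : 0 <= (T - s) * modulus a by rewrite mulr_ge0// subr_ge0 ltW.
  by lra.
apply: (le_trans (ler_wpM2l (ltW K0) H3)); rewrite mulrDr lerD2l mulrC divfK//.
by rewrite gt_eqF.
Qed.

(** Dually, the Poisson kernel is at least [(s - |a|) / (s + |a|)] times the
    uniform density; read backwards, the value of [F] at one point bounds the
    mean of [phi] from above. *)
Lemma poisson_lower F phi s a : 0 < s ->
  (forall z, modulus z <= s -> cdiff F z) ->
  (forall z, modulus z = s -> {for z, continuous (phi : C^o -> R)}) ->
  (forall z, modulus z = s -> modulus (F z) <= expR (- phi z)) ->
  (forall z, modulus z = s -> 0 <= phi z) ->
  modulus a < s ->
  modulus (F a) <= expR (- ((s - modulus a) / (s + modulus a) * circle_mean phi s)).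
Proof.
move=> s0 dF cphi Fphi phi0 as_; apply: expR_infimum => [|e e0].
  exact: modulus_ge0.
have a0 := modulus_ge0 a.
set K := (s - _) / _; have K0 : 0 < K.
  by rewrite divr_gt0 ?subr_gt0// ltr_wpDr.
have e20 : 0 < e / 2 by rewrite divr_gt0.
have eK0 : 0 < e / 2 / K by rewrite divr_gt0.
have cNphi z : modulus z = s -> {for z, continuous ((fun w => - phi w) : C^o -> R)}.
  by move=> zs; apply: continuousN; exact: cphi.
have [T sT [N1 H1]] := modulus_le_herglotz_sum s0 dF cNphi Fphi as_ e20.
have [N2 H2] := riemann_sum_circle_mean s0 eK0 cphi.
set n := (maxn N1 N2).+1.
have N1n : (N1 <= n)%N by rewrite leqW// leq_maxl.
have N2n : (N2 <= n)%N by rewrite leqW// leq_maxr.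
apply: (le_trans (H1 n N1n isT)); rewrite ler_expR.
have := H2 n N2n isT; rewrite ler_distl => /andP[H3 _].
set S := \sum_(j < n) phi _ in H3.
rewrite {2}[e]splitr addrA lerD2r; apply: (@le_trans _ _ (- (K * (n%:R^-1 * S)))).
  rewrite mulrCA -mulrN ler_wpM2l ?invr_ge0// mulr_sumr -sumrN; apply: ler_sum => j _.
  rewrite mulNr lerN2 mulrC ler_wpM2l ?phi0 ?modulus_circle_point ?(ltW s0)//.
  have mt := modulus_circle_point (circle_angle R n j) (ltW (lt_trans s0 sT)).
  apply: (le_trans _ (@re_herglotz_ge _ _ _ _)); rewrite mt ?(lt_trans as_)//.
  rewrite /K ler_pdivrMr ?ltr_wpDr// mulrAC ler_pdivlMr; last first.
    by rewrite ltr_wpDr// (lt_trans s0).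
  have : 0 <= (T - s) * modulus a by rewrite mulr_ge0// subr_ge0 ltW.
  by lra.
have := ler_wpM2l (ltW K0) H3; rewrite mulrBr (mulrC K (e / 2 / K)) divfK ?gt_eqF//.
by lra.
Qed.

End PoissonInequality.

(** * Poles of a meromorphic function *)

Section Poles.
Variable R : realType.
Local Notation C := R[i].
Local Notation modulus := (@ComplexField.Normc.normc R).
Local Notation cdiff := (@complex_differentiable R).
Implicit Types (f F g : C -> C) (a b z w : C) (r s S t : R).

Lemma near_complex_differentiable f a : holomorphic_at f a ->
  exists2 d : R, 0 < d & forall z, modulus (z - a) < d -> cdiff f z.
Proof. by move/near_modulusP. Qed.

Lemma holomorphic_at_complex_differentiable f a : holomorphic_at f a -> cdiff f a.
Proof.
by move/near_complex_differentiable => [d d0]; apply; rewrite subrr modulus0.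
Qed.

Lemma has_pole_near f a n : has_pole_of_order f a n -> (0 < n)%N /\
  exists g (d : R), [/\ 0 < d, g a != 0,
    forall z, modulus (z - a) < d -> cdiff g z &
    forall z, modulus (z - a) < d -> z != a -> f z = g z / (z - a) ^+ n].
Proof.
move=> [n0 [g [/near_complex_differentiable[d1 d10 dg] ga /near_modulusP[d2 d20 fg]]]].
split=> //; exists g, (Num.min d1 d2); split=> //.
- by rewrite lt_min d10.
- by move=> z; rewrite lt_min => /andP[/dg].
- by move=> z; rewrite lt_min => /andP[_ /fg].
Qed.

(** Near a pole [(z - a) ^+ n * f z] stays away from [0], which continuity of
    [f] at [a] forbids. *)
Lemma complex_differentiable_no_pole f a : cdiff f a -> ~ has_pole f a.
Proof.
move=> /complex_differentiable_continuous/complex_continuousP cf [n].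
move=> /has_pole_near[n0 [g [d [d0 ga dg fg]]]].
have /complex_differentiable_continuous/complex_continuousP cg : cdiff g a.
  by apply: dg; rewrite subrr modulus0.
have ga0 : 0 < modulus (g a) / 2 by rewrite divr_gt0// modulus_gt0.
have [d1 d10 fP] := cf 1 ltr01; have [d2 d20 gP] := cg _ ga0.
pose K := modulus (f a) + 1.
have K0 : 0 < K by rewrite ltr_wpDl ?modulus_ge0.
(* A real displacement so small that [x ^+ n * modulus (f (a + x))] falls below
   half of [modulus (g a)]. *)
pose x := Num.min (Num.min (Num.min d d1) (Num.min d2 1)) (modulus (g a) / 2 / K) / 2.
have x0 : 0 < x by rewrite divr_gt0// !lt_min d0 d10 d20 ltr01 divr_gt0.
have mx : modulus (a + x%:C%C - a) = x.
  by rewrite addrC addKr modulus_real ger0_norm ?ltW.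
have : x < Num.min (Num.min (Num.min d d1) (Num.min d2 1)) (modulus (g a) / 2 / K).
  by rewrite /x ltr_pdivrMr// ltr_pMr ?ltr1n// !lt_min d0 d10 d20 ltr01 divr_gt0.
rewrite !lt_min => /andP[/andP[/andP[xd xd1] /andP[xd2 x1]] xK].
pose z := a + x%:C%C; rewrite -/z in mx.
have za : z - a != 0 by rewrite -modulus_gt0 mx.
have {}fP : modulus (f z) < K.
  rewrite -[f z](subrK (f a)) (le_lt_trans (modulusD _ _))// addrC /K ltrD2l.
  by apply: fP; rewrite mx.
have {}gP : modulus (g a) / 2 < modulus (g z).
  have : modulus (g z - g a) < modulus (g a) / 2 by apply: gP; rewrite mx.
  have := modulus_sub_ge (g a) (g z); rewrite modulus_distC; lra.
have : modulus (g z) = x ^+ n * modulus (f z).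
  rewrite fg ?mx//; last by rewrite -subr_eq0.
  rewrite modulusM modulusV modulusX mx mulrC divfK//.
  by rewrite expf_neq0// gt_eqF.
move=> gzE; move: gP; rewrite gzE; apply/negP; rewrite -leNgt.
have xn : x ^+ n <= x.
  by case: n n0 {fg gzE} => // n _; rewrite exprS ler_piMr ?(ltW x0)// exprn_ile1 ?ltW.
move: xK; rewrite ltr_pdivlMr// => xK; apply: le_trans (ltW xK).
by rewrite ler_pM ?exprn_ge0 ?modulus_ge0 ?(ltW x0) ?(ltW fP).
Qed.

Lemma meromorphic_punctured f a : meromorphic f ->
  exists2 d : R, 0 < d & forall z, z != a -> modulus (z - a) < d -> cdiff f z.
Proof.
move=> /(_ a)[/near_complex_differentiable[d d0 df]|[n]].
  by exists d => // z _; exact: df.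
move=> /has_pole_near[n0 [g [d [d0 ga dg fg]]]]; exists d => // z za zd.
have z0 : 0 < modulus (z - a) by rewrite modulus_gt0 subr_eq0.
apply: (@complex_differentiable_near _ (fun w => g w / (w - a) ^+ n)).
  apply/near_modulusP; exists (Num.min (modulus (z - a)) (d - modulus (z - a))).
    by rewrite lt_min z0 subr_gt0.
  move=> w; rewrite lt_min => /andP[wz wd]; rewrite fg//.
    by have := modulus_dist_triangle w z a; lra.
  by apply: contraTneq wz => ->; rewrite modulus_distC ltxx.
apply: complex_differentiableM; first exact: dg.
apply: complex_differentiableV; first by rewrite expf_neq0// subr_eq0.
have -> : (fun w => (w - a) ^+ n) = (fun w => \prod_(i < n) (w - a)).
  by apply: funext => w; rewrite prodr_const card_ord.
apply: complex_differentiable_prod => i _; apply: complex_differentiableB.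
  exact: complex_differentiable_id.
exact: complex_differentiable_cst.
Qed.

Lemma pole_orderP f a : has_pole f a -> has_pole_of_order f a (pole_order f a).
Proof. by move=> [n fn]; apply: (@xgetPex _ 0%N); exists n. Qed.

Lemma pole_order_eq0 f a : ~ has_pole f a -> pole_order f a = 0%N.
Proof. by move=> fa; apply: xgetPN => n fn; apply: fa; exists n. Qed.

Lemma pole_order_gt0 f a : has_pole f a -> (0 < pole_order f a)%N.
Proof. by move=> /pole_orderP[]. Qed.

(** Poles are isolated, and the disc is covered by finitely many discs that
    contain no pole besides their centers. *)
Lemma finite_poles f S : meromorphic f ->
  finite_set [set a : C | modulus a <= S /\ has_pole f a].
Proof.
move=> fm; have := @compact_disc R S; rewrite compact_cover => cov.
have /boolp.choice[d dP] : forall a : C, exists e : R, 0 < e /\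
    forall z, z != a -> modulus (z - a) < e -> ~ has_pole f z.
  move=> a; have [e e0 H] := meromorphic_punctured a fm.
  by exists e; split=> // z za zd; exact/complex_differentiable_no_pole/H.
pose U (a : C) : set C^o := [set z | modulus (z - a) < d a].
have [a _|z zS|D _ DP] := cov C setT U.
- rewrite openE => z /= zd; apply/near_modulusP.
  exists (d a - modulus (z - a)) => [|w wz]; first by rewrite subr_gt0.
  by rewrite /U /=; have := modulus_dist_triangle w z a; lra.
- by exists z => //; rewrite /U /= subrr modulus0; have [] := dP z.
- apply: sub_finite_set (finite_fset D) => a [aS fa].
  have [b /= bD] := DP a aS; rewrite /U /= => ab.
  have [->//|neq] := eqVneq a b.
  by have [_ /(_ a neq ab)] := dP b.
Qed.

Definition pole_seq f S : seq C :=
  finite_support (0 : R) [set a : C | modulus a <= S]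
    (fun a => (pole_order f a)%:R).

Lemma pole_count_seq f S :
  pole_count f S = (\sum_(b <- pole_seq f S) pole_order f b)%:R.
Proof. by rewrite natr_sum. Qed.

Lemma mem_pole_seq f S b : meromorphic f ->
  (b \in pole_seq f S) <-> (modulus b <= S /\ has_pole f b).
Proof.
move=> fm; rewrite in_finite_support; last first.
  apply: sub_finite_set (finite_poles S fm) => a [aS]; rewrite /preimage /= => oa.
  split=> //; apply: contrapT => /pole_order_eq0 fa.
  by apply: oa; rewrite fa.
split=> [/set_mem[bS]|[bS fb]].
  rewrite /preimage /= => ob; split=> //; apply: contrapT => /pole_order_eq0 fb.
  by apply: ob; rewrite fb.
apply/mem_set; split=> //; rewrite /preimage /= => /eqP.
by rewrite pnatr_eq0 -leqn0 leqNgt pole_order_gt0.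
Qed.

(** The monic polynomial whose zeros are the poles of [f] in the closed disc of
    radius [S], with multiplicities. *)
Definition pole_poly f S z : C := \prod_(b <- pole_seq f S) (z - b) ^+ pole_order f b.

Lemma prod_power_ge (I : eqType) (D : seq I) (x : I -> R) (o : I -> nat) (m : R) :
  0 <= m -> (forall b : I, b \in D -> m <= x b) ->
  m ^+ (\sum_(b <- D) o b)%N <= \prod_(b <- D) x b ^+ o b.
Proof.
move=> m0; elim: D => [|b D IHD] H; first by rewrite !big_nil.
rewrite !big_cons exprD ler_pM ?exprn_ge0// ?IHD//.
  have mb : m <= x b by apply: H; rewrite inE eqxx.
  by rewrite lerXn2r ?nnegrE// (le_trans m0).
by move=> b' b'D; apply: H; rewrite inE b'D orbT.
Qed.

Lemma prod_power_le (I : eqType) (D : seq I) (x : I -> R) (o : I -> nat) (M : R) :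
  (forall b : I, b \in D -> 0 <= x b <= M) ->
  \prod_(b <- D) x b ^+ o b <= M ^+ (\sum_(b <- D) o b)%N.
Proof.
elim: D => [|b D IHD] H; first by rewrite !big_nil.
have H' (b' : I) : b' \in D -> 0 <= x b' <= M by move=> b'D; apply: H; rewrite inE b'D orbT.
have /andP[xb0 xbM] : 0 <= x b <= M by apply: H; rewrite inE eqxx.
rewrite !big_cons exprD ler_pM ?exprn_ge0 ?IHD//.
  by rewrite big_seq; apply: prodr_ge0 => b' /H' /andP[? _]; rewrite exprn_ge0.
by rewrite lerXn2r ?nnegrE// (le_trans xb0).
Qed.

Lemma complex_differentiable_powers (D : seq C) (o : C -> nat) (P : pred C) z :
  cdiff (fun w => \prod_(b <- D | P b) (w - b) ^+ o b) z.
Proof.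
apply: complex_differentiable_prod => b _.
have -> : (fun w => (w - b) ^+ o b) = (fun w => \prod_(i < o b) (w - b)).
  by apply: funext => w; rewrite prodr_const card_ord.
apply: complex_differentiable_prod => i _; apply: complex_differentiableB.
  exact: complex_differentiable_id.
exact: complex_differentiable_cst.
Qed.

(** The values of [f] at its poles are arbitrary, so the product of [f] with
    [pole_poly f S] has to be redefined there, through the local factors of the
    poles. *)
Lemma clear_poles f S : meromorphic f -> exists F,
  (forall z, modulus z <= S -> cdiff F z) /\
  (forall z, modulus z <= S -> ~ has_pole f z -> F z = f z * pole_poly f S z).
Proof.
move=> fm; pose o := pole_order f; pose D := pole_seq f S.
have /boolp.choice[G HG] : forall b : C, exists g : C -> C,
    has_pole f b -> exists d : R,
    [/\ 0 < d, forall z, modulus (z - b) < d -> cdiff g z &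
    forall z, modulus (z - b) < d -> z != b -> f z = g z / (z - b) ^+ o b].
  move=> b; have [fb|fb] := pselect (has_pole f b); last by exists id.
  have [_ [g [d [d0 _ dg fg]]]] := has_pole_near (pole_orderP fb).
  by exists g => _; exists d.
pose Q b z := \prod_(b' <- D | b' != b) (z - b') ^+ o b'.
have polyE b z : b \in D -> pole_poly f S z = (z - b) ^+ o b * Q b z.
  by move=> bD; rewrite /pole_poly (bigD1_seq b)// finite_support_uniq.
pose F z := if `[< has_pole f z >] then G z z * Q z z else f z * pole_poly f S z.
exists F; split=> [z zS|z zS fz]; last by rewrite /F; case: asboolP.
have [e e0 He] := meromorphic_punctured z fm.
have npole w : w != z -> modulus (w - z) < e -> ~ has_pole f w.
  by move=> wz we; exact/complex_differentiable_no_pole/He.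
have [fz|fz] := pselect (has_pole f z).
  have [d [d0 dG fG]] := HG z fz; have zD : z \in D by apply/mem_pole_seq.
  apply: (@complex_differentiable_near _ (fun w => G z w * Q z w)).
    apply/near_modulusP; exists (Num.min d e); first by rewrite lt_min d0.
    move=> w; rewrite lt_min => /andP[wd we]; rewrite /F.
    have [->|wz] := eqVneq w z; first by case: asboolP.
    case: asboolP => [/(npole w wz we)//|_]; rewrite (polyE z)// fG//.
    by rewrite mulrA divfK// expf_neq0// subr_eq0.
  apply: complex_differentiableM; first by apply: dG; rewrite subrr modulus0.
  exact: complex_differentiable_powers.
apply: (@complex_differentiable_near _ (fun w => f w * pole_poly f S w)).
  apply/near_modulusP; exists e => // w we; rewrite /F.
  case: asboolP => // fw; have [wz|wz] := eqVneq w z; first by rewrite wz in fw.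
  by case: (npole w wz we).
apply: complex_differentiableM; last exact: complex_differentiable_powers.
by case: (fm z) => [/holomorphic_at_complex_differentiable|].
Qed.

End Poles.

(** * The pole counting function *)

Section CountingFunction.
Variable R : realType.
Local Notation C := R[i].
Local Notation modulus := (@ComplexField.Normc.normc R).
Local Notation cdiff := (@complex_differentiable R).
Local Notation mu := (@lebesgue_measure R).
Implicit Types (f F g : C -> C) (a b z w : C) (r s S t : R).

Lemma pole_count_restrict f S t : meromorphic f -> t <= S ->
  pole_count f t = \sum_(b <- pole_seq f S | modulus b <= t) (pole_order f b)%:R.
Proof.
move=> fm tS; rewrite -big_filter; apply: perm_big; apply: uniq_perm.
- exact: finite_support_uniq.
- by rewrite filter_uniq// finite_support_uniq.
move=> b; rewrite mem_filter; apply/idP/idP.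
- move/(mem_pole_seq t b fm) => [bt fb]; rewrite bt/=.
  by apply/mem_pole_seq => //; split=> //; exact: le_trans tS.
- by move=> /andP[bt] /(mem_pole_seq S b fm)[_ fb]; apply/mem_pole_seq.
Qed.

Lemma pole_count_ge0 f t : 0 <= pole_count f t.
Proof. by rewrite pole_count_seq ler0n. Qed.

Lemma pole_count_mono f s t : meromorphic f -> s <= t -> pole_count f s <= pole_count f t.
Proof.
move=> fm st; rewrite (pole_count_restrict fm st) (pole_count_restrict fm (lexx t)).
rewrite big_mkcond [leRHS]big_mkcond/=; apply: ler_sum => b _.
by case: ifP => [/le_trans/(_ st) ->//|_]; case: ifP.
Qed.

Lemma pole_count_near0 f : meromorphic f ->
  exists2 d : R, 0 < d & forall t, 0 <= t < d -> pole_count f t = pole_count f 0.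
Proof.
move=> fm; have [d d0 dP] := meromorphic_punctured 0 fm.
exists d => // t /andP[t0 td]; rewrite (pole_count_restrict fm (lexx t)).
rewrite (pole_count_restrict fm t0) [LHS]big_seq_cond [RHS]big_seq_cond.
apply: eq_bigl => b; apply: andb_id2l => /(mem_pole_seq t b fm)[bt fb].
have [->|b0] := eqVneq b 0; first by rewrite modulus0 t0 lexx.
case: (@complex_differentiable_no_pole _ f b) => //.
by apply: dP => //; rewrite subr0 (le_lt_trans bt).
Qed.

Definition counting_integrand f t : R := (pole_count f t - pole_count f 0) / t.

Lemma counting_integrand_ge0 f t : meromorphic f -> 0 < t -> 0 <= counting_integrand f t.
Proof.
by move=> fm t0; rewrite divr_ge0 ?subr_ge0 ?pole_count_mono ?(ltW t0).
Qed.

(** The integrand vanishes near [0], since poles are isolated; so the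
    denominator may be replaced by [Num.max t d], and the numerator is a finite
    combination of indicators of half-lines. *)
Lemma counting_integrand_integrable f r : meromorphic f ->
  mu.-integrable `]0, r] (EFin \o counting_integrand f).
Proof.
move=> fm; have [d d0 dP] := pole_count_near0 fm.
pose g t := (\sum_(b <- pole_seq f r)
  (pole_order f b)%:R * \1_`[modulus b, +oo[ t - pole_count f 0) * (Num.max t d)^-1.
have hg t : t \in `]0, r] -> counting_integrand f t = g t.
  rewrite in_itv/= => /andP[t0 tr]; rewrite /g /counting_integrand.
  have <- : pole_count f t =
      \sum_(b <- pole_seq f r) (pole_order f b)%:R * \1_`[modulus b, +oo[ t.
    rewrite (pole_count_restrict fm tr) big_mkcond/=; apply: eq_bigr => b _.
    rewrite indicE mem_setE in_itv/= andbT.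
    by case: ifP => _; rewrite ?mulr1 ?mulr0.
  have [td|dt] := ltP t d; last by [].
  by rewrite dP ?subrr ?mul0r// (ltW t0).
have mg : measurable_fun `]0, r] g.
  apply: measurable_funM.
    apply: measurable_funB; last exact: measurable_cst.
    apply: measurable_sum => b; apply: measurable_funM; first exact: measurable_cst.
    exact: measurable_indic.
  apply: measurable_funTS; apply: continuous_measurable_fun => t.
  apply: cvgV; first by rewrite gt_eqF// lt_max d0 orbT.
  by apply: (@continuous_max _ _ id (cst d)); [exact: cvg_id|exact: cvg_cst].
suff ig : mu.-integrable `]0, r] (EFin \o g).
  apply: eq_integrable ig => // t.
  by rewrite inE /= => tr; rewrite hg.
apply: measurable_bounded_integrable => //.
  by rewrite /= lebesgue_measure_itv/=; case: ifP => // _; rewrite -EFinB ltry.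
exists (pole_count f r / d); split; first exact: num_real.
move=> M dM t /= tr; rewrite -hg//; apply: le_trans (ltW dM).
move: tr; rewrite in_itv/= => /andP[t0 tr].
rewrite ger0_norm ?counting_integrand_ge0// /counting_integrand.
have [td|dt] := ltP t d.
  by rewrite dP ?(ltW t0)// subrr mul0r divr_ge0 ?pole_count_ge0 ?(ltW d0).
rewrite ler_pM ?invr_ge0 ?(ltW t0) ?subr_ge0 ?pole_count_mono ?(ltW t0)//.
  by rewrite lerBlDr (le_trans (pole_count_mono fm tr))// lerDl pole_count_ge0.
by rewrite lef_pV2 ?posrE.
Qed.

Lemma pole_counting_ge0 f r : meromorphic f -> 1 <= r -> 0 <= pole_counting f r.
Proof.
move=> fm r1; rewrite /pole_counting addr_ge0 ?mulr_ge0 ?pole_count_ge0 ?ln_ge0//.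
apply: Rintegral_ge0 => t /=; rewrite in_itv/= => /andP[t0 _].
exact: counting_integrand_ge0.
Qed.

(** On the interval from [S] to [2 * S] the integrand that defines
    [pole_counting] is at least [(pole_count f S - pole_count f 0) / (2 * S)]. *)
Lemma pole_count_le_counting f S : meromorphic f -> 1 <= S -> expR 1 <= 2 * S ->
  pole_count f S <= 2 * pole_counting f (2 * S).
Proof.
move=> fm S1 eS; have S0 : 0 < S by exact: lt_le_trans S1.
have intf := counting_integrand_integrable (2 * S) fm.
have SS : S <= 2 * S by lra.
have ln1 : 1 <= ln (2 * S).
  have : ln (expR 1) <= ln (2 * S) by rewrite ler_ln ?posrE ?expR_gt0 ?mulr_gt0.
  by rewrite expRK.
pose n := pole_count f S; pose n0 := pole_count f 0.
pose c := (n - n0) / (2 * S).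
have n0n : n0 <= n by apply: pole_count_mono => //; exact: ltW.
have : (n - n0) / 2 <= \int[mu]_(t in `]0, (2 * S)]) counting_integrand f t.
  have := Rintegral_itvB intf (x := S); rewrite !bnd_simp => /(_ (ltW S0) SS) split.
  have -> : \int[mu]_(t in `]0, (2 * S)]) counting_integrand f t =
      \int[mu]_(t in `]0, S]) counting_integrand f t +
      \int[mu]_(t in `]S, (2 * S)]) counting_integrand f t.
    by rewrite -split addrC subrK.
  have pos : 0 <= \int[mu]_(t in `]0, S]) counting_integrand f t.
    apply: Rintegral_ge0 => t /=; rewrite in_itv/= => /andP[t0 _].
    exact: counting_integrand_ge0.
  rewrite -[leLHS]add0r lerD//.
  have -> : (n - n0) / 2 = \int[mu]_(t in `]S, (2 * S)]) c.
    rewrite Rintegral_cst//= lebesgue_measure_itv/= lte_fin ifT; last by lra.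
    by rewrite /= /c; field; rewrite gt_eqF.
  apply: le_Rintegral => //=.
  - apply: measurable_bounded_integrable => //.
      by rewrite /= lebesgue_measure_itv/=; case: ifP => // _; rewrite -EFinB ltry.
    by exists `|c|; split; [exact: num_real|move=> M cM t _; exact: ltW].
  - by apply: integrableS intf => //; apply: subset_itvr; rewrite bnd_simp ltW.
  move=> t; rewrite in_itv/= => /andP[St tS].
  rewrite /c /counting_integrand ler_pM ?subr_ge0 ?invr_ge0 ?mulr_ge0 ?(ltW S0)//.
    by rewrite lerD2r pole_count_mono// ltW.
  by rewrite lef_pV2 ?posrE ?mulr_gt0// (lt_trans S0).
rewrite /pole_counting -/n0 -/n => H.
have : n0 <= n0 * ln (2 * S) by rewrite ler_peMr// pole_count_ge0.
have := pole_count_ge0 f 0; move: H; rewrite /counting_integrand -/n0.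
by set I := Rintegral _ _ _; lra.
Qed.

Lemma log_plus_ge0 t : 0 <= log_plus t.
Proof. by rewrite /log_plus le_max lexx. Qed.

Lemma log_plusE t : log_plus t = ln (Num.max 1 t).
Proof.
rewrite /log_plus; have [t1|t1] := leP t 1; last first.
  by rewrite max_r// ln_ge0// ltW.
rewrite ln1 max_l//; have [t0|t0] := leP t 0; first by rewrite ln0.
exact: ln_le0.
Qed.

Lemma proximity_ge0 f r : 0 <= proximity f r.
Proof.
by apply: (@circle_mean_ge0 _ (fun z => log_plus (modulus (f z)))) => t; exact: log_plus_ge0.
Qed.

Lemma le_expR_log_plus t : t <= expR (log_plus t).
Proof.
rewrite log_plusE lnK ?posrE; last by rewrite lt_max ltr01.
by rewrite le_max lexx orbT.
Qed.

Lemma continuous_modulus F z : cdiff F z ->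
  {for z, continuous ((fun w => modulus (F w)) : C^o -> R)}.
Proof.
move=> /complex_differentiable_continuous/complex_continuousP cF.
apply/complex_continuous_modulusP => e /cF[d d0 dP]; exists d => // w /dP.
apply: le_lt_trans; rewrite ler_norml modulus_sub_ge andbT.
by rewrite lerNl opprB [X in _ <= X]modulus_distC modulus_sub_ge.
Qed.

Lemma continuous_log_max F z (d : R) : 0 < d -> cdiff F z ->
  {for z, continuous ((fun w => ln (Num.max d (modulus (F w)))) : C^o -> R)}.
Proof.
move=> d0 dF.
have := @continuous_comp C^o R R (fun w => Num.max d (modulus (F w))) (@ln R) z.
apply; last by apply: continuous_ln; rewrite lt_max d0.
have cd : {for z, continuous (cst d : C^o -> R)} by exact: (@cst_continuous C^o R d z).
exact: (continuous_max cd (continuous_modulus dF)).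
Qed.

Lemma pole_poly_le f S z : meromorphic f -> 0 < S -> modulus z <= S ->
  modulus (pole_poly f S z) <= expR (pole_count f S * ln (2 * S)).
Proof.
move=> fm S0 zS; rewrite pole_count_seq expRM_natl lnK ?posrE ?mulr_gt0//.
rewrite /pole_poly modulus_prod; under eq_bigr do rewrite modulusX.
apply: prod_power_le => b /(mem_pole_seq S b fm)[bS _].
by rewrite modulus_ge0 (le_trans (modulusB _ _))//; lra.
Qed.

(** Dividing out the poles makes [f] holomorphic at the cost of a power of
    [2 * S]; normalised by it, [F] is bounded by [f] on the circle of radius
    [S], and the Poisson inequality bounds [F] inside by the proximity
    function, with the constant [3] at half the radius. *)
Lemma cleared_bound f S F : meromorphic f -> 1 <= S ->
  (forall z, modulus z = S -> ~ has_pole f z) ->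
  (forall z, modulus z <= S -> cdiff F z) ->
  (forall z, modulus z <= S -> ~ has_pole f z -> F z = f z * pole_poly f S z) ->
  forall a, modulus a <= S / 2 ->
  modulus (F a) <= expR (pole_count f S * ln (2 * S) + 3 * proximity f S).
Proof.
move=> fm S1 npole dF FE a aS; have S0 : 0 < S by exact: lt_le_trans S1.
pose M := expR (pole_count f S * ln (2 * S)); have M0 : 0 < M := expR_gt0 _.
pose G z := (M^-1)%:C%C * F z.
have mG z : modulus (G z) = modulus (F z) / M.
  by rewrite modulusM modulus_real ger0_norm ?invr_ge0 ?(ltW M0)// mulrC.
have dG z : modulus z <= S -> cdiff G z.
  move=> zS; apply: complex_differentiableM; first exact: complex_differentiable_cst.
  exact: dF.
have as_ : modulus a < S by rewrite (le_lt_trans aS)// ltr_pdivrMr// ltr_pMr// ltr1n.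
pose phi z := log_plus (modulus (f z)).
have Gphi z : modulus z = S -> modulus (G z) <= expR (phi z).
  move=> zS; rewrite mG FE ?zS//; last exact: npole.
  rewrite modulusM -mulrA -[leRHS]mulr1 ler_pM ?modulus_ge0 ?le_expR_log_plus//.
    by rewrite divr_ge0 ?modulus_ge0 ?(ltW M0).
  by rewrite ler_pdivrMr// mul1r pole_poly_le// zS.
have cphi z : modulus z = S -> {for z, continuous (phi : C^o -> R)}.
  move=> zS; rewrite (_ : phi = fun w => ln (Num.max 1 (modulus (f w)))).
    apply: continuous_log_max => //.
    by have [/holomorphic_at_complex_differentiable//|/(npole z zS)] := fm z.
  by apply: funext => w; rewrite /phi log_plusE.
have := poisson_upper S0 dG cphi Gphi (fun z _ => log_plus_ge0 _) as_.
rewrite -/(proximity f S) mG ler_pdivrMr// -expRD => /le_trans; apply.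
rewrite ler_expR addrC lerD2l ler_wpM2r ?proximity_ge0//.
by rewrite ler_pdivrMr ?subr_gt0//; lra.
Qed.

End CountingFunction.

(** * Estimate of one coefficient by the others *)

Section CoefficientEstimate.
Variable R : realType.
Local Notation C := R[i].
Local Notation modulus := (@ComplexField.Normc.normc R).
Local Notation cdiff := (@complex_differentiable R).
Implicit Types (f F g : C -> C) (a b z w : C) (r s S t x : R).

Lemma itv_avoid_seq x y (D : seq R) : x < y -> exists t, [/\ x < t, t < y & t \notin D].
Proof.
elim: D x y => [|d D IHD] x y xy.
  by exists ((x + y) / 2); split => //; lra.
have [dm|md] := leP d ((x + y) / 2).
- have [|t [t1 t2 tD]] := IHD ((x + y) / 2) y; first by lra.
  exists t; split => //; first by lra.
  by rewrite inE negb_or tD andbT; apply: contraTneq t1 => ->; rewrite -leNgt.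
- have [|t [t1 t2 tD]] := IHD x ((x + y) / 2); first by lra.
  exists t; split => //; first by lra.
  by rewrite inE negb_or tD andbT; apply: contraTneq t2 => ->; rewrite -leNgt ltW.
Qed.

Lemma itv_avoid_finite x y (D : set R) : finite_set D -> x < y ->
  exists t, [/\ x < t, t < y & ~ D t].
Proof.
move=> /finite_seqP[s ->] /(itv_avoid_seq s)[t [t1 t2 ts]]; exists t; split => //.
by move=> /= H; rewrite H in ts.
Qed.

(** Adding up the reciprocals yields a positive number below all thresholds,
    also for an empty family. *)
Lemma common_threshold n (P : 'I_n -> R -> Prop) :
  (forall i, exists2 d, 0 < d & forall e, 0 < e <= d -> P i e) ->
  exists2 d, 0 < d <= 1 & forall i, P i d.
Proof.
move=> HP; have /boolp.choice[d dP] : forall i : 'I_n, exists d : R,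
    0 < d /\ forall e, 0 < e <= d -> P i e.
  by move=> i; have [d d0 H] := HP i; exists d.
have sum0 : 0 <= \sum_i (d i)^-1.
  by apply: sumr_ge0 => i _; rewrite invr_ge0 ltW//; case: (dP i).
exists (1 + \sum_i (d i)^-1)^-1.
  by rewrite invr_gt0 ltr_wpDr// invf_le1 ?ltr_wpDr// lerDl.
move=> i; have [d0 H] := dP i; apply: H; rewrite invr_gt0 ltr_wpDr//=.
rewrite -[leRHS]invrK lef_pV2 ?posrE ?ltr_wpDr ?invr_gt0//.
rewrite (bigD1 i)//= addrCA lerDl addr_ge0// sumr_ge0// => j _.
by rewrite invr_ge0 ltW//; case: (dP j).
Qed.

Section Estimate.
Variables (n : nat) (A : 'I_n.+1 -> C -> C) (sh : 'I_n.+1 -> C) (l : 'I_n.+1).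
Variable f : C -> C.
Hypothesis fm : meromorphic f.
Hypothesis A_entire : forall j, entire (A j).
Hypothesis equation : forall z, (forall j, ~ has_pole f (z + sh j)) ->
  \sum_j A j z * f (z + sh j) = 0.

Lemma meromorphic_no_pole z : ~ has_pole f z -> holomorphic_at f z.
Proof. by have [|] := fm z. Qed.

(** Translating a point where [f] does not vanish by small real amounts keeps
    [f] away from [0], and all but finitely many of them avoid the poles of
    every [f (_ + sh i)]; having no pole in a neighbourhood gives [d]. *)
Lemma base_point : (exists z, ~ has_pole f z /\ f z <> 0) ->
  exists a, exists2 d : R, 0 < d <= 1 & f (a + sh l) != 0 /\
    forall i b, has_pole f b -> d <= modulus (a + sh i - b).
Proof.
move=> [z [/meromorphic_no_pole fz /eqP fz0]].
have [d1 d10 H1] := near_complex_differentiable fz.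
have /complex_continuousP cf := complex_differentiable_continuous
  (holomorphic_at_complex_differentiable fz).
have [|d2 d20 H2] := cf (modulus (f z)); first by rewrite modulus_gt0.
pose D := Num.min d1 d2; have D0 : 0 < D by rewrite lt_min d10.
pose M := modulus z + D + \sum_i modulus (sh i - sh l).
pose bad : set R := \bigcup_(i in [set: 'I_n.+1])
  ((fun b => complex.Re (b - z - (sh i - sh l))) @` [set b | modulus b <= M /\ has_pole f b]).
have bad_fin : finite_set bad.
  apply: bigcup_finite => // i _; apply: finite_image; exact: finite_poles.
have [x [x0 xD xbad]] := itv_avoid_finite bad_fin D0.
have mx : modulus x%:C%C = x by rewrite modulus_real ger0_norm ?ltW.
pose a := z + x%:C%C - sh l.
have al : a + sh l = z + x%:C%C by rewrite /a subrK.
have npole i : ~ has_pole f (a + sh i).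
  move=> fp; apply: xbad; exists i => //; exists (a + sh i).
    split=> //; have -> : a + sh i = z + x%:C%C + (sh i - sh l) by rewrite /a; ring.
    rewrite (le_trans (modulusD _ _))// /M lerD//.
      by rewrite (le_trans (modulusD _ _))// lerD2l mx ltW.
    rewrite (bigD1 i)//= lerDl sumr_ge0// => j _; exact: modulus_ge0.
  have -> : a + sh i - z - (sh i - sh l) = x%:C%C by rewrite /a; ring.
  by [].
have [d d0 dP] : exists2 d : R, 0 < d <= 1 & forall i : 'I_n.+1,
    forall b, has_pole f b -> d <= modulus (a + sh i - b).
  apply: common_threshold => i.
  have [d d0 H] := near_complex_differentiable (meromorphic_no_pole (npole i)).
  exists d => // e /andP[e0 ed] b fb; rewrite leNgt; apply/negP => lt.
  apply: (@complex_differentiable_no_pole _ f b) fb; apply: H.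
  by rewrite modulus_distC (lt_le_trans lt).
exists a, d => //; split=> //; rewrite al.
have : modulus (f (z + x%:C%C) - f z) < modulus (f z).
  by apply: H2; rewrite addrC addKr mx (lt_le_trans xD)// ge_min lexx orbT.
by apply: contraTneq => ->; rewrite sub0r modulusN ltxx.
Qed.

Lemma pole_free_circle r : 0 < r -> exists S, [/\ 4 * r <= S, S <= 5 * r &
  forall z, modulus z = S -> ~ has_pole f z].
Proof.
move=> r0; have fin := finite_image modulus (finite_poles (5 * r) fm).
have [|S [rS Sr HS]] := @itv_avoid_finite (4 * r) (5 * r) _ fin; first by lra.
exists S; split; rewrite ?ltW// => z zS fz; apply: HS; exists z => //=.
by split=> //; rewrite zS ltW.
Qed.

Lemma shifted_pole_free_circle x y M : x < y -> exists s, [/\ x < s, s < y &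
  forall w i, modulus w = s -> modulus (w + sh i) <= M -> ~ has_pole f (w + sh i)].
Proof.
move=> xy; pose bad : set R := \bigcup_(i in [set: 'I_n.+1])
  ((fun b => modulus (b - sh i)) @` [set b | modulus b <= M /\ has_pole f b]).
have bad_fin : finite_set bad.
  apply: bigcup_finite => // i _; apply: finite_image; exact: finite_poles.
have [s [s1 s2 sbad]] := itv_avoid_finite bad_fin xy.
exists s; split=> // w i ws wM fw; apply: sbad; exists i => //.
by exists (w + sh i) => //; rewrite addrK.
Qed.

Section Radii.
Variables (r s S e : R) (a : C) (d : R) (F : C -> C).
Hypotheses (r1 : 1 <= r) (e0 : 0 < e) (e1 : e <= 2^-1).
Hypotheses (rs : r * (1 + e / 2) < s) (sr : s < r * (1 + e)).
Hypotheses (rS : 4 * r <= S) (shr : forall i, modulus (sh i) <= r / 2).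
Hypotheses (ar : modulus a <= r / 2).
Hypothesis S_free : forall z, modulus z = S -> ~ has_pole f z.
Hypothesis s_free : forall w i, modulus w = s -> modulus (w + sh i) <= S ->
  ~ has_pole f (w + sh i).
Hypotheses (d01 : 0 < d <= 1) (fa0 : f (a + sh l) != 0).
Hypothesis a_far : forall i b, has_pole f b -> d <= modulus (a + sh i - b).
Hypothesis dF : forall z, modulus z <= S -> cdiff F z.
Hypothesis FE : forall z, modulus z <= S -> ~ has_pole f z ->
  F z = f z * pole_poly f S z.

Let P := pole_poly f S.
Let N := (\sum_(b <- pole_seq f S) pole_order f b)%N.
Let b1 := pole_count f S * ln (2 * S).
Let B := b1 *+ n.+1 + 3 * proximity f S.
(** The value [f (w + sh j)] multiplied by the product of all [P (w + sh i)]: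
    the common factor clears the poles of all terms of the equation at once. *)
Let G j w := F (w + sh j) * \prod_(i | i != j) P (w + sh i).

Let r0 : 0 < r. Proof. exact: lt_le_trans r1. Qed.
Let S0 : 0 < S.
Proof. by move: rS r0; lra. Qed.
Let s_bounds : r < s /\ s <= 3 / 2 * r.
Proof.
have er0 : 0 < r * e by rewrite mulr_gt0.
have er : r * e <= r * 2^-1 by rewrite ler_wpM2l// ltW.
by move: rs sr; rewrite !mulrDr !mulr1 mulrA; lra.
Qed.

Let sh_disc w i : modulus w <= s -> modulus (w + sh i) <= S / 2.
Proof.
move=> ws; rewrite (le_trans (modulusD _ _))//.
by move: rS ws; have := shr i; have [] := s_bounds; lra.
Qed.

Let half_S : S / 2 <= S. Proof. by have := S0; lra. Qed.

Let b1_ge0 : 0 <= b1.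
Proof. by rewrite mulr_ge0 ?pole_count_ge0// ln_ge0//; move: r1 rS; lra. Qed.

Let B_ge0 : 0 <= B.
Proof.
apply: addr_ge0; first exact: mulrn_wge0 b1_ge0.
exact: mulr_ge0 (ler0n _ 3) (proximity_ge0 f S).
Qed.

Let P_le w i : modulus w <= s -> modulus (P (w + sh i)) <= expR b1.
Proof.
by move=> /(sh_disc i) ws; apply: pole_poly_le fm S0 _; exact: le_trans ws half_S.
Qed.

Let G_le j w : modulus w <= s -> modulus (G j w) <= expR B.
Proof.
move=> ws; rewrite /G modulusM modulus_prod.
have -> : B = (b1 + 3 * proximity f S) + b1 *+ n by rewrite /B mulrS; ring.
rewrite expRD ler_pM ?modulus_ge0 ?prodr_ge0//.
- by move=> i _; exact: modulus_ge0.
- apply: (cleared_bound fm _ S_free dF FE); last exact: sh_disc.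
  by move: r1 rS; lra.
apply: (@le_trans _ _ (\prod_(i < n.+1 | i != j) expR b1)).
  by apply: ler_prod => i _; rewrite modulus_ge0 P_le.
by rewrite prodr_const cardC1 card_ord /= -expRM_natl mulr_natl.
Qed.

Let dG j w : modulus w <= s -> cdiff (G j) w.
Proof.
move=> ws; apply: complex_differentiableM.
  apply: complex_differentiable_shift; apply: dF.
  exact: le_trans (sh_disc j ws) half_S.
apply: complex_differentiable_prod => i _.
apply: (@complex_differentiable_shift _ P w (sh i)).
exact: complex_differentiable_powers.
Qed.

Let cleared_equation w : modulus w = s -> \sum_j A j w * G j w = 0.
Proof.
move=> ws; have free i : ~ has_pole f (w + sh i).
  by apply: s_free => //; apply: le_trans half_S; apply: sh_disc; rewrite ws.
transitivity ((\sum_j A j w * f (w + sh j)) * \prod_i P (w + sh i)); last first.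
  by rewrite equation ?mul0r.
rewrite mulr_suml; apply: eq_bigr => j _; rewrite (bigD1 j)//= /G FE//.
  by rewrite -!mulrA.
by apply: le_trans half_S; apply: sh_disc; rewrite ws.
Qed.

(** Every pole is at distance at least [d] from every [a + sh i], and each of
    the [n.+1] products has [N] factors. *)
Let base_lower : modulus (f (a + sh l)) * d ^+ (N * n.+1) <= modulus (G l a).
Proof.
have [d0 d1] := andP d01.
have as_ : modulus a <= s by move: ar; have [] := s_bounds; have := r0; lra.
have free i : ~ has_pole f (a + sh i).
  move=> /(a_far i); rewrite subrr modulus0; lra.
rewrite /G FE//; last exact: le_trans (sh_disc l as_) half_S.
rewrite -mulrA modulusM ler_wpM2l ?modulus_ge0//.
have -> : P (a + sh l) * \prod_(i | i != l) P (a + sh i) = \prod_i P (a + sh i).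
  by rewrite [RHS](bigD1 l).
rewrite modulus_prod exprM -[X in _ ^+ X]card_ord -prodr_const.
apply: ler_prod => i _; rewrite exprn_ge0 ?(ltW d0)//= /P /pole_poly modulus_prod.
under eq_bigr do rewrite modulusX.
apply: prod_power_ge; first exact: ltW.
by move=> b /(mem_pole_seq S b fm)[_ fb]; exact: a_far.
Qed.

(** Let [phi >= 0] be the deficit of [ln |G l|] below its upper bound [B] on the
    circle of radius [s]. The cleared equation gives
    [ln |A l| <= K1 + phi] there, so the upper Poisson inequality bounds
    [ln |A l z0|] by [K1] plus a multiple of the mean of [phi]. The lower Poisson
    inequality, applied to [G l] at the base point [a], bounds this mean: [G l]
    cannot be small on most of the circle without being small at [a]. *)
Lemma coefficient_bound_at z0 L : modulus z0 = r -> 0 <= L ->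
  (forall j w, j != l -> modulus w = s -> modulus (A j w) <= expR L) ->
  modulus (A l z0) <= expR (L + ln n.+1%:R + 15 / e *
    (B - ln (modulus (f (a + sh l))) - (N * n.+1)%:R * ln d)).
Proof.
move=> z0r L0 AL; have [d0 d1] := andP d01.
have [r_s s_r] := s_bounds; have s0 : 0 < s := lt_trans r0 r_s.
pose K1 := L + ln n.+1%:R.
have K10 : 0 <= K1 by rewrite addr_ge0// ln_ge0// ler1n.
have AG w : modulus w = s -> modulus (A l w) * modulus (G l w) <= expR (K1 + B).
  move=> ws; rewrite -modulusM.
  have -> : A l w * G l w = - \sum_(j | j != l) A j w * G j w.
    apply/eqP; rewrite -addr_eq0; apply/eqP.
    by have := cleared_equation ws; rewrite (bigD1 l).
  rewrite modulusN (le_trans (modulus_sum _ _ _))//.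
  have -> : expR (K1 + B) = n.+1%:R * (expR L * expR B).
    by rewrite /K1 !expRD lnK ?posrE//; ring.
  apply: (@le_trans _ _ (\sum_(j < n.+1 | j != l) expR L * expR B)).
    apply: ler_sum => j jl; rewrite modulusM ler_pM ?modulus_ge0 ?AL//.
    by apply: G_le; rewrite ws.
  rewrite sumr_const -[leLHS]mulr_natl ler_wpM2r ?mulr_ge0 ?expR_ge0//.
  by rewrite ler_nat cardC1 card_ord.
have cA w : modulus w = s ->
    {for w, continuous ((fun z => modulus (A l z)) : C^o -> R)}.
  by move=> _; apply: continuous_modulus; exact: A_entire.
have [M M0 AM] := compact_bounded_modulus (compact_circle s0) cA.
(* Truncating [G l] at [delta] keeps [phi] continuous at the zeros of [G l];
   where the truncation acts, the crude bound [K2] of [A l] is enough. *)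
pose K2 := ln (Num.max 1 M).
have AK2 w : modulus w = s -> modulus (A l w) <= expR K2.
  move=> ws; rewrite lnK ?posrE ?lt_max ?ltr01//.
  by rewrite le_max (le_trans (ler_norm _) (AM w ws)) orbT.
have K20 : 0 <= K2 by rewrite ln_ge0// le_max lexx.
pose delta := expR (- K2); have delta0 : 0 < delta := expR_gt0 _.
pose phi w := B - ln (Num.max delta (modulus (G l w))).
have max0 w : 0 < Num.max delta (modulus (G l w)) by rewrite lt_max delta0.
have phi_ge0 w : modulus w = s -> 0 <= phi w.
  move=> ws; rewrite subr_ge0 -[leRHS]expRK ler_ln ?posrE ?expR_gt0//.
  rewrite ge_max G_le ?ws// andbT ler_expR.
  by rewrite (le_trans _ B_ge0)// oppr_le0.
have cphi w : modulus w = s -> {for w, continuous (phi : C^o -> R)}.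
  move=> ws; have dGw : cdiff (G l) w by apply: dG; rewrite ws.
  have /complex_continuous_modulusP cG := continuous_log_max delta0 dGw.
  apply/complex_continuous_modulusP => x /cG[y y0 yP]; exists y => // v /yP.
  rewrite /phi; set p := ln _; set q := ln _.
  have -> : B - p - (B - q) = - (p - q) by ring.
  by rewrite normrN.
have Gphi w : modulus (G l w) <= expR (B - phi w).
  by rewrite /phi opprB addrCA subrr addr0 lnK ?posrE// le_max lexx orbT.
have Aphi w : modulus w = s -> modulus (A l w) <= expR (K1 + phi w).
  move=> ws; have [small|large] := leP (modulus (G l w)) delta.
    rewrite (le_trans (AK2 w ws))// ler_expR /phi max_l// expRK opprK.
    by have := B_ge0; lra.
  have Gw0 : 0 < modulus (G l w) := lt_trans delta0 large.
  rewrite /phi max_r ?(ltW large)// addrA expRD expRN lnK ?posrE//.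
  by rewrite ler_pdivlMr//; exact: AG.
have scaled (H : C -> C) (K : R) w :
    modulus ((expR (- K))%:C%C * H w) = modulus (H w) / expR K.
  by rewrite modulusM modulus_real ger0_norm ?expR_ge0// expRN mulrC.
have dscaled (H : C -> C) (K : R) w : cdiff H w ->
    cdiff (fun z => (expR (- K))%:C%C * H z) w.
  move=> dH; apply: complex_differentiableM => [|//].
  exact: complex_differentiable_cst.
have mean0 : 0 <= circle_mean phi s.
  by apply: circle_mean_ge0 => t; apply: phi_ge0; rewrite modulus_circle_point// ltW.
have a_s : modulus a <= s / 2 by move: ar; have := r0; lra.
have mean_phi : circle_mean phi s <=
    3 * (B - ln (modulus (f (a + sh l))) - (N * n.+1)%:R * ln d).
  have := @poisson_lower _ (fun z => (expR (- B))%:C%C * G l z) phi s a s0.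
  move=> /(_ _ cphi _ phi_ge0 _) H.
  have {H} : modulus (G l a) / expR B <=
      expR (- ((s - modulus a) / (s + modulus a) * circle_mean phi s)).
    rewrite -scaled; apply: H => [z zs|z zs|].
    - by apply: dscaled; exact: dG.
    - by rewrite scaled ler_pdivrMr ?expR_gt0// -expRD addrC; exact: Gphi.
    - by have := s0; lra.
  have base0 : 0 < modulus (f (a + sh l)) * d ^+ (N * n.+1).
    by rewrite mulr_gt0 ?modulus_gt0 ?exprn_gt0.
  rewrite ler_pdivrMr ?expR_gt0// -expRD => /(le_trans base_lower).
  rewrite -[X in X <= _]lnK ?posrE// ler_expR lnM ?posrE ?modulus_gt0 ?exprn_gt0//.
  rewrite lnXn// -[ln d *+ _]mulr_natl => H.
  have : 3^-1 * circle_mean phi s <=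
      (s - modulus a) / (s + modulus a) * circle_mean phi s.
    rewrite ler_wpM2r// ler_pdivlMr; last by rewrite ltr_wpDr ?modulus_ge0.
    by clear H base0; have := modulus_ge0 a; lra.
  clear base0 a_s; move: H; set y := (s - _) / _ * _ => H.
  by lra.
have := @poisson_upper _ (fun z => (expR (- K1))%:C%C * A l z) phi s z0 s0.
move=> /(_ _ cphi _ phi_ge0 _) H.
have {H} : modulus (A l z0) / expR K1 <=
    expR ((s + modulus z0) / (s - modulus z0) * circle_mean phi s).
  rewrite -scaled; apply: H => [z zs|z zs|].
  - by apply: dscaled; exact: A_entire.
  - by rewrite scaled ler_pdivrMr ?expR_gt0// -expRD addrC; exact: Aphi.
  - by rewrite z0r.
rewrite ler_pdivrMr ?expR_gt0// -expRD z0r => /le_trans; apply.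
rewrite ler_expR addrC lerD2l -/K1.
set E := B - _ - _ in mean_phi *.
have ratio : (s + r) / (s - r) <= 5 / e.
  rewrite ler_pdivrMr ?subr_gt0// mulrAC ler_pdivlMr//.
  have := rs; rewrite mulrDr mulr1 mulrA => rs'.
  have es : e * s <= e * (3 / 2 * r) by rewrite ler_wpM2l// ltW.
  by have := r0; have := e0; lra.
have -> : 15 / e * E = 5 / e * (3 * E) by field; rewrite gt_eqF.
by rewrite ler_pM// divr_ge0// ltW// ?subr_gt0// addr_gt0.
Qed.

End Radii.

(** What remains after [coefficient_bound_at] is the choice of the radii: a
    circle of radius [s] just outside [r] and one of radius [S] near [4 * r],
    both avoiding the finitely many relevant poles. The factor [1 / e] is the
    price of the distance between [r] and [s]. *)
Lemma coefficient_estimate : (exists z, ~ has_pole f z /\ f z <> 0) ->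
  exists K r0 : R, 0 < K /\ forall r e : R, r0 <= r -> 0 < e <= 2^-1 ->
  exists s S, [/\ r < s <= r * (1 + e), 4 * r <= S <= 5 * r,
    (forall z, modulus z = S -> ~ has_pole f z) &
    forall z0 L, modulus z0 = r -> 0 <= L ->
    (forall j w, j != l -> modulus w = s -> modulus (A j w) <= expR L) ->
    modulus (A l z0) <=
      expR (L + K / e * (1 + proximity f S + pole_count f S * ln (2 * S)))].
Proof.
move=> /base_point[a [d d01 [fa0 a_far]]]; have [d0 d1] := andP d01.
pose c0 := `|ln (modulus (f (a + sh l)))|; pose c1 := - ln d.
have c10 : 0 <= c1 by rewrite oppr_ge0 ln_le0.
have c00 : 0 <= c0 := normr_ge0 _.
pose n1 : R := n.+1%:R; have n11 : 1 <= n1 by rewrite ler1n.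
(* The coefficients of [1], [m] and [b1] in the bound of [coefficient_bound_at]
   are [c0], [3] and [n1 * (1 + c1)]. *)
pose K := ln n1 + 15 * (n1 + 3 + c0 + n1 * c1).
have lnn : 0 <= ln n1 := ln_ge0 n11.
have n1c : 0 <= n1 * c1 by rewrite mulr_ge0// (le_trans ler01).
have K0 : 0 < K by rewrite /K; lra.
pose D := \sum_i modulus (sh i).
have shD i : modulus (sh i) <= D.
  rewrite /D (bigD1 i)//= lerDl sumr_ge0// => j _; exact: modulus_ge0.
have D0 : 0 <= D by rewrite (le_trans (modulus_ge0 (sh l))).
pose r0 := expR 1 + 2 * D + 2 * modulus a.
have exp1 : 1 <= expR 1 :> R by rewrite -expR0 ler_expR.
exists K, r0; split=> // r e r0r /andP[e0 e1].
have ma := modulus_ge0 a.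
have r1 : 1 <= r by rewrite /r0 in r0r; lra.
have re0 : 0 < r * e by rewrite mulr_gt0//; lra.
have [S [rS Sr S_free]] := @pole_free_circle r (lt_le_trans ltr01 r1).
have [s [rs sr s_free]] : exists s, [/\ r * (1 + e / 2) < s, s < r * (1 + e) &
  forall w i, modulus w = s -> modulus (w + sh i) <= S -> ~ has_pole f (w + sh i)].
  by apply: shifted_pole_free_circle; rewrite !mulrDr mulrA; lra.
exists s, S; split=> //.
- by rewrite (ltW sr) andbT (le_lt_trans _ rs)// mulrDr mulr1 mulrA lerDl; lra.
- by rewrite rS.
move=> z0 L z0r L0 AL.
have [F [dF FE]] := clear_poles S fm.
have shr i : modulus (sh i) <= r / 2 by have := shD i; rewrite /r0 in r0r; lra.
have ar : modulus a <= r / 2 by rewrite /r0 in r0r; lra.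
apply: le_trans (coefficient_bound_at r1 e0 e1 rs sr rS shr ar S_free s_free d01
  fa0 a_far dF FE z0r L0 AL) _.
rewrite ler_expR -addrA lerD2l.
set N := (\sum_(b <- _) _)%N; set m := proximity f S.
have m0 : 0 <= m := proximity_ge0 _ _.
set b1 := pole_count f S * ln (2 * S).
have lnS : 1 <= ln (2 * S).
  have eS : expR 1 <= 2 * S by rewrite /r0 in r0r; lra.
  have : ln (expR 1) <= ln (2 * S).
    by rewrite ler_ln ?posrE ?expR_gt0// (lt_le_trans (expR_gt0 _) eS).
  by rewrite expRK.
have Nb : N%:R <= b1.
  by rewrite /b1 pole_count_seq -/N ler_peMr.
have N0 : 0 <= N%:R :> R by [].
rewrite natrM -[b1 *+ _]mulr_natl -/n1.
set lf := ln (modulus (f (a + sh l))).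
have lfc : - lf <= c0 by rewrite /c0 -normrN ler_norm.
set X := 1 + m + b1; have X1 : 1 <= X by rewrite /X; lra.
have step1 : n1 * b1 + 3 * m - lf - N%:R * n1 * ln d <= (n1 + 3 + c0 + n1 * c1) * X.
  have -> : (n1 + 3 + c0 + n1 * c1) * X =
    n1 * b1 + 3 * m + c0 + n1 * c1 * b1 + (n1 * (1 + m) + 3 * (1 + b1)
      + c0 * (m + b1) + n1 * c1 * (1 + m)) by rewrite /X; ring.
  have : N%:R * n1 * - ln d <= n1 * c1 * b1.
    have -> : N%:R * n1 * - ln d = n1 * c1 * N%:R by rewrite /c1; ring.
    by rewrite ler_wpM2l.
  have b10 : 0 <= b1 := le_trans N0 Nb.
  have n10 : 0 <= n1 := le_trans ler01 n11.
  have p1 : 0 <= n1 * (1 + m) by rewrite mulr_ge0// addr_ge0.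
  have p2 : 0 <= c0 * (m + b1) by rewrite mulr_ge0// addr_ge0.
  have p3 : 0 <= n1 * c1 * (1 + m) by rewrite mulr_ge0// addr_ge0.
  by lra.
have e1' : 1 <= e^-1 by rewrite -[leLHS]invr1 lef_pV2 ?posrE//; lra.
have step2 : ln n1 <= ln n1 / e * X.
  rewrite -mulrA ler_peMr// -[leLHS]mulr1 ler_pM//.
have -> : K / e * X = ln n1 / e * X + 15 / e * ((n1 + 3 + c0 + n1 * c1) * X).
  by rewrite /K; field; rewrite gt_eqF.
by rewrite lerD// ler_wpM2l// divr_ge0// ltW.
Qed.

End Estimate.

End CoefficientEstimate.

(** * Iterated exponentials and logarithms *)

Section IteratedExponentials.
Variable R : realType.
Implicit Types (x y r s t c K : R) (u : R -> R).

Lemma limsup_infty_lt u (x : \bar R) : (limsup_infty u < x)%E ->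
  exists r0, forall r, r0 < r -> ((u r)%:E < x)%E.
Proof.
rewrite /limsup_infty limf_esupE => /ereal_inf_lt[_ [V [M [_ MV]] <-] supV].
exists M => r /MV Vr; apply: le_lt_trans supV.
by apply: ereal_sup_ubound; exists r.
Qed.

Lemma limsup_infty_gt u (x : \bar R) : (x < limsup_infty u)%E ->
  forall r0, exists2 r, r0 < r & (x < (u r)%:E)%E.
Proof.
move=> xu r0; have : (x < ereal_sup ((fun r => (u r)%:E) @` [set r : R | (r0 < r)%R]))%E.
  apply: (lt_le_trans xu); rewrite /limsup_infty limf_esupE.
  apply: ereal_inf_lbound; exists [set r : R | r0 < r] => //.
  by exists r0; split=> //; exact: num_real.
by move=> /ereal_sup_gt[_ [r /= r0r <-] xr]; exists r.
Qed.

Definition iterated_exp (n : nat) x : R := iter n (@expR R) x.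

Lemma iterated_exp_mono n x y : x <= y -> iterated_exp n x <= iterated_exp n y.
Proof. by move=> xy; elim: n => //= n IHn; rewrite ler_expR. Qed.

Lemma expR_ge_id x : x <= expR x.
Proof. by apply: le_trans (expR_ge1Dx x); rewrite lerDr. Qed.

Lemma iterated_exp_ge_id n x : x <= iterated_exp n x.
Proof. by elim: n => //= n IHn; apply: (le_trans IHn); exact: expR_ge_id. Qed.

Lemma iterated_expSr n x : iterated_exp n.+1 x = iterated_exp n (expR x).
Proof. by rewrite /iterated_exp iterSr. Qed.

Lemma iterated_logSr n x : iterated_log n.+1 x = iterated_log n (ln x).
Proof. by rewrite /iterated_log iterSr. Qed.

Lemma iterated_logS n x : iterated_log n.+1 x = ln (iterated_log n x).
Proof. by []. Qed.

Lemma ln_le_expR x y : ln x <= y -> x <= expR y.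
Proof.
have [x0|x0] := leP x 0; first by move=> _; rewrite (le_trans x0)// expR_ge0.
by rewrite -ler_expR lnK.
Qed.

Lemma iterated_log_le n x y : iterated_log n x <= y -> x <= iterated_exp n y.
Proof.
elim: n y => // n IHn y; rewrite iterated_logS => /ln_le_expR/IHn.
by rewrite -iterated_expSr.
Qed.

Lemma iterated_log_gt n x y : 0 <= y -> y < iterated_log n x -> iterated_exp n y < x.
Proof.
elim: n y => // n IHn y y0; rewrite iterated_logS.
have [x0|x0] := leP (iterated_log n x) 0; first by rewrite ln0// ltNge y0.
move=> yx; rewrite iterated_expSr; apply: IHn; first exact: expR_ge0.
by rewrite -[ltRHS]lnK ?posrE// ltr_expR.
Qed.

Lemma iterated_log_ge n x y : iterated_exp n y <= x -> y <= iterated_log n x.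
Proof.
elim: n y => // n IHn y; rewrite iterated_logS iterated_expSr => /IHn H.
rewrite -[leLHS]expRK ler_ln ?posrE ?expR_gt0//.
exact: lt_le_trans (expR_gt0 _) H.
Qed.

Lemma iterated_logK n x : iterated_exp n 0 <= x -> iterated_exp n (iterated_log n x) = x.
Proof.
elim: n => // n IHn; rewrite !iterated_expSr expR0 iterated_logS => nx.
have n1 := iterated_log_ge nx.
rewrite lnK ?posrE ?(lt_le_trans _ n1)//.
by rewrite IHn// (le_trans _ nx)// iterated_exp_mono.
Qed.

Lemma iterated_log_mono n x y : iterated_exp n 0 <= x -> x <= y ->
  iterated_log n x <= iterated_log n y.
Proof.
by move=> nx xy; apply: iterated_log_ge; rewrite iterated_logK.
Qed.

(** For the logarithm this is [ln (c * y) <= c * ln y], valid as soon as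
    [1 <= ln y]; it iterates. *)
Lemma iterated_log_scale n x c : 1 <= c -> iterated_exp n 1 <= x ->
  iterated_log n (c * x) <= c * iterated_log n x.
Proof.
move=> c1; elim: n => // n IHn nx; have c0 : 0 < c by exact: lt_le_trans c1.
have nx' : iterated_exp n 1 <= x.
  by apply: le_trans nx; rewrite iterated_expSr iterated_exp_mono// expR_ge_id.
have x0 : 0 <= x.
  by apply: le_trans nx'; rewrite (le_trans _ (iterated_exp_ge_id n 1)).
have l1 := iterated_log_ge nx; have l0 := iterated_log_ge nx'.
rewrite !iterated_logS in l1 *.
have cx : iterated_exp n 1 <= c * x by rewrite (le_trans nx')// ler_peMl.
have c0' := iterated_log_ge cx.
have p0 : 0 < iterated_log n x := lt_le_trans ltr01 l0.
apply: (@le_trans _ _ (ln (c * iterated_log n x))).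
  by rewrite ler_ln ?posrE ?IHn// ?(lt_le_trans ltr01 c0') ?mulr_gt0.
rewrite lnM ?posrE//.
have lnc : ln c <= c - 1.
  have : ln (1 + (c - 1)) <= c - 1 by apply: le_ln1Dx; rewrite ltrBrDr addNr.
  by rewrite addrC subrK.
have : (c - 1) * 1 <= (c - 1) * ln (iterated_log n x) by rewrite ler_wpM2l ?subr_ge0.
by lra.
Qed.

(** One exponentiation turns the sum into a product of two numbers that are at
    least [2], which is not below their sum. *)
Lemma iterated_expD n x y : 1 <= x -> 1 <= y ->
  iterated_exp n x + iterated_exp n y <= iterated_exp n (x + y).
Proof.
move=> x1 y1; elim: n => //= n IHn.
rewrite -/(iterated_exp n x) -/(iterated_exp n y) -/(iterated_exp n (x + y)).
have X1 := le_trans x1 (iterated_exp_ge_id n x).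
have Y1 := le_trans y1 (iterated_exp_ge_id n y).
apply: le_trans (_ : expR (iterated_exp n x + iterated_exp n y) <= _); last first.
  by rewrite ler_expR.
have e2 t : 1 <= t -> 2 <= expR t.
  by move=> t1; apply: le_trans (expR_ge1Dx t); rewrite -[leLHS]/(1 + 1) lerD2l.
have {}X1 := e2 _ X1; have {}Y1 := e2 _ Y1; rewrite expRD.
move: (expR _) (expR _) X1 Y1 => a b a2 b2.
have : 0 <= (a - 2) * (b - 2) by rewrite mulr_ge0// subr_ge0.
by lra.
Qed.

(** The product becomes a sum of exponents, and a sum of two numbers that are
    at least [2] is below their product. *)
Lemma iterated_expM n x y : 2 <= x -> 2 <= y ->
  iterated_exp n x * iterated_exp n y <= iterated_exp n (x * y).
Proof.
move=> x2 y2; elim: n => //= n IHn.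
rewrite -/(iterated_exp n x) -/(iterated_exp n y) -/(iterated_exp n (x * y)).
rewrite -expRD ler_expR; apply: le_trans IHn.
have := le_trans x2 (iterated_exp_ge_id n x).
have := le_trans y2 (iterated_exp_ge_id n y).
move: (iterated_exp n x) (iterated_exp n y) => a b b2 a2.
have : 0 <= (a - 2) * (b - 2) by rewrite mulr_ge0// subr_ge0.
by lra.
Qed.

(** The logarithm of the radius is an [m]-fold exponential of the scale in which
    the growth is measured, and stays below an [n]-fold one only if [m <= n];
    for the theorem this is the hypothesis [q <= p]. *)
Lemma ln_le_iterated m n r : (m <= n)%N -> iterated_exp m.+1 0 <= r ->
  ln r <= iterated_exp n (iterated_log m.+1 r).
Proof.
move=> mn mr; rewrite iterated_logSr.
have r0 : 0 < r.
  by apply: lt_le_trans mr; rewrite /iterated_exp /= expR_gt0.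
have mln : iterated_exp m 0 <= ln r.
  by rewrite -[leLHS]expRK ler_ln ?posrE ?expR_gt0.
rewrite -{1}(iterated_logK mln) -(subnKC mn) addnC /iterated_exp iterD.
exact: iterated_exp_ge_id.
Qed.

Lemma powR_unbounded (d K : R) : 0 < d -> exists2 t0, 1 <= t0 & forall t, t0 <= t -> K <= t `^ d.
Proof.
move=> d0; exists (expR (`|ln (Num.max 1 K)| / d)).
  by rewrite -expR0 ler_expR divr_ge0// ltW.
move=> t; set m := Num.max 1 K; have m0 : 0 < m by rewrite lt_max ltr01.
move=> tm; have t0 : 0 < t := lt_le_trans (expR_gt0 _) tm.
rewrite (@le_trans _ _ m)// ?le_max ?lexx ?orbT// /powR gt_eqF//.
rewrite -[leLHS]lnK ?posrE// ler_expR mulrC -ler_pdivrMr//.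
rewrite -[leLHS]expRK ler_ln ?posrE ?expR_gt0//; apply: le_trans tm.
by rewrite ler_expR ler_wpM2r ?invr_ge0 ?(ltW d0)// ler_norm.
Qed.

Lemma ln_le_powR (d t : R) : 0 < d -> 0 < t -> d * ln t <= t `^ d.
Proof. by move=> d0 t0; rewrite /powR gt_eqF// expR_ge_id. Qed.

(** Write [L] for [iterated_log m r]. Inside the iterated exponential the factor
    [ln (10 * r)], which counting poles costs, and the constants become a
    constant times [ln L]; both fit into [L `^ (rho - sig)], half of the exponent
    each. *)
Lemma growth_comparison (m n : nat) (K sig rho eta : R) : (m <= n)%N ->
  0 < sig -> sig < rho -> 0 < eta ->
  exists2 r0, iterated_exp m.+1 1 <= r0 & forall r, r0 <= r ->
  K * ln (10 * r) * iterated_exp n ((10 * iterated_log m r) `^ sig) <=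
    iterated_exp n (eta * iterated_log m r `^ rho).
Proof.
move=> mn sig0 sigrho eta0.
pose d := (rho - sig) / 2; have d0 : 0 < d by rewrite divr_gt0// subr_gt0.
pose K1 := Num.max (2 * K) 2.
have K12 : 2 <= K1 by rewrite le_max lexx orbT.
have [t1 t11 H1] := @powR_unbounded sig 2 sig0.
have [t2 t21 H2] := @powR_unbounded d (K1 * 10 `^ sig / d / eta) d0.
pose M := Num.max (expR 2) (Num.max t1 t2).
pose r0 := Num.max (iterated_exp m M) (Num.max (iterated_exp m.+1 1) 10).
exists r0; first by rewrite !le_max lexx orbT.
move=> r; rewrite !ge_max => /and3P[rM r1 r10].
set L := iterated_log m r.
have := iterated_log_ge rM; rewrite -/L !ge_max => /and3P[L2 Lt1 Lt2].
have L0 : 0 < L := lt_le_trans (expR_gt0 _) L2.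
have L1 : 1 <= L := le_trans t11 Lt1.
have lnL2 : 2 <= ln L by rewrite -[leLHS]expRK ler_ln ?posrE ?expR_gt0.
have r_gt0 : 0 < r by apply: lt_le_trans r10.
have lnr : ln r <= iterated_exp n (ln L).
  apply: (ln_le_iterated mn); apply: le_trans r1.
  by apply: iterated_exp_mono.
have ln10r : ln (10 * r) <= 2 * ln r.
  rewrite lnM ?posrE// mulr2n mulrDl mul1r lerD2r ler_ln ?posrE//.
have lnr0 : 0 <= ln r by rewrite ln_ge0// (le_trans _ r10)// ler1n.
have ln10r0 : 0 <= ln (10 * r).
  by rewrite ln_ge0// (le_trans _ (_ : 10 <= _))// ?ler1n// ler_peMr// (le_trans _ r10)// ler1n.
have Ls2 : 2 <= (10 * L) `^ sig.
  by apply: H1; rewrite (le_trans Lt1)// ler_peMl ?(ltW L0)// ler1n.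
set Y := iterated_exp n ((10 * L) `^ sig).
have Y0 : 0 <= Y by apply: le_trans (iterated_exp_ge_id n _); rewrite powR_ge0.
apply: (@le_trans _ _ (iterated_exp n K1 * iterated_exp n (ln L) * Y)).
  rewrite ler_wpM2r//.
  have [K0|K0] := leP 0 K; last first.
    apply: (@le_trans _ _ 0); first by rewrite mulr_le0_ge0// ltW.
    have := le_trans K12 (iterated_exp_ge_id n K1).
    have := le_trans lnL2 (iterated_exp_ge_id n (ln L)).
    move: (iterated_exp n K1) (iterated_exp n (ln L)) => a b b2 a2.
    by rewrite mulr_ge0//; lra.
  apply: (@le_trans _ _ (2 * K * ln r)).
    by rewrite (mulrC 2) -mulrA ler_wpM2l.
  rewrite ler_pM// ?mulr_ge0//.
  by rewrite (le_trans _ (iterated_exp_ge_id n K1))// le_max lexx.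
apply: (@le_trans _ _ (iterated_exp n (K1 * ln L * (10 * L) `^ sig))).
  apply: le_trans (_ : iterated_exp n (K1 * ln L) * Y <= _).
    by rewrite ler_wpM2r// iterated_expM.
  apply: iterated_expM => //.
  by have := ler_pM _ _ K12 lnL2; lra.
apply: iterated_exp_mono.
have LdK := H2 L Lt2.
have -> : (10 * L) `^ sig = 10 `^ sig * L `^ sig by rewrite powRM ?(ltW L0).
have lnLd : ln L <= L `^ d / d.
  by rewrite ler_pdivlMr// mulrC ln_le_powR.
have -> : L `^ rho = L `^ d * (L `^ d * L `^ sig).
  have Ln0 : L != 0 by rewrite gt_eqF.
  by rewrite -!powRD ?Ln0 ?implybT//; congr (_ `^ _); rewrite /d; field.
have K1s : 0 <= K1 * 10 `^ sig * L `^ sig.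
  by rewrite !mulr_ge0 ?powR_ge0// (le_trans _ K12).
apply: (@le_trans _ _ (K1 * 10 `^ sig * L `^ sig * (L `^ d / d))).
  have -> : K1 * ln L * (10 `^ sig * L `^ sig) = K1 * 10 `^ sig * L `^ sig * ln L by ring.
  by rewrite ler_wpM2l.
have -> : K1 * 10 `^ sig * L `^ sig * (L `^ d / d) =
    K1 * 10 `^ sig / d / eta * (eta * (L `^ d * L `^ sig)).
  by field; rewrite !gt_eqF.
have -> : eta * (L `^ d * (L `^ d * L `^ sig)) = L `^ d * (eta * (L `^ d * L `^ sig)) by ring.
by rewrite ler_wpM2r// !mulr_ge0 ?powR_ge0 ?(ltW eta0).
Qed.

End IteratedExponentials.

(** * Growth of the characteristic and of the coefficients *)

Section CharacteristicGrowth.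
Variable R : realType.
Local Notation C := R[i].
Local Notation modulus := (@ComplexField.Normc.normc R).
Local Notation cdiff := (@complex_differentiable R).
Implicit Types (f g : C -> C) (a b z w : C) (r s S t x K : R).

Lemma complex_differentiable_horner (p : {poly C}) z : cdiff (fun w => p.[w]) z.
Proof.
have -> : (fun w => p.[w]) = fun w => \sum_(i < size p) p`_i * \prod_(j < i) w.
  apply: funext => w; rewrite horner_coef; apply: eq_bigr => i _.
  by rewrite prodr_const card_ord.
apply: complex_differentiable_sum => i _.
apply: complex_differentiableM; first exact: complex_differentiable_cst.
by apply: complex_differentiable_prod => j _; exact: complex_differentiable_id.
Qed.

(** Far away each linear factor has modulus at least [1]. *)
Lemma horner_lower_bound (p : {poly C}) : p != 0 -> exists2 r : R, 1 <= r &
  forall z, r <= modulus z -> modulus (lead_coef p) <= modulus p.[z].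
Proof.
move=> p0; have [rs pE] := closed_field_poly_normal p.
exists (1 + \sum_(q <- rs) modulus q).
  by rewrite lerDl sumr_ge0// => q _; exact: modulus_ge0.
move=> z zr; rewrite {2}pE hornerZ modulusM ler_peMr ?modulus_ge0//.
rewrite horner_prod modulus_prod.
have : forall q, q \in rs -> 1 <= modulus (z - q).
  move=> q qrs; apply: le_trans (modulus_sub_ge _ _); rewrite lerBrDr.
  apply: le_trans zr; rewrite lerD2l (big_rem q)//= lerDl sumr_ge0// => q' _.
  exact: modulus_ge0.
elim: rs {pE zr} => [|q rs IHrs] H; first by rewrite big_nil.
rewrite big_cons -[leLHS]mulr1 ler_pM//; last first.
  by apply: IHrs => q' q'rs; apply: H; rewrite inE q'rs orbT.
by rewrite hornerXsubC H// inE eqxx.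
Qed.

Lemma horner_upper_bound (p : {poly C}) : exists2 M : R, 0 < M &
  forall z, 1 <= modulus z -> modulus p.[z] <= M * modulus z ^+ size p.
Proof.
exists (1 + \sum_(i < size p) modulus p`_i).
  by rewrite ltr_wpDr// sumr_ge0// => i _; exact: modulus_ge0.
move=> z z1; rewrite horner_coef (le_trans (modulus_sum _ _ _))// mulrDl mul1r.
apply: ler_wpDl; first by rewrite exprn_ge0 ?modulus_ge0.
rewrite mulr_suml; apply: ler_sum => i _; rewrite modulusM modulusX.
by rewrite ler_wpM2l ?modulus_ge0// ler_weXn2l// ltnW.
Qed.

(** Rational functions have order [0] by convention, so their growth has to be
    known directly. *)
Lemma rational_function_growth f : rational_function f -> exists K r0, [/\ 0 < K, 1 <= r0,
  forall z, r0 <= modulus z -> modulus (f z) <= expR (K * ln (2 * modulus z)) &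
  forall z, r0 <= modulus z -> cdiff f z].
Proof.
move=> [P [Q [Q0 fE]]].
have [r r1 Qlow] := horner_lower_bound Q0; have [M M0 Pup] := horner_upper_bound P.
have lQ : 0 < modulus (lead_coef Q) by rewrite modulus_gt0 lead_coef_eq0.
have Qn0 z : r <= modulus z -> Q.[z] != 0.
  by move=> /Qlow zr; rewrite -modulus_gt0 (lt_le_trans lQ).
pose K := 1 + `|ln (M / modulus (lead_coef Q))| / ln 2 + (size P)%:R.
have ln20 : 0 < ln 2 :> R by rewrite ln_gt0// ltr1n.
exists K, r; split=> //.
- by rewrite /K -addrA ltr_wpDr// addr_ge0// divr_ge0// ltW.
- move=> z zr; have z1 := le_trans r1 zr; rewrite fE ?Qn0// modulusM modulusV.
  have z0 : 0 < modulus z := lt_le_trans ltr01 z1.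
  set lc := modulus (lead_coef Q) in lQ K *.
  apply: (@le_trans _ _ (M / lc * modulus z ^+ size P)).
    rewrite mulrAC ler_pM ?modulus_ge0 ?invr_ge0 ?modulus_ge0 ?Pup//.
    by rewrite lef_pV2 ?posrE ?Qlow// modulus_gt0 Qn0.
  rewrite -[leLHS]lnK; last by rewrite posrE mulr_gt0 ?divr_gt0 ?exprn_gt0.
  rewrite ler_expR lnM ?posrE ?divr_gt0 ?exprn_gt0// lnXn// -[ln _ *+ _]mulr_natl.
  have lnz : 0 <= ln (modulus z) by rewrite ln_ge0.
  have lnz2 : ln (2 * modulus z) = ln 2 + ln (modulus z) by rewrite lnM ?posrE.
  rewrite /K mulrDl lerD//.
    rewrite mulrDl mul1r; apply: ler_wpDl; first by rewrite lnz2 addr_ge0// ltW.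
    rewrite (le_trans (ler_norm _))// -[leLHS]mulr1 -mulrA ler_wpM2l//.
    by rewrite mulrC ler_pdivlMr// mul1r lnz2 lerDl.
  by rewrite ler_wpM2l// lnz2 lerDr ltW.
- move=> z zr; have cQ := @complex_differentiable_horner Q z.
  apply: (@complex_differentiable_near _ (fun w => P.[w] / Q.[w])); last first.
    apply: complex_differentiableM; first exact: complex_differentiable_horner.
    by apply: complex_differentiableV; [exact: Qn0|].
  have /complex_continuousP/(_ (modulus Q.[z])) := complex_differentiable_continuous cQ.
  rewrite modulus_gt0 Qn0// => /(_ isT)[d d0 dP]; apply/near_modulusP; exists d => // w wd.
  rewrite fE//; apply: contraTneq (dP w wd) => Qw.
  by rewrite Qw sub0r modulusN ltxx.
Qed.

Lemma max_modulus_ge g z : entire g -> 0 < modulus z ->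
  modulus (g z) <= max_modulus g (modulus z).
Proof.
move=> eg z0; apply: ub_le_sup; last by exists z.
have [|M _ HM] := @compact_bounded_modulus R _ (fun w => modulus (g w)) (compact_circle z0).
  by move=> w _; apply: continuous_modulus; exact: eg.
by exists M => _ [w wz <-]; apply: le_trans (ler_norm _) (HM w wz).
Qed.

Lemma max_modulus_gt g r t : 0 <= r -> t < max_modulus g r ->
  exists2 z, modulus z = r & t < modulus (g z).
Proof.
move=> r0 /sup_gt[|_ [z zr <-] tz]; last by exists z.
by exists (modulus (g (circle_point r 0))), (circle_point r 0) => //=;
  exact: (modulus_circle_point 0 r0).
Qed.

Lemma log_plus_le t x : 0 <= x -> t <= expR x -> log_plus t <= x.
Proof.
move=> x0 tx; rewrite log_plusE -[leRHS]expRK ler_ln ?posrE ?expR_gt0 ?lt_max ?ltr01//.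
by rewrite ge_max tx andbT -expR0 ler_expR.
Qed.

Lemma proximity_le f S x : 0 <= S -> (forall z, modulus z = S -> cdiff f z) ->
  0 <= x -> (forall z, modulus z = S -> modulus (f z) <= expR x) -> proximity f S <= x.
Proof.
move=> S0 df x0 fx.
apply: (@circle_mean_le _ (fun z => log_plus (modulus (f z)))) => [th _|th].
  apply: (@continuous_circle_point _ S th (fun z => log_plus (modulus (f z)))).
  rewrite (_ : (fun z => _) = fun z => ln (Num.max 1 (modulus (f z)))).
    by apply: continuous_log_max => //; apply: df; exact: modulus_circle_point.
  by apply: funext => z; rewrite log_plusE.
by apply: log_plus_le => //; apply: fx; exact: modulus_circle_point.
Qed.

Lemma order_bound (n : nat) (u : R -> R) (m : nat) (sig : R) :
  (limsup_infty (fun r => (iterated_log n (u r) / iterated_log m.+1 r)%R) < sig%:E)%E ->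
  exists2 r0, iterated_exp m.+1 1 <= r0 &
    forall r, r0 <= r -> u r <= iterated_exp n (sig * ln (iterated_log m r)).
Proof.
move=> /limsup_infty_lt[r0 H]; exists (Num.max (r0 + 1) (iterated_exp m.+1 1)).
  by rewrite le_max lexx orbT.
move=> r; rewrite ge_max => /andP[r0r r1]; apply: iterated_log_le.
have := H r (lt_le_trans _ r0r); rewrite ltrDl ltr01 lte_fin => /(_ isT).
rewrite ltr_pdivrMr; first by move=> /ltW.
by apply: lt_le_trans (iterated_log_ge r1).
Qed.

Lemma powR_expR (x y : R) : 0 < y -> expR (x * ln y) = y `^ x.
Proof. by move=> y0; rewrite /powR gt_eqF. Qed.

Lemma pole_count_no_pole f S : meromorphic f -> (forall z, ~ has_pole f z) ->
  pole_count f S = 0.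
Proof.
move=> fm fp; rewrite pole_count_seq big1_seq// => b /andP[_] /(mem_pole_seq S b fm)[_].
by move=> /fp.
Qed.

Lemma pole_count_bounded f r0 S : meromorphic f ->
  (forall z, r0 <= modulus z -> cdiff f z) -> pole_count f S <= pole_count f r0.
Proof.
move=> fm df; have [Sr|/ltW rS] := leP S r0; first exact: pole_count_mono.
rewrite (pole_count_restrict fm rS) (pole_count_restrict fm (lexx S)).
rewrite [leLHS]big_seq_cond [leRHS]big_seq_cond le_eqVlt; apply/orP; left; apply/eqP.
apply: eq_bigl => b; apply: andb_id2l => /(mem_pole_seq S b fm)[-> fb].
have [|/ltW /df] := leP (modulus b) r0; first by [].
by move=> /complex_differentiable_no_pole.
Qed.

Lemma ereal_between (x : \bar R) rho : 0 < rho -> (x < rho%:E)%E ->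
  exists sig, [/\ 0 < sig, sig < rho & (x < sig%:E)%E].
Proof.
move=> rho0; case: x => [x| |]; last 2 first.
- by rewrite ltNge leey.
- by exists (rho / 2); split; rewrite ?ltNyr//; lra.
rewrite lte_fin => xrho; exists ((Num.max x 0 + rho) / 2).
by have [x0|x0] := leP x 0; split; rewrite ?lte_fin; lra.
Qed.

Lemma large_radius (q : nat) : exists2 t, 1 <= t & forall r, t <= r ->
  [/\ 1 <= r, expR 1 <= r, iterated_exp q 0 <= r, iterated_exp q 1 <= r &
    1 <= iterated_log q r].
Proof.
exists (Num.max (expR 1) (iterated_exp q 1)).
  by rewrite le_max -[leLHS]expR0 ler_expR ler01.
move=> r; rewrite ge_max => /andP[r1 rq]; split=> //.
- by apply: le_trans r1; rewrite -expR0 ler_expR.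
- by apply: le_trans rq; exact: iterated_exp_mono.
- exact: iterated_log_ge.
Qed.

(** The order is given by one of three formulas: [0] for a rational [f], the
    maximum modulus for an entire one, the characteristic otherwise. Each of them
    bounds the proximity function and the number of poles, which are what
    [coefficient_estimate] involves. *)
Lemma characteristic_growth (p q : nat) (rho : R) f : 0 < rho -> meromorphic f ->
  (pq_order p.+1 q.+1 f < rho%:E)%E ->
  exists sig K r0, [/\ 0 < sig, sig < rho, 0 <= K & forall S, r0 <= S ->
    (forall z, modulus z = S -> ~ has_pole f z) ->
    1 + proximity f S + pole_count f S * ln (2 * S) <=
      K * ln (2 * S) * iterated_exp p (iterated_log q (2 * S) `^ sig)].
Proof.
move=> rho0 fm frho.
have cdiff_free S : (forall z, modulus z = S -> ~ has_pole f z) ->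
    forall z, modulus z = S -> cdiff f z.
  move=> Sfree z /Sfree fz.
  by have [/holomorphic_at_complex_differentiable|] := fm z.
have [t t1 tP] := large_radius q.
have double S : t <= S -> t <= 2 * S.
  by move=> tS; apply: (le_trans tS); have := le_trans t1 tS; lra.
have ln1 S : t <= S -> 1 <= ln (2 * S).
  move=> /double/tP[_ eS _ _ _].
  by rewrite -[leLHS]expRK ler_ln ?posrE ?expR_gt0// (lt_le_trans (expR_gt0 _) eS).
have Epos r sig : 0 < sig -> t <= r -> 1 <= iterated_exp p (iterated_log q r `^ sig).
  move=> sig0 /tP[_ _ _ _ L1]; apply: le_trans (iterated_exp_ge_id p _).
  by rewrite -[leLHS](powRr0 (iterated_log q r)) ler_powR// ltW.
have Emono S sig : 0 < sig -> t <= S -> iterated_exp p (iterated_log q S `^ sig) <=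
    iterated_exp p (iterated_log q (2 * S) `^ sig).
  move=> sig0 tS; have [S1 _ S0q _ L1] := tP S tS.
  apply: iterated_exp_mono; apply: ge0_ler_powR; rewrite ?nnegrE.
  - exact: ltW.
  - exact: le_trans L1.
  - by apply: le_trans ler01 _; have [] := tP _ (double S tS).
  - by apply: iterated_log_mono => //; lra.
move: frho; rewrite /pq_order; case: asboolP => [frat _|_].
  have [K [r1 [K0 r11 fle fcd]]] := rational_function_growth frat.
  pose n1 := pole_count f r1; have n10 : 0 <= n1 := pole_count_ge0 _ _.
  exists (rho / 2), (1 + K + n1), (Num.max t r1); split; [lra|lra|lra|].
  move=> S; rewrite ge_max => /andP[tS rS] Sfree.
  have [S1 _ _ _ _] := tP S tS; have L1 := ln1 S tS.
  have prox : proximity f S <= K * ln (2 * S).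
    apply: proximity_le; [lra|exact: cdiff_free| |].
      by rewrite mulr_ge0// ?ltW//; lra.
    by move=> z zS; rewrite -zS fle// zS.
  have cnt : pole_count f S * ln (2 * S) <= n1 * ln (2 * S).
    by rewrite ler_wpM2r ?pole_count_bounded//; lra.
  rewrite (@le_trans _ _ ((1 + K + n1) * ln (2 * S)))//; first by lra.
  rewrite ler_peMr ?mulr_ge0//; [lra|lra|apply: Epos; [lra|exact: double]].
case: asboolP => [fent|_] /(ereal_between rho0)[sig [sig0 sigrho]].
  move=> /order_bound[r1 r11 H].
  have fpole z : ~ has_pole f z := complex_differentiable_no_pole (fent z).
  exists sig, 2, (Num.max t r1); split=> // S; rewrite ge_max => /andP[tS rS] _.
  have [S1 _ _ _ L1] := tP S tS; have S0 : 0 < S by lra.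
  have ES := Epos S sig sig0 tS; have E2S := Emono S sig sig0 tS.
  have prox : proximity f S <= iterated_exp p (iterated_log q S `^ sig).
    apply: proximity_le => [|z _||z zS]; [lra|exact: fent|lra|].
    have := max_modulus_ge fent (_ : 0 < modulus z); rewrite zS => /(_ S0) /le_trans; apply.
    have := H S rS; rewrite iterated_expSr powR_expR// ?(lt_le_trans _ L1)//.
  rewrite pole_count_no_pole// mul0r addr0.
  set Y := iterated_exp p (iterated_log q (2 * S) `^ sig) in E2S *.
  have : 2 * Y <= 2 * ln (2 * S) * Y.
    by rewrite ler_wpM2r ?ler_peMr ?ln1//; lra.
  by lra.
move=> /order_bound[r1 r11 H].
exists sig, 4, (Num.max t r1); split=> // S; rewrite ge_max => /andP[tS rS] Sfree.
have [S1 _ _ _ L1] := tP S tS; have S0 : 0 < S by lra.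
have [S1' eS _ _ L1'] := tP _ (double S tS).
have ES := Epos S sig sig0 tS; have E2S := Emono S sig sig0 tS.
have T1 : nevanlinna_T f S <= iterated_exp p (iterated_log q S `^ sig).
  have := H S rS; rewrite iterated_expSr powR_expR// ?(lt_le_trans _ L1)//.
have T2 : nevanlinna_T f (2 * S) <= iterated_exp p (iterated_log q (2 * S) `^ sig).
  have := H (2 * S); rewrite iterated_expSr powR_expR// ?(lt_le_trans _ L1')//.
  by apply; lra.
have cnt := pole_count_le_counting fm S1 eS.
have N1 := pole_counting_ge0 fm S1; have m2 := proximity_ge0 f (2 * S).
set Y := iterated_exp p (iterated_log q (2 * S) `^ sig) in E2S T2 *.
rewrite /nevanlinna_T in T1 T2.
have l1 := ln1 S tS.
have : pole_count f S * ln (2 * S) <= 2 * Y * ln (2 * S).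
  by rewrite ler_wpM2r//; lra.
have : Y * 1 <= Y * ln (2 * S) by rewrite ler_wpM2l//; lra.
by lra.
Qed.

(** If the order of [g] is below [rho], then [growth_comparison] makes any type,
    for instance [tau / 2], sufficient; if it equals [rho], any number between
    the type of [g] and [tau] does. *)
Lemma coefficient_growth (p q : nat) (rho tau : R) g : (q <= p)%N -> entire g ->
  0 < rho -> 0 < tau ->
  (pq_order p.+1 q.+1 g <= rho%:E)%E ->
  (pq_order p.+1 q.+1 g = rho%:E -> (pq_type p.+1 q.+1 g < tau%:E)%E) ->
  exists2 tau', tau' < tau & exists r0, forall z, r0 <= modulus z ->
    modulus (g z) <=
      expR (iterated_exp p (tau' * iterated_log q (modulus z) `^ rho)).
Proof.
move=> qp eg rho0 tau0; rewrite le_eqVlt => /predU1P[grho|glt _]; last first.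
  have tau2 : 0 < tau / 2 by lra.
  exists (tau / 2); first by lra.
  have [t t1 tP] := large_radius q.
  have Epos r sig : 0 < sig -> t <= r -> 1 <= iterated_exp p ((10 * iterated_log q r) `^ sig).
    move=> sig0 /tP[_ _ _ _ L1]; apply: le_trans (iterated_exp_ge_id p _).
    rewrite -[leLHS](powRr0 (10 * iterated_log q r)) ler_powR//; first lra.
    exact: ltW.
  move: glt; rewrite /pq_order; case: asboolP => [grat _|_].
    have [K [r1 [K0 r11 gle _]]] := rational_function_growth grat.
    have rho2 : 0 < rho / 2 by lra.
    have [|r2 _ H] := @growth_comparison R q p K (rho / 2) rho (tau / 2) qp rho2 _ tau2.
      by lra.
    exists (Num.max t (Num.max r1 r2)) => z; rewrite !ge_max => /and3P[tz z1 z2].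
    apply: (le_trans (gle z z1)); rewrite ler_expR; apply: le_trans (H _ z2).
    have [m1 _ _ _ _] := tP _ tz.
    apply: (@le_trans _ _ (K * ln (10 * modulus z))).
      by rewrite ler_wpM2l ?(ltW K0)// ler_ln ?posrE; lra.
    rewrite ler_peMr ?Epos// mulr_ge0 ?(ltW K0)// ln_ge0//; lra.
  case: asboolP => // _ /(ereal_between rho0)[sig [sig0 sigrho]].
  move=> /order_bound[r1 r11 H].
  have [r2 _ H2] := @growth_comparison R q p 1 sig rho (tau / 2) qp sig0 sigrho tau2.
  exists (Num.max t (Num.max r1 r2)) => z; rewrite !ge_max => /and3P[tz z1 z2].
  have [m1 em _ _ L1] := tP _ tz; have m0 : 0 < modulus z by lra.
  apply: (le_trans (max_modulus_ge eg m0)); apply: (le_trans (H _ z1)).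
  rewrite iterated_expSr powR_expR; last by lra.
  rewrite ler_expR; apply: le_trans (H2 _ z2); rewrite mul1r.
  apply: (@le_trans _ _ (iterated_exp p ((10 * iterated_log q (modulus z)) `^ sig))).
    apply: iterated_exp_mono; apply: ge0_ler_powR; rewrite ?nnegrE ?(ltW sig0)//; lra.
  rewrite ler_peMl ?(le_trans ler01 (Epos _ _ sig0 tz))//.
  by rewrite -[leLHS]expRK ler_ln ?posrE ?expR_gt0//; lra.
move=> /(_ grho); rewrite /pq_type; case: asboolP => // _.
move=> /(ereal_between tau0)[tau' [tau'0 tau'tau]] /limsup_infty_lt[r1 H].
exists tau' => //; have [t t1 tP] := large_radius q.
exists (Num.max t (r1 + 1)) => z; rewrite ge_max => /andP[tz z1].
have [m1 _ _ _ L1] := tP _ tz; have m0 : 0 < modulus z by lra.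
apply: (le_trans (max_modulus_ge eg m0)).
have r1z : r1 < modulus z by lra.
have := H _ r1z; rewrite lte_fin grho ltr_pdivrMr; last by rewrite powR_gt0//=; lra.
by move=> /ltW Hz; exact: (@iterated_log_le _ p.+1 _ _ Hz).
Qed.

End CharacteristicGrowth.

(** * The lower bound of the order *)

(** By continuity of the power function; [e] is the proportion by which a radius
    may be enlarged without closing the gap between two types. *)
Lemma power_margin (R : realType) (rho t t' : R) : 0 < rho -> 0 < t -> t < t' ->
  exists2 e, 0 < e <= 2^-1 & t * (1 + e) `^ rho <= t'.
Proof.
move=> rho0 t0 tt'; pose c := t' / t.
have c1 : 1 < c by rewrite /c ltr_pdivlMr// mul1r.
have c0 : 0 < c := lt_trans ltr01 c1.
pose x := c `^ rho^-1; have x1 : 1 < x.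
  have : 1 `^ rho^-1 < c `^ rho^-1.
    by apply: gt0_ltr_powR; rewrite ?invr_gt0 ?nnegrE ?(ltW c0).
  by rewrite powR1.
exists (Num.min 2^-1 (x - 1)).
  by rewrite ge_min lexx/= andbT lt_min subr_gt0 x1 andbT invr_gt0.
set e := Num.min _ _; have ex : 1 + e <= x by rewrite addrC -lerBrDr ge_min lexx orbT.
have e0 : 0 < e by rewrite lt_min subr_gt0 x1 andbT invr_gt0.
rewrite mulrC -ler_pdivlMr// -/c.
have -> : c = x `^ rho by rewrite /x -powRrM mulVf ?gt_eqF// powRr1// ltW.
by apply: ge0_ler_powR; rewrite ?nnegrE ?(ltW rho0)//; lra.
Qed.

Theorem theorem19 (R : realType) (p q k : nat)
    (A : 'I_k.+1 -> R[i] -> R[i]) (c : 'I_k -> R[i]) (l : 'I_k.+1) :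
  (1 <= q)%N -> (q <= p)%N -> (2 <= k)%N ->
  (forall j, entire (A j)) ->
  (forall j, exists z, A j z <> 0) ->
  injective c -> (forall j, c j <> 0) ->
  (forall j, j <> l -> (pq_order p q (A j) <= pq_order p q (A l))%E) ->
  (forall j, j <> l -> pq_order p q (A j) = pq_order p q (A l) ->
     (pq_type p q (A j) < pq_type p q (A l))%E) ->
  (0 < pq_order p q (A l))%E -> (pq_order p q (A l) < +oo)%E ->
  (0 < pq_type p q (A l))%E -> (pq_type p q (A l) < +oo)%E ->
  forall f : R[i] -> R[i],
    meromorphic f ->
    (exists z, ~ has_pole f z /\ f z <> 0) ->
    (forall z, ~ has_pole f z -> (forall j, ~ has_pole f (z + c j)) ->
       \sum_(j < k) A (lift ord0 j) z * f (z + c j) + A ord0 z * f z = 0) ->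
    (pq_order p q (A l) <= pq_order p q f)%E.
Proof.
case: q => [/notF[]|q _]; case: p => [/notF[]|p]; rewrite ltnS => qp _.
move=> A_entire _ _ _ A_order A_type; set order := pq_order p.+1 q.+1 (A l).
set type := pq_type p.+1 q.+1 (A l) => order_gt0 order_fin type_gt0 type_fin f fm fn0 feq.
pose rho := fine order; pose tau := fine type.
have orderE : order = rho%:E by rewrite fineK// gt0_fin_numE.
have typeE : type = tau%:E by rewrite fineK// gt0_fin_numE.
have rho0 : 0 < rho by rewrite -lte_fin -orderE.
have tau0 : 0 < tau by rewrite -lte_fin -typeE.
rewrite leNgt; apply/negP; rewrite orderE.
move=> /(characteristic_growth rho0 fm)[sig [K1 [r1 [sig0 sigrho K10 f_growth]]]].
(* The unshifted term becomes the shift by [0], so that all terms look alike. *)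
pose sh (j : 'I_k.+1) : R[i] := if unlift ord0 j is Some i then c i else 0.
have equation z : (forall j, ~ has_pole f (z + sh j)) ->
    \sum_j A j z * f (z + sh j) = 0.
  have sh0 : sh ord0 = 0 by rewrite /sh unlift_none.
  have shS i : sh (lift ord0 i) = c i by rewrite /sh liftK.
  move=> free; rewrite big_ord_recl sh0 addr0 addrC.
  under eq_bigr do rewrite shS.
  apply: feq; first by have := free ord0; rewrite sh0 addr0.
  by move=> i; have := free (lift ord0 i); rewrite shS.
pose E (x : R) := iterated_exp p x; pose L (r : R) := iterated_log q r.
(* One gap below [tau] and one radius serve for all coefficients but [A l]:
   [gap] and [gap^-1]. *)
have [gap /andP[gap0 _] coeff] : exists2 d : R, 0 < d <= 1 & forall j, j != l ->
    forall z, d^-1 <= ComplexField.Normc.normc z -> ComplexField.Normc.normc (A j z) <=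
      expR (E ((tau - d) * L (ComplexField.Normc.normc z) `^ rho)).
  apply: common_threshold => j.
  have [->|jl] := eqVneq j l; first by exists 1.
  have /eqP jl' := jl.
  have [||tau' tau'tau [r0 H]] := @coefficient_growth R p q rho tau (A j) qp (A_entire j) rho0 tau0.
  - by rewrite -orderE; exact: A_order.
  - by rewrite -orderE -typeE; exact: A_type.
  exists (Num.min (tau - tau') (Num.max 1 r0)^-1).
    by rewrite lt_min subr_gt0 tau'tau invr_gt0 lt_max ltr01.
  move=> d /andP[d0]; rewrite le_min => /andP[d1 d2] _ z zd.
  have zr : r0 <= ComplexField.Normc.normc z.
    apply: le_trans zd; rewrite -[leLHS]invrK.
    have m0 : 0 < Num.max 1 r0 by rewrite lt_max ltr01.
    apply: (@le_trans _ _ (Num.max 1 r0)); first by rewrite invrK le_max lexx orbT.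
    by rewrite -[leLHS]invrK lef_pV2 ?posrE ?invr_gt0.
  apply: (le_trans (H z zr)); rewrite ler_expR; apply: iterated_exp_mono.
  by rewrite ler_wpM2r ?powR_ge0//; lra.
pose tau2 := Num.max (tau - gap) (tau / 2).
have [tau20 tau2tau] : 0 < tau2 /\ tau2 < tau.
  by rewrite lt_max gt_max; split; [apply/orP; right; lra|apply/andP; split; lra].
(* The three thirds of the gap between [tau2] and [tau] absorb, in this order,
   the enlargement of the radius, the contribution of [f], and the distance to
   the upper limit that defines the type of [A l]. *)
pose h := (tau - tau2) / 3; have h0 : 0 < h by rewrite divr_gt0// subr_gt0.
have [e e01 eP] : exists2 e : R, 0 < e <= 2^-1 & tau2 * (1 + e) `^ rho <= tau2 + h.
  by apply: power_margin => //; rewrite ltrDl.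
have /andP[e0 e1] := e01.
have [K2 [r2 [K20 estimate]]] := coefficient_estimate l fm A_entire equation fn0.
have [r3 _ growth] := growth_comparison (K2 / e * K1) qp sig0 sigrho h0.
have [t t1 tP] := large_radius R q.
(* [h * L r `^ rho] has to exceed [1] in order that [iterated_expD] applies. *)
have [t2 t21 L_large] := powR_unbounded (h^-1 + 1) rho0.
pose r4 := Num.max (Num.max r1 r2) (Num.max (Num.max r3 t) (Num.max gap^-1 (iterated_exp q t2))).
have [r r4r type_r] : exists2 r, r4 < r & ((tau2 + 2 * h)%:E <
    (iterated_log p.+1 (max_modulus (A l) r) / L r `^ rho)%:E)%E.
  have : ((tau2 + 2 * h)%:E < type)%E by rewrite typeE lte_fin /h; lra.
  rewrite /type /pq_type asboolT; last exact: A_entire.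
  by move=> /limsup_infty_gt; apply.
have := ltW r4r; rewrite !ge_max => /andP[/andP[r1r r2r] /andP[/andP[r3r tr] /andP[gapr t2r]]].
have [rge1 _ rq0 rq1 L1] := tP r tr.
have Lt2 : t2 <= L r by exact: iterated_log_ge.
have Lrho : h^-1 + 1 <= L r `^ rho := L_large _ Lt2.
have [s [S [/andP[rs sr] /andP[rS Sr] S_free bound]]] := estimate r e r2r e01.
have r0 : 0 < r by lra.
have ler0 : 0 < L r `^ rho by rewrite powR_gt0//; lra.
have [z zr Az] : exists2 z, ComplexField.Normc.normc z = r &
    expR (E ((tau2 + 2 * h) * L r `^ rho)) < ComplexField.Normc.normc (A l z).
  apply: max_modulus_gt; first exact: ltW.
  apply: (@iterated_log_gt _ p.+1); first by rewrite mulr_ge0 ?(ltW ler0)//; lra.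
  by move: type_r; rewrite lte_fin ltr_pdivlMr.
have Ls : L s <= (1 + e) * L r.
  apply: (@le_trans _ _ (L ((1 + e) * r))).
    by apply: iterated_log_mono; [lra|rewrite mulrC].
  by apply: iterated_log_scale; [lra|].
have coeff_s j w : j != l -> ComplexField.Normc.normc w = s ->
    ComplexField.Normc.normc (A j w) <= expR (E ((tau2 + h) * L r `^ rho)).
  move=> jl ws; have := coeff j jl w; rewrite ws => /(_ _)/le_trans; apply.
    by apply: le_trans gapr (ltW rs).
  rewrite ler_expR; apply: iterated_exp_mono.
  have Ls0 : 0 <= L s by rewrite (le_trans ler01)// (le_trans L1)// iterated_log_mono// ltW.
  have L0 : 0 <= L r by lra.
  apply: (@le_trans _ _ (tau2 * L s `^ rho)).
    by rewrite ler_wpM2r ?powR_ge0// le_max lexx.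
  apply: (@le_trans _ _ (tau2 * ((1 + e) * L r) `^ rho)).
    rewrite ler_wpM2l ?(ltW tau20)//; apply: ge0_ler_powR; rewrite ?nnegrE ?(ltW rho0)//.
    by rewrite mulr_ge0//; lra.
  rewrite powRM ?addr_ge0 ?(ltW e0)// mulrA ler_wpM2r ?powR_ge0//.
have E_ge0 : 0 <= E ((tau2 + h) * L r `^ rho).
  by apply: le_trans (iterated_exp_ge_id p _); rewrite mulr_ge0 ?(ltW ler0)//; lra.
(* It remains to contradict this by showing that the other coefficients and the
   contribution of [f] stay below the growth of [A l] at [z]. *)
have := lt_le_trans Az (bound z _ zr E_ge0 coeff_s); rewrite ltr_expR.
apply/negP; rewrite -leNgt.
have r1S : r1 <= S by lra.
have fS := f_growth S r1S S_free.
have S2 : 2 * S <= 10 * r by lra.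
have S2r : r <= 2 * S by lra.
have L2S : L (2 * S) <= 10 * L r.
  apply: (@le_trans _ _ (L (10 * r))).
    by apply: iterated_log_mono => //; apply: le_trans S2r.
  by apply: iterated_log_scale => //; rewrite ler1n.
have L2S0 : 0 <= L (2 * S) by rewrite (le_trans ler01)// (le_trans L1)// iterated_log_mono.
have K2e : 0 <= K2 / e by rewrite divr_ge0// ltW.
have error : K2 / e * (1 + proximity f S + pole_count f S * ln (2 * S)) <=
    E (h * L r `^ rho).
  apply: le_trans (growth r r3r).
  rewrite -[in leRHS](mulrA (K2 / e)) -[leRHS]mulrA ler_wpM2l//.
  apply: (le_trans fS); rewrite -!mulrA ler_wpM2l//.
  have pos x : 0 <= iterated_exp p (x `^ sig).
    by apply: le_trans (iterated_exp_ge_id p _); exact: powR_ge0.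
  apply: ler_pM => //; first by rewrite ln_ge0//; lra.
    by rewrite ler_ln ?posrE//; lra.
  apply: iterated_exp_mono; apply: ge0_ler_powR; rewrite ?nnegrE ?(ltW sig0)//; lra.
have hL : 1 <= h * L r `^ rho.
  have := ler_wpM2l (ltW h0) Lrho; rewrite mulrDr divff ?gt_eqF//; lra.
have tL : 1 <= (tau2 + h) * L r `^ rho.
  by apply: (le_trans hL); rewrite mulrDl lerDr mulr_ge0 ?(ltW tau20) ?(ltW ler0).
apply: (le_trans (lerD (lexx _) error)).
apply: (le_trans (iterated_expD p tL hL)); apply: iterated_exp_mono.
by rewrite -mulrDl ler_wpM2r ?(ltW ler0)//; lra.
Qed.
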